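(* Let $N\ge1$, let $\Omega\subset\mathbb{R}^N$ be a bounded open set, $K\subset\Omega$ compact and $s\in(0,\min\{1,N/2\})$. Then $\lambda_k^s(\Omega)=\lambda_k^s(\Omega\setminus K)$ for every integer $k\ge1$ if and only if $\mathrm{Cap}^s_\Omega(K)=0$.
   Context: For an open set $\Omega\subset\mathbb{R}^N$ and $s\in(0,\min\{1,N/2\})$, $\mathcal{D}^{s,2}(\Omega)$ is the completion of $C^\infty_c(\Omega)$ with respect to the Gagliardo norm $[u]_{H^s(\mathbb{R}^N)}=\big(\int_{\mathbb{R}^N}\int_{\mathbb{R}^N}\frac{|u(x)-u(y)|^2}{|x-y|^{N+2s}}dx\,dy\big)^{1/2}$ (functions extended by $0$ outside $\Omega$, so that $\mathcal{D}^{s,2}(\Omega)\subset\mathcal{D}^{s,2}(\mathbb{R}^N)$). It is a Hilbert space with scalar product $$(u,v)_{\mathcal{D}^{s,2}(\Omega)}=\frac{C(N,s)}{2}\int_{\mathbb{R}^N}\int_{\mathbb{R}^N}\frac{(u(x)-u(y))(v(x)-v(y))}{|x-y|^{N+2s}}\,dx\,dy,\qquad C(N,s)=\pi^{-N/2}2^{2s}\frac{\Gamma(\frac{N+2s}{2})}{\Gamma(2-s)}s(1-s),$$ and norm $\|u\|_{\mathcal{D}^{s,2}(\Omega)}=(u,u)_{\mathcal{D}^{s,2}(\Omega)}^{1/2}$. Eigenvalues: for a bounded open set $\Omega$, $\lambda\in\mathbb{R}$ is an eigenvalue of the restricted fractional Laplacian $(-\Delta)^s$ in $\Omega$ with homogeneous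 Dirichlet conditions in $\mathbb{R}^N\setminus\Omega$ if there is $u\in\mathcal{D}^{s,2}(\Omega)\setminus\{0\}$ with $(u,v)_{\mathcal{D}^{s,2}(\Omega)}=\lambda\int_{\mathbb{R}^N}uv\,dx$ for all $v\in\mathcal{D}^{s,2}(\Omega)$. The eigenvalues form a diverging sequence $0<\lambda_1^s(\Omega)\le\lambda_2^s(\Omega)\le\dots\to+\infty$, repeated according to their (finite) multiplicity. The same definition applies to the bounded open set $\Omega\setminus K$. Capacity: let $\zeta_K\in C_c^\infty(\Omega)$ be such that $\zeta_K=1$ in a neighborhood of $K$. Then $$\mathrm{Cap}^s_\Omega(K)=\inf\{\|u\|^2_{\mathcal{D}^{s,2}(\Omega)}: u\in\mathcal{D}^{s,2}(\Omega),\ u-\zeta_K\in\mathcal{D}^{s,2}(\Omega\setminus K)\}.$$ *)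

(* Defs.v *)
From HB Require Import structures.
From mathcomp Require Import all_boot all_order all_algebra.
From mathcomp Require Import all_classical all_reals all_analysis.

Set Implicit Arguments.
Unset Strict Implicit.
Unset Printing Implicit Defensive.

Import Order.TTheory GRing.Theory Num.Theory.
Import numFieldNormedType.Exports.

Local Open Scope classical_set_scope.
Local Open Scope ring_scope.

(* The Borel sigma-algebra of R^N = 'rV[R]_N, generated by the N coordinate
   projections. *)
Section borel_rV.
Context {R : realType} (N : nat).

Definition rV_measurable : set (set 'rV[R]_N) :=
  g_sigma_preimage (fun (i : 'I_N) (x : 'rV[R]_N) => x ord0 i : measurableTypeR R).

Let rV_set0 : rV_measurable set0.
Proof. exact: sigma_algebra0. Qed.

Let rV_setC A : rV_measurable A -> rV_measurable (~` A).
Proof. exact: sigma_algebraC. Qed.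

Let rV_bigcup (F : (set 'rV[R]_N)^nat) : (forall i, rV_measurable (F i)) ->
  rV_measurable (\bigcup_i (F i)).
Proof. exact: sigma_algebra_bigcup. Qed.

Fact rV_display : measure_display. Proof. exact: default_measure_display. Qed.

HB.instance Definition _ := @isMeasurable.Build rV_display
  'rV[R]_N rV_measurable rV_set0 rV_setC rV_bigcup.

Lemma measurable_rV_coord (i : 'I_N) :
  measurable_fun [set: 'rV[R]_N] (fun x => x ord0 i : measurableTypeR R).
Proof.
move=> _ Y mY; rewrite setTI; apply: sub_sigma_algebra => /=.
rewrite -bigcup_seq/=; exists i => /=; first by rewrite mem_index_enum.
by exists Y => //; rewrite setTI.
Qed.

Lemma measurable_rV d (T : measurableType d) (f : T -> 'rV[R]_N) :
  (forall i, measurable_fun [set: T] (fun t => f t ord0 i : measurableTypeR R)) ->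
  measurable_fun [set: T] f.
Proof.
move=> mf.
suff H : @measurable _ 'rV[R]_N `<=` [set A | measurable (f @^-1` A)].
  by move=> _ A mA; rewrite setTI; exact: H.
apply: smallest_sub.
  split => /=.
  - by rewrite preimage_set0; exact: measurable0.
  - by move=> A mA; rewrite setTD -preimage_setC; exact: measurableC.
  - by move=> F mF; rewrite preimage_bigcup; exact: bigcup_measurable.
move=> A; rewrite -bigcup_seq => -[i _ [B mB <-]] /=.
by rewrite setTI -[_ @^-1` _]setTI; exact: mf.
Qed.

End borel_rV.

(* Lebesgue measure on R^N, by recursion on N: Dirac mass on R^0, and the image
   of the product measure under R x R^N ~ R^(N+1). *)
Section lebesgue_rV.
Context {R : realType}.

Definition rV_cons (n : nat) (z : measurableTypeR R * 'rV[R]_n) : 'rV[R]_n.+1 :=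
  \row_i oapp (z.2 ord0) z.1 (unlift ord0 i).

Definition rV_uncons (n : nat) (v : 'rV[R]_n.+1) : measurableTypeR R * 'rV[R]_n :=
  (v ord0 ord0, \row_i v ord0 (lift ord0 i)).

Lemma rV_consK n : cancel (@rV_cons n) (@rV_uncons n).
Proof.
move=> [x v]; rewrite /rV_uncons !mxE unlift_none; congr pair.
by apply/rowP => i; rewrite !mxE liftK.
Qed.

Lemma measurable_rV_cons n : measurable_fun setT (@rV_cons n).
Proof.
apply: measurable_rV => i.
rewrite (_ : (fun _ => _) =
  (fun z : measurableTypeR R * 'rV[R]_n => oapp (z.2 ord0) z.1 (unlift ord0 i))); last first.
  by apply/funext => z; rewrite mxE.
case: unliftP => [j _|_] /=; last exact: measurable_fst.
exact: (measurableT_comp (measurable_rV_coord j) measurable_snd).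
Qed.

Lemma measurable_rV_uncons n : measurable_fun setT (@rV_uncons n).
Proof.
apply: measurable_fun_pair; first exact: measurable_rV_coord.
apply: measurable_rV => i.
under eq_fun do rewrite mxE.
exact: measurable_rV_coord.
Qed.

HB.instance Definition _ n :=
  isMeasurableFun.Build _ _ _ _ (@rV_cons n) (@measurable_rV_cons n).

Section step.
Variables (n : nat) (m1 : {sigma_finite_measure set (measurableTypeR R) -> \bar R}).
Variable (m : {sigma_finite_measure set 'rV[R]_n -> \bar R}).

Definition leb_step : set 'rV[R]_n.+1 -> \bar R :=
  pushforward (m1 \x m)%E (@rV_cons n).

Let leb_step0 : leb_step set0 = 0%E.
Proof. exact: measure0. Qed.

Let leb_step_ge0 A : (0 <= leb_step A)%E.
Proof. exact: measure_ge0. Qed.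

Let leb_step_sigma_additive : semi_sigma_additive leb_step.
Proof. exact: measure_semi_sigma_additive. Qed.

HB.instance Definition _ := isMeasure.Build _ _ _ leb_step
  leb_step0 leb_step_ge0 leb_step_sigma_additive.

Let leb_step_sigma_finite : sigma_finite setT leb_step.
Proof.
have /sigma_finiteP[F [TF ndF Foo]] := sigma_finiteT m1.
have /sigma_finiteP[G [TG ndG Goo]] := sigma_finiteT m.
exists (fun k => @rV_uncons n @^-1` (F k `*` G k)).
  apply/esym; rewrite -subTset => v _.
  have [i _ Fi] : (\bigcup_k F k) (rV_uncons v).1 by rewrite -TF.
  have [j _ Gj] : (\bigcup_k G k) (rV_uncons v).2 by rewrite -TG.
  exists (maxn i j) => //; split.
  - by move: Fi; exact/subsetPset/ndF/leq_maxl.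
  - by move: Gj; exact/subsetPset/ndG/leq_maxr.
move=> k; have [mF Fk] := Foo k; have [mG Gk] := Goo k; split.
  by rewrite -[_ @^-1` _]setTI; apply: measurable_rV_uncons => //; exact: measurableX.
rewrite /leb_step /pushforward -comp_preimage.
rewrite (_ : _ \o _ = id); last by apply/funext => z /=; rewrite rV_consK.
by rewrite preimage_id product_measure1E// lte_mul_pinfty// ge0_fin_numE.
Qed.

HB.instance Definition _ :=
  Measure_isSigmaFinite.Build _ _ _ leb_step leb_step_sigma_finite.

End step.

Fixpoint leb (N : nat) : {sigma_finite_measure set 'rV[R]_N -> \bar R} :=
  match N with
  | 0 => \d_(0 : 'rV[R]_0)
  | n.+1 => leb_step (@lebesgue_measure R) (leb n)
  end.

Lemma leb_box (N : nat) (A : 'I_N -> set (measurableTypeR R)) :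
  (forall i, measurable (A i)) ->
  leb N [set v | forall i, A i (v ord0 i)] =
    (\prod_(i < N) lebesgue_measure (A i))%E.
Proof.
elim: N A => [|n IHn] A mA /=.
  by rewrite big_ord0 diracE mem_set// => -[].
rewrite big_ord_recl -IHn// -product_measure1E//; last first.
  rewrite (_ : (fun x : 'rV[R]_n => _) =
    \bigcap_i [set v : 'rV[R]_n | A (lift ord0 i) (v ord0 i)]); last first.
    by apply/seteqP; split => v /=; [move=> Av i _|move=> Av i]; exact: Av.
  apply: fin_bigcap_measurable => // i _.
  by rewrite -[X in measurable X]setTI; exact: measurable_rV_coord.
congr product_measure1; apply/seteqP; split => -[x v] /=.
- move=> Av; split; first by have := Av ord0; rewrite mxE unlift_none.
  by move=> i; have := Av (lift ord0 i); rewrite mxE liftK.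
- by move=> [Ax Av] i; rewrite mxE; case: unliftP => [j ->|->].
Qed.

End lebesgue_rV.

Definition GammaR {R : realType} (a : R) : R :=
  \int[@lebesgue_measure R]_(t in `]0, +oo[) (t `^ (a - 1) * expR (- t)).

(* The constant C(N,s) of the fractional Laplacian (-Delta)^s on R^N. *)
Definition fracC {R : realType} (N : nat) (s : R) : R :=
  pi `^ (- (N%:R / 2)) * 2 `^ (2 * s) *
  (GammaR ((N%:R + 2 * s) / 2) / GammaR (2 - s)) * s * (1 - s).

Section fractional.
Context {R : realType} {N : nat}.
Implicit Types (s lambda : R) (Omega K : set 'rV[R]_N) (u v : 'rV[R]_N -> R).

(* The library norm on 'rV[R]_N is the sup norm. *)
Definition eucl (x : 'rV[R]_N) : R := Num.sqrt (\sum_(i < N) x ord0 i ^+ 2).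

Fixpoint class_C (k : nat) (f : 'rV[R]_N -> R) : Prop :=
  continuous f /\
  match k with
  | 0 => True
  | k'.+1 => forall i : 'I_N,
      (forall x, derivable f x (delta_mx ord0 i)) /\
      class_C k' (fun x => 'D_(delta_mx ord0 i) f x)
  end.

Definition smooth (f : 'rV[R]_N -> R) : Prop := forall k, class_C k f.

(* C_c^oo(Omega), extended by 0 to R^N *)
Definition test_function Omega (f : 'rV[R]_N -> R) : Prop :=
  [/\ smooth f, compact (closure [set x | f x != 0]) &
      closure [set x | f x != 0] `<=` Omega].

(* Numerator and kernel vanish on the diagonal, where 0 / 0 = 0; the diagonal
   is negligible when N >= 1. *)
Definition gagliardo_kernel s (z : 'rV[R]_N * 'rV[R]_N) : R :=
  eucl (z.1 - z.2) `^ (N%:R + 2 * s).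

(* [u]_{H^s(R^N)}^2, possibly infinite *)
Definition gagliardo2 s u : \bar R :=
  (\int[leb N \x leb N]_z ((u z.1 - u z.2) ^+ 2 / gagliardo_kernel s z)%:E)%E.

(* D^{s,2}(Omega), the completion of C_c^oo(Omega) for the Gagliardo norm,
   realized as a space of (Borel representatives of) functions on R^N: for
   s < N/2, Sobolev's inequality gives every Cauchy sequence of test functions
   an a.e. convergent subsequence whose limit determines its class.  The a.e.
   convergence also rules out adding constants, which the Gagliardo seminorm
   does not see. *)
Definition Dspace s Omega : set ('rV[R]_N -> R) :=
  [set u | measurable_fun [set: 'rV[R]_N] u /\
    exists phi : nat -> 'rV[R]_N -> R,
      [/\ forall n, test_function Omega (phi n),
          gagliardo2 s (phi n \- u) @[n --> \oo] --> 0%E &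
          {ae leb N, forall x, phi n x @[n --> \oo] --> u x}]].

Definition Ddot s u v : R :=
  fracC N s / 2 *
  \int[(leb N \x leb N)%E]_z
    ((u z.1 - u z.2) * (v z.1 - v z.2) / gagliardo_kernel s z).

Definition frac_eigenspace s Omega lambda : set ('rV[R]_N -> R) :=
  [set u | Dspace s Omega u /\ forall v, Dspace s Omega v ->
    Ddot s u v = lambda * \int[leb N]_x (u x * v x)].

Definition is_eigenvalue s Omega lambda : Prop :=
  exists2 u, frac_eigenspace s Omega lambda u & ~ {ae leb N, forall x, u x = 0}.

(* E has dimension m, functions being identified when they agree a.e. *)
Definition has_dim (E : set ('rV[R]_N -> R)) (m : nat) : Prop :=
  exists e : 'I_m -> 'rV[R]_N -> R,
    [/\ forall i, E (e i),
        forall c : 'I_m -> R,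
          {ae leb N, forall x, \sum_(i < m) c i * e i x = 0} ->
          forall i, c i = 0 &
        forall u, E u -> exists c : 'I_m -> R,
          {ae leb N, forall x, u x = \sum_(i < m) c i * e i x}].

(* l 0 <= l 1 <= ... -> +oo lists the eigenvalues, each repeated according to
   its (finite) multiplicity. *)
Definition eigenvalue_enumeration s Omega (l : nat -> R) : Prop :=
  [/\ {homo l : i j / (i <= j)%N >-> i <= j},
      l k @[k --> \oo] --> +oo,
      forall k, is_eigenvalue s Omega (l k) &
      forall lambda, is_eigenvalue s Omega lambda ->
        exists2 m, has_dim (frac_eigenspace s Omega lambda) m &
                   ([set k | l k = lambda] #= `I_m)%card].

(* lambda_k^s(Omega) for k >= 1; the enumeration, unique when it exists, starts
   at index 0. *)
Definition frac_eigenvalue s Omega (k : nat) : R :=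
  xget (fun=> 0) [set l | eigenvalue_enumeration s Omega l] k.-1.

Definition cutoff Omega K (zeta : 'rV[R]_N -> R) : Prop :=
  test_function Omega zeta /\
  exists U : set 'rV[R]_N, [/\ open U, K `<=` U & forall x, U x -> zeta x = 1].

(* Cap_Omega^s(K), computed with the cutoff zeta *)
Definition capacity s Omega K (zeta : 'rV[R]_N -> R) : R :=
  inf [set Ddot s u u | u in
    [set u | Dspace s Omega u /\ Dspace s (Omega `\` K) (u \- zeta)]].

End fractional.

(* Main.v *)
Require Import Defs.
From HB Require Import structures.
From mathcomp Require Import all_boot all_order all_algebra.
From mathcomp Require Import all_classical all_reals all_analysis.
From mathcomp Require Import measurable_realfun ring lra.

Set Implicit Arguments.
Unset Strict Implicit.
Unset Printing Implicit Defensive.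

Import Order.TTheory GRing.Theory Num.Theory.
Import numFieldNormedType.Exports.

Local Open Scope classical_set_scope.
Local Open Scope ring_scope.

(** Both conditions are equivalent to [zeta] belonging to [V1 = D(Omega \ K)], a closed
subspace of [V = D(Omega)].

If the capacity vanishes, some [u_n] tend to [0] in [V] with [zeta - u_n] in [V1], so that
[zeta] is in [V1].  Conversely, [u = 0] is then admissible.  If [zeta] is in [V1], every test
function [phi] of [Omega] splits as [(1 - zeta) phi + zeta phi] with both terms in [V1]: the
first one is supported away from [K], and [V1] is stable under multiplication by [phi].
Hence [V = V1], and all eigenvalues agree.

If all eigenvalues agree, then, by induction on the min-max level, each eigenvector of [V1]
is an eigenvector of [V]: the eigenvectors of [V] below its level lie in [V1] because the
eigenspaces have the same dimension, so that it minimizes the Rayleigh quotient of [V] on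
their orthogonal.  So every eigenspace of [V1] sits in the one of [V] and fills it.  The
Fourier sums of any [v] in [V] are thus in [V1], and [V = V1].

The spectral theory is that of two nonnegative forms on a space of functions.  The compact
embedding in [L^2] comes from averaging over small cubes,
[\int_Q u^2 = (2 |Q|)^-1 \iint_(Q x Q) (u(x) - u(y))^2 + |Q|^-1 (\int_Q u)^2], and the
Poincare inequality from the interaction of a bounded set with a far away cube. *)

(** * Nonnegative forms *)

(** The obstacle is that an eigenvector of [V1] is tested against [V1] only, so nothing makes it an
    eigenvector of the larger [V], and equal eigenvalues say nothing directly about vectors. What is
    extracted from them is an equality of dimensions: two nested eigenspaces of the same finite
    dimension coincide, and this brings eigenvectors of [V] into [V1]. The given sequences serve for
    nothing else; the comparison runs on two independently built eigenbases.

    Functions are never identified almost everywhere, so the forms are only semidefinite and vectors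
    are determined up to null vectors of [b]. Hence [V1] has to absorb null vectors and dimensions
    are counted modulo them. Compactness is stated through finitely many functionals: this yields
    the minimizers and, by a dimension count, the divergence of the eigenvalues.

    No smooth bump is built from scratch: when [K] is nonempty, [zeta] equals 1 on it, and rescaled
    copies of [zeta] give as many independent test functions as needed. *)

Lemma exists_left_kernel (F : fieldType) (m : nat) (M : 'M[F]_(m.+1, m)) :
  exists2 c : 'rV[F]_m.+1, c != 0 & c *m M = 0.
Proof.
have : kermx M != 0.
  by rewrite kermx_eq0 /row_free neq_ltn ltnS rank_leq_col.
case/rowV0Pn => c /sub_kermxP cM0 c0.
by exists c.
Qed.

Section PsdForms.
Context {R : realType} {E : lmodType R}.

Record subspace (V : set E) : Prop := Subspace {
  subspace0 : V 0;
  subspaceL : forall c u v, V u -> V v -> V (c *: u + v) }.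

(** The laws are required on [V] only, because a real-valued integral of a product is bilinear only
    where the products are integrable. *)
Record psd_form (V : set E) (a : E -> E -> R) : Prop := PsdForm {
  formC : forall u v, V u -> V v -> a u v = a v u;
  formL : forall c u v w, V u -> V v -> V w ->
    a (c *: u + v) w = c * a u w + a v w;
  form_ge0 : forall u, V u -> 0 <= a u u }.

Definition form_cauchy (a : E -> E -> R) (u_ : nat -> E) :=
  forall e, 0 < e -> exists n0, forall i j, (n0 <= i)%N -> (n0 <= j)%N ->
    a (u_ i - u_ j) (u_ i - u_ j) <= e.

Definition form_cvg (a : E -> E -> R) (u_ : nat -> E) (u : E) :=
  forall e, 0 < e -> exists n0, forall n, (n0 <= n)%N ->
    a (u_ n - u) (u_ n - u) <= e.

Section OneForm.
Context {V : set E} {a : E -> E -> R}.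
Hypotheses (sV : subspace V) (fa : psd_form V a).

Lemma subspaceZ c u : V u -> V (c *: u).
Proof. by move=> Vu; rewrite -[c *: u]addr0; apply: (subspaceL sV) => //; exact: subspace0. Qed.

Lemma subspaceD u v : V u -> V v -> V (u + v).
Proof. by move=> Vu Vv; rewrite -[u]scale1r; exact: (subspaceL sV). Qed.

Lemma subspaceN u : V u -> V (- u).
Proof. by move=> Vu; rewrite -scaleN1r; exact: subspaceZ. Qed.

Lemma subspaceB u v : V u -> V v -> V (u - v).
Proof. by move=> Vu Vv; apply: subspaceD => //; exact: subspaceN. Qed.

Lemma subspace_sum (I : Type) (r : seq I) (P : pred I) (c : I -> R) (f : I -> E) :
  (forall i, P i -> V (f i)) -> V (\sum_(i <- r | P i) c i *: f i).
Proof.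
move=> Vf; apply: (big_ind V); first exact: subspace0.
- by move=> *; exact: subspaceD.
- by move=> i Pi; apply: subspaceZ; exact: Vf.
Qed.

Lemma formDl u v w : V u -> V v -> V w -> a (u + v) w = a u w + a v w.
Proof. by move=> *; rewrite -[u in LHS]scale1r (formL fa)// mul1r. Qed.

Lemma form0l w : V w -> a 0 w = 0.
Proof.
move=> Vw; have V0 := subspace0 sV; have := formDl V0 V0 Vw.
by rewrite addr0; lra.
Qed.

Lemma formZl c u w : V u -> V w -> a (c *: u) w = c * a u w.
Proof.
move=> Vu Vw; have V0 := subspace0 sV.
by rewrite -[c *: u]addr0 (formL fa)// form0l// addr0.
Qed.

Lemma formBl u v w : V u -> V v -> V w -> a (u - v) w = a u w - a v w.
Proof.
move=> Vu Vv Vw; rewrite formDl//; last exact: subspaceN.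
by rewrite -scaleN1r formZl// mulN1r.
Qed.

Lemma formDr u v w : V u -> V v -> V w -> a w (u + v) = a w u + a w v.
Proof.
move=> Vu Vv Vw; rewrite (formC fa)//; last exact: subspaceD.
by rewrite formDl// !(formC fa Vw).
Qed.

Lemma formZr c u w : V u -> V w -> a w (c *: u) = c * a w u.
Proof.
move=> Vu Vw; rewrite (formC fa)//; last exact: subspaceZ.
by rewrite formZl// !(formC fa Vw).
Qed.

Lemma formBr u v w : V u -> V v -> V w -> a w (u - v) = a w u - a w v.
Proof.
move=> Vu Vv Vw; rewrite (formC fa)//; last exact: subspaceB.
by rewrite formBl// !(formC fa Vw).
Qed.

Lemma form_suml (I : Type) (r : seq I) (P : pred I) (c : I -> R) (f : I -> E) w :
  (forall i, P i -> V (f i)) -> V w ->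
  a (\sum_(i <- r | P i) c i *: f i) w = \sum_(i <- r | P i) c i * a (f i) w.
Proof.
move=> Vf Vw; elim: r => [|i r IH]; first by rewrite !big_nil form0l.
rewrite !big_cons; case: ifPn => // Pi.
rewrite (formL fa)//; [by rewrite IH|exact: Vf|exact: subspace_sum].
Qed.

Lemma form_sqrD u v : V u -> V v ->
  a (u + v) (u + v) = a u u + 2 * a u v + a v v.
Proof.
move=> Vu Vv; rewrite formDl//; last exact: subspaceD.
by rewrite !formDr// (formC fa Vv Vu); ring.
Qed.

Lemma form_sqrB u v : V u -> V v ->
  a (u - v) (u - v) = a u u - 2 * a u v + a v v.
Proof.
move=> Vu Vv; rewrite formBl//; last exact: subspaceB.
by rewrite !formBr// (formC fa Vv Vu); ring.
Qed.

Lemma form_sqrZ c u : V u -> a (c *: u) (c *: u) = c ^+ 2 * a u u.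
Proof.
move=> Vu; rewrite formZl//; last exact: subspaceZ.
by rewrite formZr// mulrA.
Qed.

Lemma form_leD u v : V u -> V v ->
  a (u + v) (u + v) <= 2 * a u u + 2 * a v v.
Proof.
move=> Vu Vv; have := form_ge0 fa (subspaceB Vu Vv).
by rewrite form_sqrB// form_sqrD//; lra.
Qed.

Lemma form_leB u v : V u -> V v ->
  a (u - v) (u - v) <= 2 * a u u + 2 * a v v.
Proof.
move=> Vu Vv; have := form_ge0 fa (subspaceD Vu Vv).
by rewrite form_sqrB// form_sqrD//; lra.
Qed.

Lemma form_symB u v : V u -> V v -> a (u - v) (u - v) = a (v - u) (v - u).
Proof.
move=> Vu Vv; rewrite -[u - v]opprB -[- (v - u)]scaleN1r form_sqrZ ?sqrrN ?expr1n ?mul1r//.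
exact: subspaceB.
Qed.

Lemma form_CauchySchwarz u v : V u -> V v -> a u v ^+ 2 <= a u u * a v v.
Proof.
move=> Vu Vv.
have key x y : V x -> V y -> 0 <= a y y * (a x x * a y y - a x y ^+ 2).
  move=> Vx Vy.
  have := form_ge0 fa (subspaceB (subspaceZ (a y y) Vx) (subspaceZ (a x y) Vy)).
  rewrite form_sqrB ?form_sqrZ ?formZl ?formZr//; do ?exact: subspaceZ.
  by move=> h; apply: le_trans h _; rewrite le_eqVlt; apply/orP; left; apply/eqP; ring.
have h1 := key u v Vu Vv; have h2 := key v u Vv Vu.
rewrite (formC fa Vv Vu) in h2.
have := form_ge0 fa Vu; rewrite le_eqVlt => /orP[/eqP u0|u0]; last first.
  by move: h2; rewrite pmulr_rge0// subr_ge0 mulrC.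
have := form_ge0 fa Vv; rewrite le_eqVlt => /orP[/eqP v0|v0]; last first.
  by move: h1; rewrite pmulr_rge0// subr_ge0.
have := form_leD Vu Vv; have := form_leB Vu Vv.
rewrite form_sqrB// form_sqrD// -u0 -v0 => h3 h4.
have -> : a u v = 0 by lra.
by rewrite expr0n/= mul0r.
Qed.

Lemma form_null u v : V u -> V v -> a u u = 0 -> a u v = 0.
Proof.
move=> Vu Vv u0; have := form_CauchySchwarz Vu Vv.
by rewrite u0 mul0r => h; apply/eqP; rewrite -sqrf_eq0 eq_le h sqr_ge0.
Qed.

Lemma form_nullD u v : V u -> V v -> a u u = 0 -> a v v = 0 -> a (u + v) (u + v) = 0.
Proof. by move=> Vu Vv u0 v0; rewrite form_sqrD// u0 v0 (form_null Vu Vv u0); ring. Qed.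

Lemma form_null_eq u v w : V u -> V v -> V w ->
  a (u - v) (u - v) = 0 -> a u w = a v w.
Proof.
move=> Vu Vv Vw uv0; apply/eqP; rewrite -subr_eq0 -formBl//.
by rewrite (form_null _ Vw uv0)//; exact: subspaceB.
Qed.

(** Write [u = u_ n - (u_ n - u)] and apply [form_leB]. The lost factor 2 is harmless, the intended
    bound being [c = 0]. *)
Lemma form_cvg_le u_ u c : (forall n, V (u_ n)) -> V u -> form_cvg a u_ u ->
  (forall e, 0 < e -> exists n0, forall n, (n0 <= n)%N -> a (u_ n) (u_ n) <= c + e) ->
  a u u <= 2 * c.
Proof.
move=> Vu_ Vu uu uc; apply/ler_addgt0Pr => e e0.
have [n0 h0] := uc (e / 4) ltac:(lra).
have [n1 h1] := uu (e / 4) ltac:(lra).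
have {}h0 := h0 _ (leq_maxl n0 n1); have {}h1 := h1 _ (leq_maxr n0 n1).
have := form_leB (Vu_ (maxn n0 n1)) (subspaceB (Vu_ (maxn n0 n1)) Vu).
by rewrite subKr; lra.
Qed.

End OneForm.

Lemma sub_subspace_form (V W : set E) a : W `<=` V -> psd_form V a -> psd_form W a.
Proof.
move=> WV [h1 h2 h3]; split.
- by move=> u v /WV Vu /WV Vv; exact: h1.
- by move=> c u v w /WV Vu /WV Vv /WV Vw; exact: h2.
- by move=> u /WV; exact: h3.
Qed.

End PsdForms.

(** * Spectral pairs: compactness and minimizers of the Rayleigh quotient *)

Section Spectral.
Context {R : realType} {E : lmodType R}.

(* Vectors are functions rather than classes: a null vector of [b] stands for a function that
   vanishes almost everywhere. *)
Record spectral_pair (V : set E) (a b : E -> E -> R) : Prop := SpectralPair {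
  sp_sub : subspace V;
  sp_a : psd_form V a;
  sp_b : psd_form V b;
  sp_poincare : exists C, forall u, V u -> b u u <= C * a u u;
  sp_null : forall u, V u -> b u u = 0 -> a u u = 0;
  sp_complete : forall u_ : nat -> E, (forall n, V (u_ n)) -> form_cauchy a u_ ->
    exists2 u, V u & form_cvg a u_ u;
  sp_compact : forall e, 0 < e ->
    exists (m : nat) (l : 'I_m -> E -> R) (C : R),
    [/\ forall j c u v, V u -> V v -> l j (c *: u + v) = c * l j u + l j v,
        forall j u, V u -> l j u ^+ 2 <= C * a u u &
        forall u, V u -> b u u <= e * a u u + \sum_j l j u ^+ 2];
  sp_infinite : forall n, exists u : 'I_n -> E, (forall i, V (u i)) /\
    forall c : 'I_n -> R,
      b (\sum_i c i *: u i) (\sum_i c i *: u i) = 0 -> forall i, c i = 0 }.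

Section OnePair.
Context {V : set E} {a b : E -> E -> R} (sp : spectral_pair V a b).
Let sV := sp_sub sp.
Let fa := sp_a sp.
Let fb := sp_b sp.

Lemma sp_poincare_gt0 : exists2 C, 0 < C & forall u, V u -> b u u <= C * a u u.
Proof.
have [C h] := sp_poincare sp; exists (`|C| + 1); first by rewrite ltr_wpDl.
move=> u Vu; apply: le_trans (h _ Vu) _; apply: ler_wpM2r; first exact: (form_ge0 fa).
by rewrite (le_trans (ler_norm C))// lerDl.
Qed.

Lemma linear_combination (l : E -> R) n (c : 'I_n -> R) (f : 'I_n -> E) :
  (forall c u v, V u -> V v -> l (c *: u + v) = c * l u + l v) ->
  (forall i, V (f i)) -> l (\sum_i c i *: f i) = \sum_i c i * l (f i).
Proof.
move=> ll Vf.
have l0 : l 0 = 0.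
  have := ll 1 0 0 (subspace0 sV) (subspace0 sV).
  by rewrite scaler0 addr0 mul1r; lra.
elim: (index_enum _) => [|i r IH]; first by rewrite !big_nil.
rewrite !big_cons ll//; first by rewrite IH.
exact: (subspace_sum sV).
Qed.

(** Among [m.+1] vectors independent modulo null vectors, [m] linear conditions leave a nontrivial
    combination. Applied to the functionals [b v x], it makes orthogonal complements of finite lists
    nontrivial. *)
Lemma killed_vector (m : nat) (l : 'I_m -> E -> R) :
  (forall j c u v, V u -> V v -> l j (c *: u + v) = c * l j u + l j v) ->
  exists v, [/\ V v, b v v != 0 & forall j, l j v = 0].
Proof.
move=> ll; have [u [Vu uindep]] := sp_infinite sp m.+1.
have [c c0 cM] := exists_left_kernel (\matrix_(i, j) l j (u i)).
exists (\sum_i c ord0 i *: u i); split.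
- exact: (subspace_sum sV).
- apply: contra c0 => /eqP /uindep c0; apply/eqP/rowP => i.
  by rewrite c0 mxE.
- move=> j; rewrite linear_combination//; last exact: ll.
  move/rowP : cM => /(_ j); rewrite !mxE => cM; rewrite -[RHS]cM.
  by apply: eq_bigr => i _; rewrite mxE.
Qed.

(* Along a free ultrafilter all the functionals of [sp_compact], for every [e], converge at
   once. *)
Lemma bounded_cauchy_subseq (v_ : nat -> E) (M : R) :
  (forall n, V (v_ n)) -> (forall n, a (v_ n) (v_ n) <= M) ->
  exists2 f : nat -> nat, (forall k, (k <= f k)%N) & form_cauchy b (v_ \o f).
Proof.
move=> Vv vM; have M0 : 0 <= M by apply: le_trans (vM 0%N); exact: (form_ge0 fa).
have [U [uU ooU]] := @ultraFilterLemma nat \oo _.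
have PU : ProperFilter U by exact: ultra_proper.
have key e : 0 < e -> exists2 A, U A & forall i j, A i -> A j ->
    b (v_ i - v_ j) (v_ i - v_ j) <= e.
  move=> e0; have e0' : 0 < e / (8 * M + 8) by rewrite divr_gt0//; lra.
  have [m [l [C [ll lC lb]]]] := sp_compact sp e0'.
  (* [mR] stands for [m] in denominators, since [m] may be 0. Two values within
     [Num.sqrt (e / (8 * mR))] of the same limit differ by at most twice that, and the [m] squares
     then sum to at most [e / 2]. *)
  have [mR mR0 mmR] : exists2 mR : R, 0 < mR & m%:R <= mR by exists m.+1%:R; rewrite ?ler_nat.
  have lB j u v : V u -> V v -> l j (u - v) = l j u - l j v.
    by move=> Vu Vw; rewrite addrC -scaleN1r ll// mulN1r addrC.
  have lcvg j : exists c : R, \forall i \near U, `|l j (v_ i) - c| < Num.sqrt (e / (8 * mR)).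
    have := @segment_compact R (- (`|C| * M + 1)) (`|C| * M + 1)
      (fmap (fun i : nat => l j (v_ i)) U) _.
    case.
      apply: (@filterS _ U _ setT) => [i _ /=|]; last exact: filterT.
      have h : l j (v_ i) ^+ 2 <= `|C| * M.
        apply: le_trans (lC j _ (Vv i)) _.
        apply: (@le_trans _ _ (`|C| * a (v_ i) (v_ i))).
          by apply: ler_wpM2r; [exact: (form_ge0 fa)|exact: ler_norm].
        by apply: ler_wpM2l.
      by rewrite in_itv/=; apply/andP; split; nra.
    move=> c [_ Uc]; exists c.
    set r := Num.sqrt _; have r0 : 0 < r by rewrite sqrtr_gt0 divr_gt0// mulr_gt0.
    (* A cluster point of an ultrafilter is a limit: the preimage of the ball or its complement
       belongs to [U], and the complement would contradict clustering. *)
    have [//|nU] := in_ultra_setVsetC [set i | `|l j (v_ i) - c| < r] uU.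
    have [x [/= nx]] := Uc [set x | ~ (`|x - c| < r)] _ nU (nbhsx_ballx c _ r0).
    by rewrite /ball/= distrC => /nx.
  have [c lc] := choice lcvg.
  exists [set i | forall j, `|l j (v_ i) - c j| < Num.sqrt (e / (8 * mR))].
    by apply: filter_forall.
  move=> i k Ai Ak; apply: le_trans (lb _ (subspaceB sV (Vv i) (Vv k))) _.
  have h1 : e / (8 * M + 8) * a (v_ i - v_ k) (v_ i - v_ k) <= e / 2.
    have := form_leB sV fa (Vv i) (Vv k); have := vM i; have := vM k.
    set x := a (_ - _) _ => h1 h2 h3.
    rewrite mulrAC ler_pdivrMr; last lra.
    by nra.
  have h2 : \sum_j l j (v_ i - v_ k) ^+ 2 <= e / 2.
    apply: (@le_trans _ _ (\sum_(j < m) (e / (2 * mR)))).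
      apply: ler_sum => j _; rewrite lB//.
      have h := Ai j; have h' := Ak j.
      set s := Num.sqrt _ in h h'.
      have ss : s ^+ 2 = e / (8 * mR).
        by rewrite sqr_sqrtr// divr_ge0 ?(ltW e0)// mulr_ge0// ltW.
      have -> : e / (2 * mR) = 4 * s ^+ 2 by rewrite ss; field; rewrite gt_eqF.
      have s0 : 0 <= s by rewrite sqrtr_ge0.
      have -> : 4 * s ^+ 2 = (2 * s) ^+ 2 by ring.
      rewrite -[leLHS]real_normK ?num_real// ler_sqr ?nnegrE ?mulr_ge0//.
      by move: h h'; rewrite !ltr_norml ler_norml; lra.
    rewrite sumr_const card_ord -[leLHS]mulr_natr.
    have -> : e / (2 * mR) * m%:R = e / 2 * (m%:R / mR).
      by field; rewrite gt_eqF.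
    by rewrite ger_pMr ?divr_gt0// ler_pdivrMr// mul1r.
  lra.
have key' (k : nat) : exists X, U X /\ (forall i j, X i -> X j ->
    b (v_ i - v_ j) (v_ i - v_ j) <= k.+1%:R^-1).
  by have [X UX hX] := key k.+1%:R^-1 ltac:(by rewrite invr_gt0); exists X.
have [A A_] := choice key'.
(* Diagonal choice: the index picked at rank [k] lies in all the sets [A 0], ..., [A k] at once, and
   beyond [k]. *)
have UA k : U (fun i => (k <= i)%N /\ forall q : 'I_k.+1, A q i).
  apply: filterI; first by apply: ooU; exists k.
  by apply: filter_forall => q; exact: (A_ q).1.
have Une k : exists i, (k <= i)%N /\ forall q : 'I_k.+1, A q i.
  exact: filter_ex (UA k).
have [f hf] := choice Une.
exists f; first by move=> k; exact: (hf k).1.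
move=> e e0; have [n0 _ hn0] := near_infty_natSinv_lt (PosNum e0).
exists n0 => i j ni nj /=.
apply: (@le_trans _ _ n0.+1%:R^-1); last by apply/ltW/hn0 => /=.
apply: (A_ n0).2.
- by have := (hf i).2 (@Ordinal i.+1 n0 ni).
- by have := (hf j).2 (@Ordinal j.+1 n0 nj).
Qed.

Lemma inv_nat_small (e : R) : 0 < e ->
  exists n0, forall n, (n0 <= n)%N -> n.+1%:R^-1 < e.
Proof. by move=> e0; have [n0 _ h] := near_infty_natSinv_lt (PosNum e0); exists n0 => n /h. Qed.

Lemma unit_scale (v : E) : 0 < b v v -> exists2 c : R, c != 0 & c ^+ 2 = (b v v)^-1.
Proof.
move=> v0; exists (Num.sqrt (b v v))^-1.
  by rewrite invr_eq0 sqrtr_eq0 -ltNge.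
by rewrite exprVn sqr_sqrtr// ltW.
Qed.

Definition orth (s : seq E) : set E := [set v | V v /\ forall x, x \in s -> b v x = 0].

Lemma orth_subspace (s : seq E) : (forall x, x \in s -> V x) -> subspace (orth s).
Proof.
move=> Vs; split.
  by split=> [|x /Vs Vx]; [exact: (subspace0 sV)|rewrite (form0l sV fb)].
move=> c u v [Vu us] [Vv vs]; split; first exact: (subspaceL sV).
by move=> x xs; rewrite (formL fb)//; [rewrite us// vs// mulr0 addr0|exact: Vs].
Qed.

(** Direct method on the orthogonal of [s]: compactness makes a minimizing sequence Cauchy for [b],
    and completeness provides the limit. *)
Lemma rayleigh_minimizer (s : seq E) : (forall x, x \in s -> V x) ->
  exists e, [/\ orth s e, b e e = 1 & forall v, orth s v -> a e e * b v v <= a v v].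
Proof.
move=> Vs; set W := orth s.
have sW : subspace W := orth_subspace Vs.
have WV : W `<=` V by move=> v [].
pose S := [set a v v | v in [set v | W v /\ b v v = 1]].
have S_unit v : W v -> b v v != 0 -> S (a v v / b v v).
  move=> Wv v0; have Vv := WV _ Wv.
  have [|c c0 cv] := @unit_scale v; first by rewrite lt0r v0 (form_ge0 fb).
  exists (c *: v); last by rewrite (form_sqrZ sV fa)// cv mulrC.
  by split; [exact: (subspaceZ sW)|rewrite (form_sqrZ sV fb)// cv mulVf].
have S0 : has_inf S.
  split; last by exists 0 => _ [v [/WV Vv _] <-]; exact: (form_ge0 fa).
  have [|v [Vv v0 vs]] := @killed_vector (size s) (fun j v => b v (nth 0 s j)).
    by move=> j c u v Vu Vv; rewrite (formL fb)//; apply/Vs/mem_nth.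
  exists (a v v / b v v); apply: S_unit => //; split => // x xs.
  have xi : (index x s < size s)%N by rewrite index_mem.
  by have := vs (Ordinal xi); rewrite /= nth_index.
set lam := inf S.
have S_lb : lbound S lam by move=> x Sx; apply: ge_inf => //; exact: S0.2.
have lam0 : 0 <= lam.
  by apply: lb_le_inf; [exact: S0.1|move=> _ [v [/WV Vv _] <-]; exact: (form_ge0 fa)].
have W_lam v : W v -> lam * b v v <= a v v.
  move=> Wv; have := form_ge0 fb (WV _ Wv); rewrite le_eqVlt => /orP[/eqP v0|v0].
    by rewrite -v0 mulr0; exact: (form_ge0 fa (WV _ Wv)).
  by rewrite -ler_pdivlMr//; apply: S_lb; apply: S_unit => //; rewrite gt_eqF.
have minseq (n : nat) : exists v, [/\ W v, b v v = 1 & a v v < lam + n.+1%:R^-1].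
  have [|_ [v [Wv v1] <-] hv] := @inf_adherent _ S n.+1%:R^-1 _ S0.
    by rewrite invr_gt0.
  by exists v.
have [v_ hv_] := choice minseq.
have Wv_ n : W (v_ n) by case: (hv_ n).
have Vv_ n : V (v_ n) := WV _ (Wv_ n).
have [|f fk fC] := @bounded_cauchy_subseq v_ (lam + 1) Vv_.
  move=> n; have [_ _ /ltW h] := hv_ n; apply: le_trans h _.
  by rewrite lerD2l invf_le1// ler1n.
(* [q] is nonnegative on [W] and [a x x = q x x + lam b x x], so that a minimizing sequence
   that is Cauchy for [b] is Cauchy for [a]. *)
pose q u v := a u v - lam * b u v.
have fq : psd_form W q.
  split.
  - by move=> u v /WV Vu /WV Vv; rewrite /q (formC fa)// (formC fb).
  - by move=> c u v w /WV Vu /WV Vv /WV Vw; rewrite /q (formL fa)// (formL fb)//; ring.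
  - by move=> u Wu; rewrite subr_ge0; exact: W_lam.
have q_small e : 0 < e -> exists n0, forall n, (n0 <= n)%N -> q (v_ (f n)) (v_ (f n)) <= e.
  move=> e0; have [n0 hn0] := inv_nat_small e0; exists n0 => n hn.
  have [_ h1 h2] := hv_ (f n); rewrite /q h1 mulr1.
  apply: le_trans (ltW (hn0 (f n) (leq_trans hn (fk n)))).
  by rewrite lerBlDl ltW.
have [u Vu cu] : exists2 u, V u & form_cvg a (v_ \o f) u.
  apply: (sp_complete sp) => [n|e e0]; first exact: Vv_.
  have [n0 hn0] := q_small (e / 8) ltac:(lra).
  have [n1 hn1] := fC (e / (2 * lam + 2)) ltac:(by rewrite divr_gt0//; lra).
  exists (maxn n0 n1) => i j; rewrite !geq_max => /andP[i0 i1] /andP[j0 j1].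
  have := form_leB sW fq (Wv_ (f i)) (Wv_ (f j)).
  have := hn0 i i0; have := hn0 j j0; have := hn1 i j i1 j1 => /=.
  set x := b (_ - _) _ => bx hi hj; rewrite {1}/q -/x => hq.
  have : lam * x <= e / 2.
    apply: (@le_trans _ _ (lam * (e / (2 * lam + 2)))); first exact: ler_wpM2l.
    by rewrite mulrA ler_pdivrMr; [nra|lra].
  lra.
have [C C0 hC] := sp_poincare_gt0.
have cbu : form_cvg b (v_ \o f) u.
  move=> e e0; have [n0 hn0] := cu (e / C) ltac:(by rewrite divr_gt0).
  exists n0 => n hn; apply: le_trans (hC _ (subspaceB sV (Vv_ _) Vu)) _.
  by rewrite mulrC -ler_pdivlMr//; exact: hn0.
have Wu : W u.
  split=> // x xs; have Vx := Vs _ xs.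
  apply/eqP; rewrite -sqrf_eq0 eq_le sqr_ge0 andbT.
  apply/ler_addgt0Pl => e e0; rewrite addr0.
  have bx0 := form_ge0 fb Vx.
  have [n0 hn0] := cbu (e / (b x x + 1)) ltac:(by rewrite divr_gt0// ltr_wpDl).
  have := form_CauchySchwarz sV fb (subspaceB sV (Vv_ (f n0)) Vu) Vx.
  rewrite (formBl sV fb)// (Wv_ (f n0)).2// sub0r sqrrN => /le_trans; apply.
  apply: (@le_trans _ _ (e / (b x x + 1) * b x x)).
    by apply: ler_wpM2r => //; exact: (hn0 n0 (leqnn _)).
  by rewrite mulrAC ler_pdivrMr; [nra|lra].
have qu0 : q u u = 0.
  apply/eqP; rewrite eq_le (form_ge0 fq Wu) andbT -(mulr0 2).
  apply: (form_cvg_le sW fq (fun n => Wv_ (f n)) Wu) => [e e0|e e0]; last first.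
    by have [n0 h] := q_small e e0; exists n0 => n hn; rewrite add0r; exact: h.
  have [n0 hn0] := cu e e0; exists n0 => n hn; apply: le_trans (hn0 n hn).
  rewrite /q lerBlDr lerDl mulr_ge0//.
  exact: (form_ge0 fb (subspaceB sV (Vv_ _) Vu)).
(* The limit could a priori be null. But [1 = b (v_ n) (v_ n)] is at most twice [b] at [v_ n - u]
   plus twice [b u u], and the first term is eventually at most [1/2]. Positivity is enough, the
   limit being normalized afterwards. *)
have bu0 : 0 < b u u.
  have [n0 hn0] := cbu (1/4) ltac:(lra); have := hn0 n0 (leqnn _).
  have := form_leD sV fb (subspaceB sV (Vv_ (f n0)) Vu) Vu.
  by rewrite subrK/=; have [_ -> _] := hv_ (f n0); lra.
have [c c0 cu2] := unit_scale bu0.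
exists (c *: u); split.
- exact: (subspaceZ sW).
- by rewrite (form_sqrZ sV fb)// cu2 mulVf// gt_eqF.
- move=> v Wv; suff -> : a (c *: u) (c *: u) = lam by exact: W_lam.
  rewrite (form_sqrZ sV fa)// cu2; move/eqP : qu0; rewrite subr_eq0 => /eqP ->.
  by rewrite mulrCA mulVf ?mulr1// gt_eqF.
Qed.

End OnePair.
End Spectral.

(** * Spectral systems *)

Section SpectralSystem.
Context {R : realType} {E : lmodType R}.

Definition eig (V : set E) (a b : E -> E -> R) (lam : R) : set E :=
  [set u | V u /\ forall v, V v -> a u v = lam * b u v].

(** Dimension of the image of [F] in the quotient by the null vectors of [b], phrased without
    forming the quotient. *)
Definition has_null_dim (b : E -> E -> R) (F : set E) (m : nat) : Prop :=
  exists e : 'I_m -> E,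
    [/\ forall i, F (e i),
        forall c : 'I_m -> R,
          b (\sum_i c i *: e i) (\sum_i c i *: e i) = 0 -> forall i, c i = 0 &
        forall u, F u -> exists c : 'I_m -> R,
          b (u - \sum_i c i *: e i) (u - \sum_i c i *: e i) = 0].

(** Completeness of the family is not a field: it follows from [ss_min] and [ss_oo]. *)
Record spectral_system (V : set E) (a b : E -> E -> R) (e : nat -> E) (l : nat -> R) : Prop :=
  SpectralSystem {
  ss_V : forall k, V (e k);
  ss_on : forall i j, b (e i) (e j) = (i == j)%:R;
  ss_eig : forall k, eig V a b (l k) (e k);
  ss_mono : {homo l : i j / (i <= j)%N >-> i <= j};
  ss_oo : forall M, exists k, M < l k;
  ss_min : forall n v, V v -> (forall j, (j < n)%N -> b v (e j) = 0) -> l n * b v v <= a v v }.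

Definition fourier (b : E -> E -> R) (e : nat -> E) (n : nat) (v : E) :=
  \sum_(i < n) b v (e i) *: e i.

Section System.
Context {V : set E} {a b : E -> E -> R} (sp : spectral_pair V a b).
Let sV := sp_sub sp.
Let fa := sp_a sp.
Let fb := sp_b sp.

Lemma fourier_in (W : set E) e n v : subspace W -> (forall i, (i < n)%N -> W (e i)) ->
  W (fourier b e n v).
Proof. by move=> sW We; apply: (subspace_sum sW) => i _; exact: We. Qed.

Lemma orthonormal_coord e n (c : nat -> R) j :
  (forall i, (i < n)%N -> V (e i)) -> V (e j) ->
  (forall i, (i < n)%N -> b (e i) (e j) = (i == j)%:R) ->
  b (\sum_(i < n) c i *: e i) (e j) = if (j < n)%N then c j else 0.
Proof.
move=> Ve Vj on; rewrite (form_suml sV fb)//; last by move=> i _; exact: Ve.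
case: ifPn => jn.
  rewrite (bigD1 (Ordinal jn))//= on// eqxx mulr1 big1 ?addr0// => i ij.
  rewrite on//; case: eqP => [ij'|]; last by rewrite mulr0.
  by move: ij; rewrite -val_eqE/= ij' eqxx.
apply: big1 => i _; rewrite on//; case: eqP => [ij'|]; last by rewrite mulr0.
by move: jn; rewrite -ij' ltn_ord.
Qed.

Lemma fourier_orth e n v j : (forall i, (i < n)%N -> V (e i)) ->
  (forall i k, (i < n)%N -> (k < n)%N -> b (e i) (e k) = (i == k)%:R) -> V v -> (j < n)%N ->
  b (v - fourier b e n v) (e j) = 0.
Proof.
move=> Ve on Vv jn; have Vj := Ve _ jn.
rewrite (formBl sV fb)//; last exact: fourier_in.
rewrite (@orthonormal_coord e n (fun i => b v (e i)))//; first by rewrite jn subrr.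
by move=> i iltn; exact: on.
Qed.

(** Euler-Lagrange equation. The form [a - lam * b] is nonnegative on the orthogonal of the first
    [n] vectors and vanishes at [w], so by Cauchy-Schwarz it vanishes between [w] and that
    orthogonal. Between [w] and each [e i] both forms vanish, because [e i] is an eigenvector
    orthogonal to [w]. Every [v] is a Fourier sum plus an orthogonal vector. *)
Lemma orth_min_eig e l n w lam : (forall i, (i < n)%N -> V (e i)) ->
  (forall i k, (i < n)%N -> (k < n)%N -> b (e i) (e k) = (i == k)%:R) ->
  (forall i, (i < n)%N -> eig V a b (l i) (e i)) ->
  (forall v, V v -> (forall j, (j < n)%N -> b v (e j) = 0) -> lam * b v v <= a v v) ->
  V w -> (forall j, (j < n)%N -> b w (e j) = 0) -> a w w = lam * b w w ->
  eig V a b lam w.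
Proof.
move=> Ve on eige minlam Vw we aw; split=> // v Vv.
pose W : set E := [set v | V v /\ forall j, (j < n)%N -> b v (e j) = 0].
have WV : W `<=` V by move=> x [].
have sW : subspace W.
  split; first by split; [exact: (subspace0 sV)|move=> j jn; rewrite (form0l sV fb)//; exact: Ve].
  move=> c x y [Vx xe] [Vy ye]; split; first exact: (subspaceL sV).
  by move=> j jn; rewrite (formL fb)//; [rewrite xe// ye// mulr0 addr0|exact: Ve].
pose q u v := a u v - lam * b u v.
have fq : psd_form W q.
  split.
  - by move=> x y /WV Vx /WV Vy; rewrite /q (formC fa)// (formC fb).
  - by move=> c x y z /WV Vx /WV Vy /WV Vz; rewrite /q (formL fa)// (formL fb)//; ring.
  - by move=> x [Vx xe]; rewrite subr_ge0; exact: minlam.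
have Ww : W w by [].
have Vf : V (fourier b e n v) by exact: fourier_in.
have Wv : W (v - fourier b e n v).
  by split; [exact: (subspaceB sV)|move=> j jn; exact: fourier_orth].
have /eqP := form_null sW fq Ww Wv ltac:(by rewrite /q aw subrr).
rewrite subr_eq0 (formBr sV fa)// (formBr sV fb)// => /eqP.
have -> : a w (fourier b e n v) = 0.
  rewrite (formC fa)// (form_suml sV fa)//; last by move=> i _; exact: Ve.
  apply: big1 => i _; have [Vi ->//] := eige i (ltn_ord i).
  by rewrite (formC fb Vi Vw) we// !mulr0.
have -> : b w (fourier b e n v) = 0.
  rewrite (formC fb)// (form_suml sV fb)//; last by move=> i _; exact: Ve.
  by apply: big1 => i _; rewrite (formC fb (Ve i _) Vw)// we// mulr0.
by rewrite !subr0.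
Qed.

(** Greedy construction: each new vector minimizes the Rayleigh quotient on the orthogonal of the
    list already chosen. The choice depends on that list, whence the recursion on lists through
    [xget]. *)
Let minimal (s : seq E) : set E := [set x | [/\ orth (V := V) (b := b) s x, b x x = 1 &
  forall v, orth (V := V) (b := b) s v -> a x x * b v v <= a v v]].

Let step (s : seq E) : E := xget 0 (minimal s).

Let Fixpoint es (n : nat) : seq E := if n is n'.+1 then rcons (es n') (step (es n')) else [::].

Lemma spectral_system_exists : exists e l, spectral_system V a b e l.
Proof.
pose e n := step (es n).
have esP n : forall x, x \in es n -> exists2 i, (i < n)%N & x = e i.
  elim: n => [|n IH] x //=; rewrite mem_rcons inE => /orP[/eqP ->|/IH [i iltn ->]].
    by exists n.
  by exists i => //; exact: ltnW.
have es_mem n i : (i < n)%N -> e i \in es n.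
  elim: n => [//|n IH]; rewrite ltnS leq_eqVlt => /orP[/eqP ->|/IH h] /=.
    by rewrite mem_rcons inE eqxx.
  by rewrite mem_rcons inE h orbT.
have stepP n : [/\ orth (V := V) (b := b) (es n) (e n), b (e n) (e n) = 1 &
    forall v, orth (V := V) (b := b) (es n) v -> a (e n) (e n) * b v v <= a v v].
  have [m] := ubnP n; elim: m n => [//|m IH] n nm.
  have [|x hx] := @rayleigh_minimizer _ _ _ _ _ sp (es n).
    move=> x /esP[i iltn ->]; have [|[]//] := IH i.
    by rewrite (leq_trans iltn).
  exact: (@xgetPex _ 0 (minimal (es n)) (ex_intro _ x hx)).
have Ve n : V (e n) by have [[]] := stepP n.
have orthP n v : V v -> (forall j, (j < n)%N -> b v (e j) = 0) -> orth (V := V) (b := b) (es n) v.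
  by move=> Vv h; split => // x /esP[i iltn ->]; exact: h.
have on i j : b (e i) (e j) = (i == j)%:R.
  have [->|] := eqVneq i j; first by have [] := stepP j.
  rewrite neq_ltn => /orP[] h.
    by rewrite (formC fb)//; have [[_ h1] _ _] := stepP j; rewrite h1 ?es_mem.
  by have [[_ h1] _ _] := stepP i; rewrite h1 ?es_mem.
pose l n := a (e n) (e n).
have mn n v : V v -> (forall j, (j < n)%N -> b v (e j) = 0) -> l n * b v v <= a v v.
  by move=> Vv /(orthP _ _ Vv); have [_ _] := stepP n; exact.
have eige k : eig V a b (l k) (e k).
  have [m] := ubnP k; elim: m k => [//|m IH] k km.
  apply: (@orth_min_eig e l k) => // [i ik|v Vv ve|j jk|].
  - by apply: IH; rewrite (leq_trans ik).
  - exact: mn.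
  - by rewrite on; case: eqP jk => // ->; rewrite ltnn.
  - by rewrite on eqxx mulr1.
have lmono : {homo l : i j / (i <= j)%N >-> i <= j}.
  move=> i j ij; have := mn i (e j) (Ve j).
  rewrite on eqxx mulr1; apply => q qi; rewrite on; case: eqP qi => // <-.
  by rewrite ltnNge ij.
exists e, l; split=> // M.
(* Were all eigenvalues at most [M], then among [m.+1] eigenvectors some combination [w] would be
   killed by the [m] compactness functionals. This gives [b w w <= M / (2 * (M + 1)) * b w w] with
   [b w w] positive. *)
apply/not_existsP => hM; have {}hM k : l k <= M by rewrite leNgt; exact/negP.
have M0 : 0 <= M by apply: le_trans (hM 0%N); exact: (form_ge0 fa).
have [m [f [C [fl _ fb']]]] := sp_compact sp (e := (2 * (M + 1))^-1) ltac:(by rewrite invr_gt0; lra).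
have [c c0 cM] := exists_left_kernel (\matrix_(i < m.+1, j < m) f j (e i)).
pose w := \sum_(i < m.+1) c ord0 i *: e i.
have Vw : V w by exact: (subspace_sum sV).
have bw j : (j < m.+1)%N -> b (e j) w = c ord0 (inord j).
  move=> jm; rewrite (formC fb)//.
  rewrite (_ : w = \sum_(i < m.+1) c ord0 (inord i) *: e i); last first.
    by apply: eq_bigr => i _; rewrite inord_val.
  by rewrite (@orthonormal_coord e m.+1 (fun i => c ord0 (inord i)))// jm.
have fw j : f j w = 0.
  rewrite (linear_combination sp)//; last exact: fl.
  move/rowP : cM => /(_ j); rewrite !mxE => cM; rewrite -[RHS]cM.
  by apply: eq_bigr => i _; rewrite mxE.
have bww : b w w = \sum_(i < m.+1) c ord0 i ^+ 2.
  rewrite (form_suml sV fb)//; apply: eq_bigr => i _.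
  by rewrite bw// inord_val.
have aww : a w w <= M * b w w.
  rewrite bww (form_suml sV fa)// mulr_sumr; apply: ler_sum => i _.
  have [_ ->//] := eige i; rewrite bw// inord_val mulrCA -expr2.
  by apply: ler_wpM2r; rewrite ?sqr_ge0.
have bw0 : 0 < b w w.
  rewrite bww lt_def sumr_ge0 ?andbT; last by move=> *; exact: sqr_ge0.
  apply: contra c0; rewrite psumr_eq0 => [/allP h|*]; last exact: sqr_ge0.
  apply/eqP/rowP => i; have := h i (mem_index_enum i).
  by rewrite /= sqrf_eq0 mxE => /eqP.
have := fb' _ Vw; rewrite big1 ?addr0; last by move=> j _; rewrite fw expr0n.
apply/negP; rewrite -ltNge.
apply: (@le_lt_trans _ _ ((2 * (M + 1))^-1 * (M * b w w))).
  by apply: ler_wpM2l => //; rewrite invr_ge0; lra.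
by rewrite mulrC ltr_pdivrMr; [nra|lra].
Qed.

Section Given.
Context {e : nat -> E} {l : nat -> R} (ss : spectral_system V a b e l).

(** Such a [v] competes at every level, so [l k * b v v <= a v v] for all [k] although [l] is
    unbounded. *)
Lemma ss_complete v : V v -> (forall k, b v (e k) = 0) -> b v v = 0.
Proof.
move=> Vv ve; apply/eqP; rewrite eq_le (form_ge0 fb Vv) andbT leNgt; apply/negP => v0.
have [k hk] := ss_oo ss (a v v / b v v).
have := ss_min ss (n := k) Vv (fun j _ => ve j).
by rewrite -ler_pdivlMr// leNgt hk.
Qed.

Lemma eig_orth (W : set E) mu nu u v : W `<=` V -> eig W a b mu u -> eig W a b nu v ->
  mu != nu -> b u v = 0.
Proof.
move=> WV [Wu hu] [Wv hv] mn.
have := hu v Wv; rewrite (formC fa (WV _ Wu) (WV _ Wv)) hv// (formC fb (WV _ Wv) (WV _ Wu)).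
move=> /eqP; rewrite -subr_eq0 -mulrBl mulf_eq0 subr_eq0 eq_sym (negbTE mn) => /eqP//.
Qed.

Lemma ss_bound mu : exists n, forall k, (n <= k)%N -> mu < l k.
Proof.
by have [n hn] := ss_oo ss mu; exists n => k nk; apply: lt_le_trans hn (ss_mono ss nk).
Qed.

(** Eigenvectors for distinct eigenvalues are orthogonal, so no coefficient survives from [n] on and
    the remainder is null by completeness. *)
Lemma eig_fourier mu u n : eig V a b mu u -> (forall k, (n <= k)%N -> mu < l k) ->
  b (u - fourier b e n u) (u - fourier b e n u) = 0.
Proof.
move=> eu hn; have Vu := eu.1.
have Vf : V (fourier b e n u) by apply: fourier_in => // i _; exact: (ss_V ss).
apply: ss_complete; first exact: (subspaceB sV).
move=> k; have [kn|nk] := ltnP k n.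
  by apply: fourier_orth => // *; [exact: (ss_V ss)|exact: (ss_on ss)].
have Vk := ss_V ss k.
rewrite (formBl sV fb)//.
rewrite (@orthonormal_coord e n (fun i => b u (e i)))//; last first.
- by move=> i _; exact: (ss_on ss).
- by move=> i _; exact: (ss_V ss).
rewrite ltnNge nk subr0; apply: (@eig_orth V mu (l k)) => //; first exact: (ss_eig ss).
by rewrite lt_eqF// hn.
Qed.

(** The indices carrying [lam] are finitely many because [l] diverges. The corresponding [e k] form
    the basis: completeness leaves no further direction. *)
Lemma ss_has_null_dim lam : exists2 m, has_null_dim b (eig V a b lam) m &
  ([set k | l k = lam] #= `I_m)%card.
Proof.
have [n hn] := ss_bound lam.
pose S := [seq k <- iota 0 n | l k == lam].
have uS : uniq S by rewrite filter_uniq// iota_uniq.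
have memS k : (k \in S) = (l k == lam).
  rewrite mem_filter mem_iota/= add0n; case: eqP => //= lk.
  by rewrite ltnNge; apply/negP => /hn; rewrite lk ltxx.
exists (size S).
  exists (fun i : 'I_(size S) => e (nth 0%N S i)).
  have nthS (i : 'I_(size S)) : l (nth 0%N S i) = lam.
    by apply/eqP; rewrite -memS mem_nth.
  have coord (c : 'I_(size S) -> R) k :
      b (\sum_i c i *: e (nth 0%N S i)) (e k) = \sum_(i : 'I_(size S) | nth 0%N S i == k) c i.
    rewrite (form_suml sV fb)//; [|by move=> *; exact: (ss_V ss)|exact: (ss_V ss)].
    rewrite [RHS]big_mkcond/=; apply: eq_bigr => i _.
    by rewrite (ss_on ss); case: eqP; rewrite ?mulr1// mulr0.
  have coord_nth (c : 'I_(size S) -> R) (j : 'I_(size S)) :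
      \sum_(i : 'I_(size S) | nth 0%N S i == nth 0%N S j) c i = c j.
    by rewrite (big_pred1 j)// => i /=; rewrite nth_uniq.
  have Vsum (c : 'I_(size S) -> R) : V (\sum_i c i *: e (nth 0%N S i)).
    by apply: (subspace_sum sV) => i _; exact: (ss_V ss).
  split.
  - by move=> i; rewrite -(nthS i); exact: (ss_eig ss).
  - move=> c c0 i.
    have := form_null sV fb (Vsum c) (ss_V ss (nth 0%N S i)) c0.
    by rewrite coord coord_nth.
  - move=> u eu; have Vu := eu.1; exists (fun i => b u (e (nth 0%N S i))).
    apply: ss_complete; first exact: (subspaceB sV).
    move=> k; rewrite (formBl sV fb)//; last exact: (ss_V ss).
    rewrite coord; have [|lk] := eqVneq (l k) lam.
      move/eqP; rewrite -memS => kS; have iS : (index k S < size S)%N by rewrite index_mem.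
      rewrite (eq_bigl (fun i : 'I_(size S) => nth 0%N S i == nth 0%N S (Ordinal iS))); last first.
        by move=> i; rewrite nth_index.
      by rewrite coord_nth/= nth_index// subrr.
    rewrite big_pred0 ?subr0; last first.
      by move=> i; apply/negP => /eqP h; rewrite -h nthS eqxx in lk.
    by apply: (@eig_orth V lam (l k)) => //; [exact: (ss_eig ss)|rewrite eq_sym].
rewrite (_ : [set k | l k = lam] = nth 0%N S @` `I_(size S)); last first.
  apply/seteqP; split => k /=.
    move/eqP; rewrite -memS => kS; exists (index k S); last by rewrite nth_index.
    by rewrite /= index_mem.
  by move=> [i iS <-]; apply/eqP; rewrite -memS mem_nth.
apply: inj_card_eq => i j; rewrite !inE => iS jS /eqP.
by rewrite nth_uniq// => /eqP.
Qed.

Lemma ss_eigenvalue k : exists2 u, eig V a b (l k) u & b u u != 0.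
Proof. by exists (e k); [exact: (ss_eig ss)|rewrite (ss_on ss) eqxx oner_neq0]. Qed.

End Given.
End System.

(** Expanding a basis of [F] in a basis of [G] gives, modulo null vectors, a square matrix. It is
    injective by independence of the first basis, hence invertible, and its inverse expresses [G]
    through [F]. *)
Lemma null_dim_inclusion (V : set E) (b : E -> E -> R) (F G : set E) m :
  subspace V -> psd_form V b -> F `<=` G -> G `<=` V ->
  has_null_dim b F m -> has_null_dim b G m ->
  forall u, G u -> exists f : 'I_m -> E, exists c : 'I_m -> R, (forall i, F (f i)) /\
    b (u - \sum_i c i *: f i) (u - \sum_i c i *: f i) = 0.
Proof.
move=> sV fb FG GV [f [Ff fi _]] [g [Gg gi gs]] u Gu.
have Vg i : V (g i) by exact: GV.
have Vf i : V (f i) by apply/GV/FG.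
have Vs (h : 'I_m -> E) (c : 'I_m -> R) : (forall i, V (h i)) -> V (\sum_i c i *: h i).
  by move=> Vh; exact: (subspace_sum sV).
have [M hM] := choice (fun i => gs _ (FG _ (Ff i))).
pose A : 'M[R]_m := \matrix_(i, j) M i j.
(* modulo null vectors, f = A g *)
have comb (c d : 'I_m -> R) : (forall j, \sum_i c i * A i j = d j) ->
    b (\sum_j d j *: g j - \sum_i c i *: f i)
      (\sum_j d j *: g j - \sum_i c i *: f i) = 0.
  move=> cd; rewrite (form_symB sV fb); [|exact: Vs|exact: Vs].
  pose r i := f i - \sum_j M i j *: g j.
  have Vr i : V (r i) by apply: (subspaceB sV) => //; exact: Vs.
  have -> : \sum_i c i *: f i - \sum_j d j *: g j = \sum_i c i *: r i.
    under [in RHS]eq_bigr do rewrite scalerBr.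
    rewrite big_split/= sumrN; congr (_ - _).
    under [RHS]eq_bigr => i _ do rewrite scaler_sumr.
    rewrite exchange_big/=; apply: eq_bigr => j _; rewrite -cd scaler_suml.
    by apply: eq_bigr => i _; rewrite scalerA mxE.
  rewrite (form_suml sV fb)//; last exact: Vs.
  by apply: big1 => i _; rewrite (form_null sV fb _ _ (hM i)) ?mulr0//; [exact: Vr|exact: Vs].
have Aunit : A \in unitmx.
  rewrite -row_free_unit -kermx_eq0; apply/negPn/negP.
  case/rowV0Pn => c /sub_kermxP cA c0.
  move/negP : c0; apply; apply/eqP/rowP => i; rewrite mxE.
  apply: (fi (fun i => c ord0 i)).
  have := comb (fun i => c ord0 i) (fun=> 0).
  rewrite big1; last by move=> j _; rewrite scale0r.
  rewrite (form_symB sV fb); [|exact: subspace0|exact: Vs].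
  rewrite subr0; apply => j.
  by move/rowP : cA => /(_ j); rewrite !mxE.
have [c hc] := gs _ Gu.
pose c' i := ((\row_j c j) *m invmx A) ord0 i.
exists f, c'; split => //.
have c'A j : \sum_i c' i * A i j = c j.
  have : ((\row_j c j) *m invmx A *m A) ord0 j = c j by rewrite mulmxKV// mxE.
  by rewrite mxE.
have := form_nullD sV fb _ _ hc (comb _ _ c'A).
rewrite addrA subrK; apply; first by apply: (subspaceB sV); [exact: GV|exact: Vs].
by apply: (subspaceB sV); exact: Vs.
Qed.

(** * Two nested spaces whose eigenspaces have the same dimensions *)

Section Comparison.
Context {V V1 : set E} {a b : E -> E -> R}.
Hypotheses (sp : spectral_pair V a b) (sp1 : spectral_pair V1 a b) (V1V : V1 `<=` V).
Hypothesis V1_null : forall u w, V u -> V1 w -> b (u - w) (u - w) = 0 -> V1 u.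
Hypothesis same_dim : forall lam, (exists2 u, eig V a b lam u & b u u != 0) ->
  exists m, has_null_dim b (eig V a b lam) m /\ has_null_dim b (eig V1 a b lam) m.
Context {e e1 : nat -> E} {l l1 : nat -> R}.
Hypotheses (ss : spectral_system V a b e l) (ss1 : spectral_system V1 a b e1 l1).
Let sV := sp_sub sp.
Let fa := sp_a sp.
Let fb := sp_b sp.
Let sV1 := sp_sub sp1.

(** Modulo a null vector, [u] is a combination of the [e1 i] with [i < k], which are already
    eigenvectors of [V]. The terms whose eigenvalue is not [mu] have a zero coefficient. *)
Lemma eig_transfer k mu : (forall i, (i < k)%N -> eig V a b (l1 i) (e1 i)) ->
  (forall i, (k <= i)%N -> mu < l1 i) -> eig V1 a b mu `<=` eig V a b mu.
Proof.
move=> eigV hk u eu; have Vu : V u by apply/V1V/eu.1.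
have Ve1 i : V (e1 i) by apply/V1V/(ss_V ss1).
have Vf : V (fourier b e1 k u) by apply: (fourier_in _ sV) => i _.
have bnull := eig_fourier sp1 ss1 eu hk.
have anull := sp_null sp (subspaceB sV Vu Vf) bnull.
split=> // v Vv.
rewrite (form_null_eq sV fa Vu Vf Vv anull) (form_null_eq sV fb Vu Vf Vv bnull).
rewrite (form_suml sV fa)// (form_suml sV fb)// mulr_sumr; apply: eq_bigr => i _.
have [_ ->//] := eigV i (ltn_ord i).
have [->|ne] := eqVneq (l1 i) mu; first by ring.
by rewrite (eig_orth sp1 (@subset_refl _ V1) eu (ss_eig ss1 i)) ?mul0r ?mulr0// eq_sym.
Qed.

(** Equality of dimensions turns the inclusion of eigenspaces into an equality modulo null vectors,
    and [V1_null] absorbs the null difference. *)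
Lemma eigenvector_transfer j : eig V1 a b (l j) `<=` eig V a b (l j) -> V1 (e j).
Proof.
move=> sub; have [m [hm hm1]] := same_dim (ss_eigenvalue ss j).
have [f [c [hf fnull]]] := null_dim_inclusion sV fb sub (fun u h => h.1) hm1 hm (ss_eig ss j).
apply: (V1_null (ss_V ss j) _ fnull).
by apply: (subspace_sum sV1) => i _; exact: (hf i).1.
Qed.

Lemma eig_sub k : eig V a b (l1 k) (e1 k).
Proof.
have [n] := ubnP k; elim: n k => [//|n IH] k; rewrite ltnS => kn.
have {}IH i : (i < k)%N -> eig V a b (l1 i) (e1 i).
  by move=> ik; apply: IH; exact: leq_trans kn.
(* [p] will be the first level of [V] whose eigenvalue reaches [l1 k]. Below it the eigenvalues of
   [V] are smaller than [l1 k], so the induction hypothesis is enough to transfer their eigenvectors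
   to [V1], where they are orthogonal to [e1 k]. *)
have exn : exists n, l1 k <= l n by have [q /ltW] := ss_oo ss (l1 k); exists q.
have minn := ex_minnP exn; case: minn => p hp minp.
have Ve1 : V (e1 k) by apply/V1V/(ss_V ss1).
have orthp j : (j < p)%N -> b (e1 k) (e j) = 0.
  move=> jp; have ljk : l j < l1 k.
    by rewrite ltNge; apply/negP => /minp; rewrite leqNgt jp.
  have V1j : V1 (e j).
    apply: eigenvector_transfer; apply: (eig_transfer IH) => i ki.
    exact: lt_le_trans ljk (ss_mono ss1 ki).
  have ej : eig V1 a b (l j) (e j).
    by split => // v V1v; apply: (ss_eig ss j).2; exact: V1V.
  by rewrite (eig_orth sp1 (@subset_refl _ V1) (ss_eig ss1 k) ej)// gt_eqF.
have bk : b (e1 k) (e1 k) = 1 by rewrite (ss_on ss1) eqxx.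
have ak : a (e1 k) (e1 k) = l1 k.
  by have [_ /(_ _ (ss_V ss1 k)) ->] := ss_eig ss1 k; rewrite bk mulr1.
(* [e1 k] competes at level [p] with Rayleigh quotient [l1 k]. With the choice of [p] this gives
   equality, so [e1 k] is a minimizer for [V] itself. *)
have lpk : l p = l1 k.
  apply/eqP; rewrite eq_le hp andbT.
  by have := ss_min ss Ve1 orthp; rewrite ak bk mulr1.
apply: (orth_min_eig sp (e := e) (l := l) (n := p)) => //.
- by move=> *; exact: (ss_V ss).
- by move=> *; exact: (ss_on ss).
- by move=> *; exact: (ss_eig ss).
- by move=> v Vv hv; rewrite -lpk; exact: (ss_min ss).
- by rewrite ak bk mulr1.
Qed.

Lemma eigenvectors_in j : V1 (e j).
Proof.
have [n hn] := ss_bound ss1 (l j).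
by apply: eigenvector_transfer; apply: (@eig_transfer n) => // i _; exact: eig_sub.
Qed.

(** The Fourier sums are Cauchy for [a], since the increasing energies [T n] are bounded by [a v v]
    (Bessel). Their limit [w] lies in [V1] and has the same coefficients as [v], so [v - w] is null
    by completeness. *)
Lemma isospectral_inclusion : V `<=` V1.
Proof.
move=> v Vv; pose S n := fourier b e n v.
have V1S n : V1 (S n) by apply: (fourier_in _ sV1) => i _; exact: eigenvectors_in.
have VS n : V (S n) := V1V (V1S n).
have Ve i : V (e i) := ss_V ss i.
pose T n := \sum_(i < n) l i * b v (e i) ^+ 2.
have l0 i : 0 <= l i.
  have := form_ge0 fa (Ve i); have [_ ->//] := ss_eig ss i.
  by rewrite (ss_on ss) eqxx mulr1.
have aeS i n : a (e i) (S n) = if (i < n)%N then l i * b v (e i) else 0.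
  have [_ ->//] := ss_eig ss i; rewrite (formC fb)//.
  rewrite (@orthonormal_coord V a b sp e n (fun i => b v (e i)))//; last first.
    by move=> *; exact: (ss_on ss).
  by case: ifP; rewrite ?mulr0.
have aSS n m : (n <= m)%N -> a (S n) (S m) = T n.
  move=> nm; rewrite (form_suml sV fa)//; apply: eq_bigr => i _.
  by rewrite aeS (leq_trans (ltn_ord i))//; ring.
have avS n : a v (S n) = T n.
  rewrite (formC fa)// (form_suml sV fa)//; apply: eq_bigr => i _.
  have [_ ->//] := ss_eig ss i; rewrite (formC fb)//; ring.
have Tmono : {homo T : i j / (i <= j)%N >-> i <= j}.
  move=> i j ij; rewrite /T -!(big_mkord xpredT (fun i => l i * b v (e i) ^+ 2)).
  rewrite [leRHS](big_cat_nat (leq0n i) ij)//= lerDl sumr_ge0// => q _.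
  by rewrite mulr_ge0// sqr_ge0.
have Tbound n : T n <= a v v.
  have := form_ge0 fa (subspaceB sV Vv (VS n)).
  by rewrite (form_sqrB sV fa)// avS aSS//; lra.
have Sdiff i j : (i <= j)%N -> a (S i - S j) (S i - S j) = T j - T i.
  by move=> ij; rewrite (form_sqrB sV fa)// !aSS//; ring.
have hasT : has_sup (range T).
  split; first by exists (T 0%N), 0%N.
  by exists (a v v) => _ [n _ <-].
have [w V1w cw] : exists2 w, V1 w & form_cvg a S w.
  apply: (sp_complete sp1) => // eps eps0.
  have [_ [n _ <-] hn] := sup_adherent eps0 hasT.
  exists n => i j ni nj.
  have Tsup k : T k <= sup (range T) by apply: ub_le_sup; [exact: hasT.2|exists k].
  have := Tsup i; have := Tsup j; have := Tmono _ _ ni; have := Tmono _ _ nj.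
  have [ij|/ltnW ji] := leqP i j.
    by rewrite Sdiff//; lra.
  by rewrite (form_symB sV fa)// Sdiff//; lra.
have Vw := V1V V1w.
have [C C0 hC] := sp_poincare_gt0 sp.
apply: (V1_null Vv V1w); apply: (ss_complete sp ss); first exact: (subspaceB sV).
move=> k; apply/eqP; rewrite -sqrf_eq0 eq_le sqr_ge0 andbT.
apply/ler_addgt0Pl => eps eps0; rewrite addr0.
have [n0 hn0] := cw (eps / C) ltac:(by rewrite divr_gt0).
pose n := maxn n0 k.+1.
have VSw : V (S n - w) by exact: (subspaceB sV).
have -> : b (v - w) (e k) = b (S n - w) (e k).
  have -> : v - w = (v - S n) + (S n - w) by rewrite addrA subrK.
  rewrite (formDl fb)//; last exact: (subspaceB sV).
  rewrite (fourier_orth sp) ?add0r//; first by move=> *; exact: (ss_on ss).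
  by rewrite leq_max ltnSn orbT.
apply: le_trans (form_CauchySchwarz sV fb VSw (Ve k)) _.
rewrite (ss_on ss) eqxx mulr1; apply: le_trans (hC _ VSw) _.
by rewrite mulrC -ler_pdivlMr//; apply: hn0; rewrite leq_maxl.
Qed.

End Comparison.
End SpectralSystem.

(** * Square-integrable functions *)

Section SquareIntegrable.
Context d {T : measurableType d} {R : realType} (mu : {measure set T -> \bar R}).
Implicit Types f g h : T -> R.

Definition nrm2 f : \bar R := (\int[mu]_x ((f x) ^+ 2)%:E)%E.

Definition sq_int : set (T -> R) := [set f | measurable_fun setT f /\ (nrm2 f < +oo)%E].

Definition ip f g : R := \int[mu]_x (f x * g x).

Lemma nrm2_ge0 f : (0 <= nrm2 f)%E.
Proof. by apply: integral_ge0 => x _; rewrite lee_fin sqr_ge0. Qed.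

Lemma measurable_sqr f : measurable_fun setT f ->
  measurable_fun setT (EFin \o (fun x => f x ^+ 2)).
Proof. by move=> mf; apply/measurable_EFinP; exact: measurable_funX. Qed.

Lemma le_nrm2 f g : measurable_fun setT f -> measurable_fun setT g ->
  (forall x, `|f x| <= `|g x|) -> (nrm2 f <= nrm2 g)%E.
Proof.
move=> mf mg fg; apply: ge0_le_integral => //.
- by move=> x _; rewrite lee_fin sqr_ge0.
- exact: measurable_sqr.
- exact: measurable_sqr.
- by move=> x _; rewrite lee_fin -[leLHS]real_normK ?num_real// -[leRHS]real_normK ?num_real// ler_sqr ?nnegrE.
Qed.

Lemma nrm2Z c f : measurable_fun setT f -> nrm2 (c *: f) = ((c ^+ 2)%:E * nrm2 f)%E.
Proof.
move=> mf; rewrite /nrm2 -ge0_integralZl//; last 3 first.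
- exact: measurable_sqr.
- by move=> x _; rewrite lee_fin sqr_ge0.
- by rewrite lee_fin sqr_ge0.
by apply: eq_integral => x _; rewrite -EFinM/= exprMn.
Qed.

Lemma nrm2D f g : measurable_fun setT f -> measurable_fun setT g ->
  (nrm2 (f + g)%R <= 2%:E * nrm2 f + 2%:E * nrm2 g)%E.
Proof.
move=> mf mg; rewrite /nrm2 -!ge0_integralZl//; try exact: measurable_sqr; try by move=> x _; rewrite lee_fin sqr_ge0.
rewrite -ge0_integralD//; last 4 first.
- by move=> x _; rewrite -EFinM lee_fin mulr_ge0// sqr_ge0.
- by apply: measurable_funeM; exact: measurable_sqr.
- by move=> x _; rewrite -EFinM lee_fin mulr_ge0// sqr_ge0.
- by apply: measurable_funeM; exact: measurable_sqr.
apply: ge0_le_integral => //.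
- by move=> x _; rewrite lee_fin sqr_ge0.
- by apply: measurable_sqr; exact: measurable_funD.
- by apply: emeasurable_funD; apply: measurable_funeM; exact: measurable_sqr.
- move=> x _; rewrite -!EFinM -EFinD lee_fin /=.
  have := sqr_ge0 (f x - g x).
  have -> : (f + g) x = f x + g x by [].
  by nra.
Qed.

Lemma measurable_linear c f g : measurable_fun setT f -> measurable_fun setT g ->
  measurable_fun setT (c *: f + g).
Proof.
move=> mf mg; apply: measurable_funD => //.
by apply: measurable_funM => //; exact: measurable_cst.
Qed.

Lemma sq_int_subspace : subspace sq_int.
Proof.
split.
  split; first exact: measurable_cst.
  by rewrite /nrm2; under eq_integral do rewrite expr0n/=; rewrite integral0.
move=> c f g [mf f2] [mg g2]; split; first exact: measurable_linear.
apply: le_lt_trans (nrm2D _ mg) _.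
  by apply: measurable_funM => //; exact: measurable_cst.
by rewrite nrm2Z// lte_add_pinfty// lte_mul_pinfty// ?mule_ge0 ?nrm2_ge0 ?lee_fin ?sqr_ge0// lte_mul_pinfty// ?nrm2_ge0// lee_fin sqr_ge0.
Qed.

Lemma sq_int_integrable f g : sq_int f -> sq_int g ->
  mu.-integrable setT (EFin \o (fun x => f x * g x)).
Proof.
move=> [mf f2] [mg g2]; apply/integrableP; split.
  by apply/measurable_EFinP; exact: measurable_funM.
apply: (@le_lt_trans _ _ (nrm2 f + nrm2 g)%E); last by rewrite lte_add_pinfty.
rewrite /nrm2 -ge0_integralD//; last 4 first.
- by move=> x _; rewrite lee_fin sqr_ge0.
- exact: measurable_sqr.
- by move=> x _; rewrite lee_fin sqr_ge0.
- exact: measurable_sqr.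
apply: ge0_le_integral => //.
- by apply: measurableT_comp => //; apply/measurable_EFinP; exact: measurable_funM.
- by apply: emeasurable_funD; exact: measurable_sqr.
- move=> x _; rewrite /= lee_fin ler_norml.
  have := sqr_ge0 (f x - g x); have := sqr_ge0 (f x + g x).
  by move=> h1 h2; apply/andP; split; nra.
Qed.

Lemma ip_form : psd_form sq_int ip.
Proof.
split.
- by move=> f g _ _; apply: eq_Rintegral => x _; rewrite mulrC.
- move=> c f g h sf sg sh; rewrite /ip -RintegralZl//; last exact: sq_int_integrable.
  rewrite -RintegralD//; last 2 first.
  + apply: (eq_integrable measurableT (fun x => (c%:E * (f x * h x)%:E)%E)) => //.
    by apply: integrableZl => //; exact: sq_int_integrable.
  + exact: sq_int_integrable.
  by apply: eq_Rintegral => x _; have -> : (c *: f + g) x = c * f x + g x by []; ring.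
- by move=> f sf; apply: Rintegral_ge0 => x _; rewrite -expr2 sqr_ge0.
Qed.

Lemma ip_nrm2 f : ip f f = fine (nrm2 f).
Proof. by []. Qed.

Lemma nrm2_ip f : sq_int f -> nrm2 f = (ip f f)%:E.
Proof. by move=> [_ f2]; rewrite ip_nrm2 fineK// ge0_fin_numE// nrm2_ge0. Qed.

Lemma nrm2_eq0 f : measurable_fun setT f -> nrm2 f = 0%E <-> {ae mu, forall x, f x = 0}.
Proof.
move=> mf; have h := ae_eq_integral_abs mu measurableT (measurable_sqr mf).
have -> : nrm2 f = (\int[mu]_x `| (f x ^+ 2)%:E |)%E.
  by apply: eq_integral => x _; rewrite /= ger0_norm// sqr_ge0.
rewrite h; split; apply: filterS => x.
  by move=> /(_ I)[] /eqP; rewrite sqrf_eq0 => /eqP.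
by move=> fx0 _ /=; rewrite fx0 expr0n.
Qed.

Lemma nrm2_ae f g : measurable_fun setT f -> measurable_fun setT g ->
  {ae mu, forall x, f x = g x} -> nrm2 f = nrm2 g.
Proof.
move=> mf mg fg; apply: ge0_ae_eq_integral => //; try exact: measurable_sqr.
- by move=> x _; rewrite lee_fin sqr_ge0.
- by move=> x _; rewrite lee_fin sqr_ge0.
- by apply: filterS fg => x fgx _ /=; rewrite fgx.
Qed.

(* Riesz-Fischer: along a subsequence with [nrm2] of successive differences at most [8 ^ -k],
   the function [sum_k 4 ^ k (f_(k+1) - f_k)^2] is integrable, hence finite almost everywhere. *)
Lemma ae_cvg_subsequence (f_ : nat -> T -> R) : (forall n, measurable_fun setT (f_ n)) ->
  (forall e, 0 < e -> exists n0, forall i j, (n0 <= i)%N -> (n0 <= j)%N ->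
     (nrm2 (f_ i - f_ j)%R <= e%:E)%E) ->
  exists g : nat -> nat, exists f, [/\ forall k, (k <= g k)%N, measurable_fun setT f &
    {ae mu, forall x, f_ (g k) x @[k --> \oo] --> f x}].
Proof.
move=> mf cf.
have c8 (k : nat) : exists n0, forall i j, (n0 <= i)%N -> (n0 <= j)%N ->
     (nrm2 (f_ i - f_ j)%R <= ((8 ^+ k)^-1)%:E)%E.
  by apply: cf; rewrite invr_gt0 exprn_gt0.
have [N hN] := choice c8.
(* Summing the ranks makes both [g k] and [g k.+1] at least [N k], which bounds [D k]; the added [k]
   ensures [k <= g k]. *)
pose g k := (\sum_(i < k.+1) N i + k)%N.
have gN k : (N k <= g k)%N.
  by rewrite /g big_ord_recr/= -addnA addnCA leq_addr.
have gS k : (N k <= g k.+1)%N.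
  by rewrite /g 2!big_ord_recr/= -!addnA addnCA leq_addr.
pose D k x := f_ (g k.+1) x - f_ (g k) x.
have mD k : measurable_fun setT (D k) by exact: measurable_funB.
have D8 k : (nrm2 (D k) <= ((8 ^+ k)^-1)%:E)%E by apply: hN.
pose G (k : nat) x : \bar R := ((4 ^+ k)%:E * (D k x ^+ 2)%:E)%E.
have G0 k x : (0 <= G k x)%E by rewrite /G -EFinM lee_fin mulr_ge0 ?sqr_ge0.
have mG k : measurable_fun setT (G k) by apply: measurable_funeM; exact: measurable_sqr.
pose S x := (\sum_(k <oo) G k x)%E.
have mS : measurable_fun setT S by apply: ge0_emeasurable_sum.
have iS : mu.-integrable setT S.
  apply/integrableP; split => //.
  rewrite (eq_integral S); last by move=> x _; rewrite gee0_abs// nneseries_ge0.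
  rewrite integral_nneseries//.
  apply: (@le_lt_trans _ _ (\sum_(k <oo) ((2 / (2 ^ k.+1)%:R)%:E : \bar R))%E); last first.
    apply: le_lt_trans (epsilon_trick0 xpredT _) _ => //.
    by rewrite ltry.
  apply: lee_nneseries => k _; first by move=> _; apply: integral_ge0.
  rewrite ge0_integralZl//; last 2 first.
  - exact: measurable_sqr.
  - by move=> x _; rewrite lee_fin sqr_ge0.
  apply: (@le_trans _ _ ((4 ^+ k)%:E * ((8 ^+ k)^-1)%:E)%E).
    by apply: lee_wpmul2l; [rewrite lee_fin|exact: D8].
  rewrite -EFinM lee_fin natrX exprS invfM mulrA mulfV ?mul1r ?expf_neq0//.
  rewrite (_ : 8 = 4 * 2 :> R); last by ring.
  by rewrite exprMn invfM mulrA mulfV ?mul1r ?expf_neq0.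
have Sfin := integrable_ae measurableT iS.
(* The upper limit is measurable without any convergence. At the exceptional points, a null set,
   [fine] returns some real value. *)
pose f x := fine (limn_esup (fun k => (f_ (g k) x)%:E)).
exists g, f; split.
- by move=> k; rewrite /g leq_addl.
- apply: measurableT_comp => //; apply: measurable_fun_limn_esup => k.
  exact/measurable_EFinP.
apply: filterS Sfin => x /(_ I) Sx.
suff cv : cvgn (fun k => f_ (g k) x).
  have cvE : (fun k => (f_ (g k) x)%:E) @ \oo --> (limn (fun k => f_ (g k) x))%:E.
    by apply/fine_cvgP; split; [exact: nearW|exact: cv].
  rewrite /f is_cvg_limn_esupE; last by apply/cvg_ex; eexists; exact: cvE.
  by rewrite (cvg_lim _ cvE).
pose M := fine (S x).
have GM k : 4 ^+ k * D k x ^+ 2 <= M.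
  rewrite -lee_fin /M fineK// EFinM -[leLHS]/(G k x).
  apply: le_trans (nneseries_lim_ge k.+1 _); last by [].
  by rewrite big_mkord big_ord_recr/= leeDr// sume_ge0.
have M0 : 0 <= M by apply: le_trans (GM 0%N); rewrite mulr_ge0// sqr_ge0.
(* [GM] reads [|D k x| <= Num.sqrt M * 2^-k], a geometric bound. *)
have cD : cvgn (series (fun k => D k x)).
  apply: normed_cvg.
  apply: (@series_le_cvg _ _ (geometric (Num.sqrt M) (2^-1))).
  - by move=> n /=.
  - by move=> n; rewrite /geometric/= mulr_ge0 ?sqrtr_ge0// exprn_ge0.
  - move=> n; rewrite /geometric/= -(ler_pM2r (x := 2 ^+ n)) ?exprn_gt0//.
    rewrite -mulrA -exprMn mulVf// expr1n mulr1.
    rewrite -ler_sqr ?nnegrE ?sqrtr_ge0 ?mulr_ge0 ?exprn_ge0//.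
    rewrite sqr_sqrtr// exprMn real_normK ?num_real// mulrC.
    by rewrite exprAC (_ : 2 ^+ 2 = 4 :> R) ?GM//; ring.
  - by apply: is_cvg_geometric_series; rewrite ger0_norm// invf_lt1// ltr1n.
have -> : (fun k => f_ (g k) x) = (fun k => f_ (g 0%N) x + series (fun k => D k x) k).
  apply/funext => k; rewrite (_ : series _ k = f_ (g k) x - f_ (g 0%N) x); first by ring.
  by rewrite seriesEnat/= (GRing.telescope_sumr (fun k => f_ (g k) x)).
by apply: is_cvgD => //; exact: is_cvg_cst.
Qed.

End SquareIntegrable.

(** * Test functions *)

Section Smooth.
Context {R : realType} {N : nat}.
Implicit Types (f g : 'rV[R]_N -> R).

Lemma coord_le_norm (x : 'rV[R]_N) i : `|x ord0 i| <= `|x|.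
Proof.
rewrite [leRHS]/Num.Def.normr/= mx_normrE; apply/bigmax_geP; right => /=.
by exists (ord0, i).
Qed.

Lemma norm_le_coord (x : 'rV[R]_N) (M : R) : 0 <= M -> (forall i, `|x ord0 i| <= M) -> `|x| <= M.
Proof.
move=> M0 hM; rewrite [leLHS]/Num.Def.normr/= mx_normrE; apply: bigmax_le => // -[i j] _ /=.
by rewrite (ord1 i).
Qed.

Lemma class_C_continuous k f : class_C k f -> continuous f.
Proof. by case: k => [|k] []. Qed.

Lemma class_CW k f : class_C k.+1 f -> class_C k f.
Proof.
elim: k f => [|k IH] f [cf h]; split => // i.
by have [df] := h i; split => //; exact: IH.
Qed.

Lemma class_C_cst k (a : R) : class_C k (fun _ : 'rV[R]_N => a).
Proof.
elim: k a => [|k IH] a; split; try exact: cst_continuous; [by []|].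
move=> i; split; first by move=> x; exact: derivable_cst.
have -> : (fun x => 'D_(delta_mx ord0 i) (fun _ : 'rV[R]_N => a) x) = fun=> 0.
  by apply/funext => x; exact: derive_cst.
exact: IH.
Qed.

Lemma class_CD k f g : class_C k f -> class_C k g -> class_C k (f + g).
Proof.
elim: k f g => [|k IH] f g [cf hf] [cg hg]; (split; first by move=> x; exact: (cvgD (cf x) (cg x))) => //.
move=> i; have [df kf] := hf i; have [dg kg] := hg i; split.
  by move=> x; exact: derivableD.
have -> : (fun x => 'D_(delta_mx ord0 i) (f + g) x) =
    (fun x => 'D_(delta_mx ord0 i) f x) + (fun x => 'D_(delta_mx ord0 i) g x).
  by apply/funext => x; exact: deriveD.
exact: IH.
Qed.

Lemma class_CM k f g : class_C k f -> class_C k g -> class_C k (f * g).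
Proof.
elim: k f g => [|k IH] f g hf hg.
  by split => //; rewrite mulrfctE => x; exact: (cvgM (hf.1 x) (hg.1 x)).
have cf : continuous f := hf.1; have cg : continuous g := hg.1.
split; first by rewrite mulrfctE => x; exact: (cvgM (cf x) (cg x)).
move=> i; have [df kf] := hf.2 i; have [dg kg] := hg.2 i; split.
  by move=> x; exact: derivableM.
have -> : (fun x => 'D_(delta_mx ord0 i) (f * g) x) =
    f * (fun x => 'D_(delta_mx ord0 i) g x) + g * (fun x => 'D_(delta_mx ord0 i) f x).
  by apply/funext => x; exact: deriveM.
by apply: class_CD; apply: IH => //; exact: class_CW.
Qed.

(** Only a directional derivative is assumed, not differentiability, so the chain rule is applied to
    the restriction of [f] to a line. *)
Lemma is_derive_affine f (c : R) (p v x : 'rV[R]_N) : derivable f (c *: x + p) v ->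
  is_derive x v (fun y => f (c *: y + p)) (c * 'D_v f (c *: x + p)).
Proof.
move=> df.
pose psi (h : R) := f (h *: v + (c *: x + p)).
have dpsi : is_derive (0 : R) 1 psi ('D_v f (c *: x + p)).
  have d : derivable psi 0 1 := (derivable1P _ _ _).1 df.
  apply: DeriveDef => //; rewrite /derive.
  suff -> : (fun h : R => h^-1 *: ((psi \o shift 0) (h *: 1) - psi 0)) =
    (fun h => h^-1 *: ((f \o shift (c *: x + p)) (h *: v) - f (c *: x + p))) by [].
  by apply/funext => h; rewrite /psi /= addr0 scale0r add0r [_%:A]mulr1.
pose phi (h : R) := f (c *: (h *: v + x) + p).
have phiE : phi = psi \o (fun h : R => c * h).
  by apply/funext => h; rewrite /phi /psi /= scalerDr scalerA addrA.
have dphi : is_derive (0 : R) 1 phi (c * 'D_v f (c *: x + p)).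
  rewrite phiE mulrC.
  have dc : is_derive (0 : R) 1 (fun h : R => c * h) c.
    have := is_deriveZ c (is_derive_id (0 : R) (1 : R)).
    by rewrite /GRing.scale/= mulr1.
  by apply: is_derive1_comp; rewrite ?mulr0.
have dphi' : derivable phi 0 1 by case: dphi.
apply: DeriveDef; first exact/derivable1P.
case: dphi => _ <-; rewrite /derive.
suff -> : (fun h : R => h^-1 *: ((phi \o shift 0) (h *: 1) - phi 0)) =
  (fun h => h^-1 *: (((fun y => f (c *: y + p)) \o shift x) (h *: v) - f (c *: x + p))) by [].
by apply/funext => h; rewrite /phi /= addr0 scale0r add0r [_%:A]mulr1.
Qed.

Lemma class_C_affine k f (c : R) (p : 'rV[R]_N) : class_C k f ->
  class_C k (fun x => f (c *: x + p)).
Proof.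
have caff : continuous (fun x : 'rV[R]_N => c *: x + p).
  have sc : continuous (fun x : 'rV[R]_N => c *: x) by exact: scaler_continuous.
  move=> x; exact: (cvgD (sc x) (cvg_cst p)).

elim: k f => [|k IH] f [cf hf].
  by split => // x; exact: (cvg_comp _ _ (caff x) (cf (c *: x + p))).
split; first by move=> x; exact: (cvg_comp _ _ (caff x) (cf (c *: x + p))).
move=> i; have [df kf] := hf i; split.
  by move=> x; have [] := is_derive_affine (df (c *: x + p)).
have -> : (fun x => 'D_(delta_mx ord0 i) (fun x => f (c *: x + p)) x) =
    (fun=> c) * (fun x => 'D_(delta_mx ord0 i) f (c *: x + p)).
  by apply/funext => x; have [_ ->] := is_derive_affine (df (c *: x + p)).
by apply: class_CM; [exact: class_C_cst|exact: (IH _ kf)].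
Qed.

Lemma smooth_cst (a : R) : smooth (fun _ : 'rV[R]_N => a).
Proof. by move=> k; exact: class_C_cst. Qed.

Lemma smoothD f g : smooth f -> smooth g -> smooth (f + g).
Proof. by move=> sf sg k; exact: class_CD. Qed.

Lemma smoothM f g : smooth f -> smooth g -> smooth (f * g).
Proof. by move=> sf sg k; exact: class_CM. Qed.

Lemma smoothZ (c : R) f : smooth f -> smooth (c *: f).
Proof. by move=> sf; apply: (@smoothM (fun=> c)) => //; exact: smooth_cst. Qed.

Definition supp f : set 'rV[R]_N := closure [set x | f x != 0].

Lemma test_function_closed Omega f (S : set 'rV[R]_N) : smooth f -> compact S -> S `<=` Omega ->
  (forall x, f x != 0 -> S x) -> test_function Omega f.
Proof.
move=> sf cS SO fS.
have clS : closed S by apply: compact_closed => //; exact: norm_hausdorff.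
have subS : supp f `<=` S by rewrite [X in _ `<=` X](closure_id S).1//; exact: closureS.
split => //; last exact: subset_trans SO.
by apply: subclosed_compact cS subS; exact: closed_closure.
Qed.

Lemma test_function0 Omega : test_function Omega (0 : 'rV[R]_N -> R).
Proof.
apply: (@test_function_closed _ _ set0) => //; [exact: smooth_cst|exact: compact0|].
by move=> x; rewrite eqxx.
Qed.

Lemma supp_neq0 f x : f x != 0 -> supp f x.
Proof. by move=> fx; apply: subset_closure. Qed.

Lemma test_functionL Omega (c : R) f g : test_function Omega f -> test_function Omega g ->
  test_function Omega (c *: f + g).
Proof.
move=> [sf cf fO] [sg cg gO].
apply: (@test_function_closed _ _ (supp f `|` supp g)).
- by apply: smoothD => //; exact: smoothZ.
- exact: compactU.
- by rewrite subUset.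
- move=> x; have -> : (c *: f + g) x = c * f x + g x by [].
  have [fx|fx _] := eqVneq (f x) 0; last by left; exact: supp_neq0.
  by rewrite fx mulr0 add0r => gx; right; exact: supp_neq0.
Qed.

Lemma test_functionM Omega f g : smooth f -> test_function Omega g -> test_function Omega (f * g).
Proof.
move=> sf [sg cg gO]; apply: (@test_function_closed _ _ (supp g)) => //; first exact: smoothM.
move=> x fg; apply: supp_neq0; apply: contra fg => /eqP gx.
by have -> : (f * g) x = f x * g x by []; rewrite gx mulr0.
Qed.

Lemma test_functionW Omega1 Omega2 f : Omega1 `<=` Omega2 ->
  test_function Omega1 f -> test_function Omega2 f.
Proof. by move=> O12 [sf cf fO]; split => //; exact: subset_trans O12. Qed.

Lemma test_function_bounded Omega f : test_function Omega f -> exists2 M, 0 < M & forall x, `|f x| <= M.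
Proof.
move=> [sf cf _]; have ctf := class_C_continuous (sf 0%N).
have ccf : compact (f @` supp f).
  by apply: continuous_compact => //; exact: continuous_subspaceT.
have [M [_ hM]] := compact_bounded ccf.
exists (`|M| + 1); first by rewrite ltr_wpDl.
move=> x; have [->|fx] := eqVneq (f x) 0; first by rewrite normr0 addr_ge0.
apply: (hM (`|M| + 1)); first by rewrite ltr_pwDr// ler_norm.
by exists x => //; exact: supp_neq0.
Qed.

Lemma supp_derive f i x : 'D_(delta_mx ord0 i) f x != 0 -> supp f x.
Proof.
move=> Df; apply: contrapT => nx.
have : open (~` supp f) by apply: closed_openC; exact: closed_closure.
rewrite openE => /(_ x nx) nbx.
move/negP : Df; apply; apply/eqP.
rewrite -[RHS](derive_cst (0 : R) x (delta_mx ord0 i : 'rV[R]_N)).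
apply: near_eq_derive; apply: filterS nbx => y ny.
by apply/eqP; apply: contrapT => /negP /supp_neq0.
Qed.

Lemma test_function_derive Omega f i : test_function Omega f ->
  test_function Omega (fun x => 'D_(delta_mx ord0 i) f x).
Proof.
move=> [sf cf fO]; apply: (test_function_closed _ cf fO) => [k|x].
  by have := (sf k.+1).2 i; case.
exact: supp_derive.
Qed.

Lemma coord_lipschitz f i (M : R) (x : 'rV[R]_N) (t : R) : smooth f ->
  (forall y, `|'D_(delta_mx ord0 i) f y| <= M) ->
  `|f (t *: delta_mx ord0 i + x) - f x| <= M * `|t|.
Proof.
move=> sf hM; set e := delta_mx ord0 i.
have [df _] := (sf 1%N).2 i.
pose psi (h : R) := f (h *: e + x).
have dpsi (s : R) : is_derive s 1 psi ('D_e f (s *: e + x)).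
  have E : (fun h : R => h^-1 *: ((psi \o shift s) (h *: 1) - psi s)) =
      (fun h => h^-1 *: ((f \o shift (s *: e + x)) (h *: e) - f (s *: e + x))).
    by apply/funext => h; rewrite /psi /= [_%:A]mulr1 scalerDl addrA.
  apply: DeriveDef; last by rewrite /derive E.
  by have := df (s *: e + x); rewrite /derivable E.
have cpsi : continuous psi.
  by move=> s; apply/differentiable_continuous/derivable1_diffP; case: (dpsi s).
have -> : f x = psi 0 by rewrite /psi scale0r add0r.
rewrite -/(psi t).
have [t0|/ltW t0] := leP 0 t.
  have [c _ ->] := MVT_segment t0 (fun s _ => dpsi s) (continuous_subspaceT cpsi).
  by rewrite subr0 normrM ler_wpM2r.
have [c _ h] := MVT_segment t0 (fun s _ => dpsi s) (continuous_subspaceT cpsi).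
by rewrite distrC h sub0r normrM normrN ler_wpM2r.
Qed.

(** With partial derivatives only, one passes from one point to the other by changing one coordinate
    at a time; [z k] has its first [k] coordinates changed. The mean value theorem handles each
    segment. *)
Lemma test_function_lipschitz Omega f : test_function Omega f ->
  exists2 M, 0 < M & forall x y, `|f x - f y| <= M * \sum_i `|x ord0 i - y ord0 i|.
Proof.
move=> tf; have sf : smooth f by case: tf.
have [M hM] := choice (fun i => let: ex_intro2 M _ h := test_function_bounded (test_function_derive i tf)
  in ex_intro (fun M => forall y, `|'D_(delta_mx ord0 i) f y| <= M) M h).
pose L := 1 + \sum_i `|M i|.
have L0 : 0 < L by rewrite ltr_pwDl// sumr_ge0.
have ML i : M i <= L.
  rewrite (le_trans (ler_norm _))// /L (bigD1 i)//= addrCA lerDl.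
  by rewrite addr_ge0// sumr_ge0.
exists L => // y x.
pose z k : 'rV[R]_N := \row_j (if (j < k)%N then y ord0 j else x ord0 j).
have zS (k : 'I_N) : z k.+1 = (y ord0 k - x ord0 k) *: delta_mx ord0 k + z k.
  apply/rowP => j; rewrite !mxE eqxx/= ltnS.
  have [->|jk] := eqVneq j k; first by rewrite leqnn ltnn mulr1 subrK.
  by rewrite leq_eqVlt val_eqE (negbTE jk) mulr0 add0r.
have -> : f y - f x = \sum_(k < N) (f (z k.+1) - f (z k)).
  rewrite -(big_mkord xpredT (fun k => f (z k.+1) - f (z k))) (GRing.telescope_sumr (fun k => f (z k)))//.
  congr (f _ - f _); apply/rowP => j; rewrite mxE ?ltn_ord//.
rewrite mulr_sumr; apply: le_trans (ler_norm_sum _ _ _) _.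
apply: ler_sum => k _; rewrite zS; apply: coord_lipschitz => // w.
exact: le_trans (hM k w) (ML k).
Qed.

Lemma test_function_supp_bounded Omega f : test_function Omega f ->
  exists2 M, 0 < M & forall x, f x != 0 -> forall i, `|x ord0 i| <= M.
Proof.
move=> [_ /compact_bounded[M [_ hM]] _]; exists (`|M| + 1); first by rewrite ltr_wpDl.
move=> x /supp_neq0 fx i.
have hlt : M < `|M| + 1 by rewrite ltr_pwDr ?ler_norm.
exact: le_trans (coord_le_norm x i) (hM _ hlt x fx).
Qed.
End Smooth.

(** * The Gagliardo kernel *)

Section Geometry.
Context {R : realType} {N : nat}.
Implicit Types (x y : 'rV[R]_N) (f : 'rV[R]_N -> R).

Lemma measurable_box (A : 'I_N -> set (measurableTypeR R)) : (forall i, measurable (A i)) ->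
  measurable [set x : 'rV[R]_N | forall i, A i (x ord0 i)].
Proof.
move=> mA.
have -> : [set x : 'rV[R]_N | forall i, A i (x ord0 i)] =
    \bigcap_i [set x : 'rV[R]_N | A i (x ord0 i)].
  by apply/seteqP; split => v /=; [move=> h i _; exact: h|move=> h i; exact: h].
apply: fin_bigcap_measurable => // i _.
by rewrite -[X in measurable X]setTI; exact: measurable_rV_coord.
Qed.

(** The sigma-algebra is generated by the coordinates, so an open set is exhibited as a countable
    union of boxes with rational centre and radius the inverse of an integer. *)
Lemma open_measurable_rV (U : set 'rV[R]_N) : open U -> measurable U.
Proof.
move=> oU.
pose box (q : 'rV[rat]_N * nat) := [set x : 'rV[R]_N | forall i, `|x ord0 i - ratr (q.1 ord0 i)| < q.2.+1%:R^-1].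
pose F q := if `[< box q `<=` U >] then box q else set0.
suff -> : U = \bigcup_q F q.
  apply: countable_bigcupT_measurable => // q; rewrite /F; case: ifP => // _.
  apply: (measurable_box (A := fun i => [set t | `|t - ratr (q.1 ord0 i)| < q.2.+1%:R^-1])) => i.
  have -> : [set t : R | `|t - ratr (q.1 ord0 i)| < q.2.+1%:R^-1] = ball (ratr (q.1 ord0 i) : R) (q.2.+1%:R^-1 : R).
    by apply/seteqP; split => t /=; rewrite /ball/= distrC.
  exact: measurable_ball.
apply/seteqP; split => [x Ux|x [q _]]; last by rewrite /F; case: ifPn => // /asboolP; apply.
have := open_nbhs_nbhs (conj oU Ux : open_nbhs x U) => /nbhs_ballP[e /= e0 eU].
(* The radius stays below [e / 2]: both [x] and any [y] of the box are that close to the rational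
   centre. *)
have [n0 hn0] := @inv_nat_small R (e / 2) ltac:(by rewrite divr_gt0).
have {hn0} := hn0 n0 (leqnn _) => hn0.
have qx i : exists q : rat, `|x ord0 i - ratr q| < n0.+1%:R^-1.
  have : 0 < n0.+1%:R^-1 :> R by rewrite invr_gt0.
  move: (n0.+1%:R^-1 : R) => d d0.
  have [|q] := @rat_in_itvoo R (x ord0 i - d) (x ord0 i + d); first by lra.
  rewrite in_itv/= => hq; exists q; rewrite distrC ltr_norml.
  by move: hq => /andP[h1 h2]; apply/andP; split; lra.
have [q hq] := choice qx.
exists (\row_i q i, n0) => //; rewrite /F ifT; first by move=> i /=; rewrite mxE; exact: hq.
apply/asboolP => y /= yb; apply: eU; rewrite -ball_normE /ball_/=.
have e2 : `|x - y| <= n0.+1%:R^-1 + n0.+1%:R^-1.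
  apply: norm_le_coord; first by rewrite addr_ge0.
  move=> i; rewrite !mxE.
  have := hq i; have := yb i; rewrite /= mxE => h1 h2.
  by rewrite (le_trans (ler_distD (ratr (q i)) _ _))// lerD// ltW// distrC.
by apply: le_lt_trans e2 _; rewrite [ltRHS]splitr ltrD.
Qed.

Lemma continuous_measurable_rV f : continuous f -> measurable_fun setT f.
Proof.
move=> /continuousP cf; apply: (measurability _ (RGenOpens.measurableE R)).
move=> _ [_ [a [b ->] <-]]; rewrite setTI; apply: open_measurable_rV.
exact/cf/interval_open.
Qed.

Lemma eucl_ge0 x : 0 <= eucl x.
Proof. exact: sqrtr_ge0. Qed.

Lemma coord_le_eucl x i : `|x ord0 i| <= eucl x.
Proof.
rewrite /eucl -sqrtr_sqr ler_wsqrtr// (bigD1 i)//= lerDl sumr_ge0// => j _.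
exact: sqr_ge0.
Qed.

Lemma eucl_le_sum x : eucl x <= \sum_i `|x ord0 i|.
Proof.
have s0 : 0 <= \sum_i `|x ord0 i| by rewrite sumr_ge0.
rewrite /eucl -[leRHS]ger0_norm// -sqrtr_sqr ler_wsqrtr// expr2 mulr_suml.
apply: ler_sum => i _; rewrite -[leLHS]real_normK ?num_real// expr2.
by rewrite ler_wpM2l// (bigD1 i)//= lerDl sumr_ge0.
Qed.

Lemma eucl_le_coord x (M : R) : (forall i, `|x ord0 i| <= M) -> eucl x <= N%:R * M.
Proof.
move=> h; apply: le_trans (eucl_le_sum x) _.
apply: le_trans (ler_sum _ (fun i _ => h i)) _.
by rewrite sumr_const card_ord mulr_natl.
Qed.

Lemma euclN x : eucl (- x) = eucl x.
Proof. by rewrite /eucl; congr Num.sqrt; apply: eq_bigr => i _; rewrite mxE sqrrN. Qed.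

Lemma eucl_eq0 x : eucl x = 0 -> x = 0.
Proof.
move=> x0; apply/rowP => i; rewrite mxE; apply/eqP; rewrite -normr_le0 -x0.
exact: coord_le_eucl.
Qed.

Lemma measurable_eucl_dist d (T : measurableType d) (f g : T -> 'rV[R]_N) :
  measurable_fun setT f -> measurable_fun setT g ->
  measurable_fun setT (fun t => eucl (f t - g t)).
Proof.
move=> mf mg.
have -> : (fun t => eucl (f t - g t)) = (fun t => Num.sqrt (\sum_i (f t ord0 i - g t ord0 i) ^+ 2)).
  by apply/funext => t; congr Num.sqrt; apply: eq_bigr => i _; rewrite !mxE.
have ms : measurable_fun setT (@Num.sqrt R).
  by apply: continuous_measurable_fun; exact: sqrt_continuous.
apply: (measurableT_comp ms).
apply: measurable_sum => i; apply: measurable_funX; apply: measurable_funB.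
  exact: (measurableT_comp (measurable_rV_coord i) mf).
exact: (measurableT_comp (measurable_rV_coord i) mg).
Qed.

Lemma kernel_ge0 s (z : 'rV[R]_N * 'rV[R]_N) : 0 <= gagliardo_kernel s z.
Proof. exact: powR_ge0. Qed.

Lemma kernel_diag s x : 0 < s -> gagliardo_kernel s (x, x) = 0.
Proof.
move=> s0; rewrite /gagliardo_kernel/= subrr.
have -> : eucl (0 : 'rV[R]_N) = 0.
  by rewrite /eucl big1 ?sqrtr0// => i _; rewrite mxE expr0n.
by rewrite powR0// gt_eqF// ltr_wpDl// mulr_gt0.
Qed.

Lemma kernel_gt0 s x y : x != y -> 0 < gagliardo_kernel s (x, y).
Proof.
move=> xy; apply: powR_gt0; rewrite lt_def eucl_ge0 andbT.
by apply: contra xy => /eqP /eucl_eq0 /eqP; rewrite subr_eq0.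
Qed.

Lemma kernel_sym s x y : gagliardo_kernel s (x, y) = gagliardo_kernel s (y, x).
Proof. by rewrite /gagliardo_kernel/= -opprB euclN. Qed.

Lemma kernel_le s x y (M : R) : 0 < s -> (forall i, `|x ord0 i - y ord0 i| <= M) ->
  gagliardo_kernel s (x, y) <= (N%:R * M) `^ (N%:R + 2 * s).
Proof.
move=> s0 h; have e : eucl (x - y) <= N%:R * M.
  by apply: eucl_le_coord => i; rewrite !mxE.
apply: ge0_ler_powR; rewrite ?nnegrE ?eucl_ge0//.
  by rewrite addr_ge0// mulr_ge0// ltW.
exact: le_trans (eucl_ge0 _) e.
Qed.

Lemma kernel_ge s x y (r : R) i : 0 < s -> 0 <= r -> r <= `|x ord0 i - y ord0 i| ->
  r `^ (N%:R + 2 * s) <= gagliardo_kernel s (x, y).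
Proof.
move=> s0 r0 h; apply: ge0_ler_powR; rewrite ?nnegrE ?eucl_ge0//.
  by rewrite addr_ge0// mulr_ge0// ltW.
by apply: le_trans h _; have := coord_le_eucl (x - y) i; rewrite !mxE.
Qed.

Lemma measurable_kernel s : measurable_fun [set: 'rV[R]_N * 'rV[R]_N] (@gagliardo_kernel R N s).
Proof.
have me : measurable_fun [set: 'rV[R]_N * 'rV[R]_N] (fun z => eucl (z.1 - z.2)).
  by apply: measurable_eucl_dist; [exact: measurable_fst|exact: measurable_snd].
exact: (measurableT_comp (measurable_powR (N%:R + 2 * s)) me).
Qed.

(* The Gagliardo energy is the squared L^2 norm of [dquot s u]; on the diagonal [0 / 0 = 0]. *)
Definition dquot s f (z : 'rV[R]_N * 'rV[R]_N) : R :=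
  (f z.1 - f z.2) / Num.sqrt (gagliardo_kernel s z).

Lemma measurable_dquot s f : measurable_fun setT f ->
  measurable_fun setT (dquot s f).
Proof.
move=> mf; apply: measurable_funM.
  apply: measurable_funB.
    exact: (measurableT_comp mf measurable_fst).
  exact: (measurableT_comp mf measurable_snd).
(* Powers are known to be measurable. On the diagonal both conventions, inverse of 0 and negative
   power of 0, give 0. *)
have -> : (fun z => (Num.sqrt (gagliardo_kernel s z))^-1) =
    (fun z : 'rV[R]_N * 'rV[R]_N => ((gagliardo_kernel s z) `^ 2^-1) `^ (-1)).
  by apply/funext => z; rewrite powR12_sqrt ?kernel_ge0// powR_inv1// sqrtr_ge0.
apply: (measurableT_comp (measurable_powR (-1))).
apply: (measurableT_comp (measurable_powR 2^-1)).
exact: measurable_kernel.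
Qed.

Lemma dquotE s f z : dquot s f z ^+ 2 = (f z.1 - f z.2) ^+ 2 / gagliardo_kernel s z.
Proof. by rewrite /dquot exprMn exprVn sqr_sqrtr// kernel_ge0. Qed.

Lemma dquotM s f g z : dquot s f z * dquot s g z =
  (f z.1 - f z.2) * (g z.1 - g z.2) / gagliardo_kernel s z.
Proof.
rewrite /dquot mulrACA -expr2 exprVn sqr_sqrtr ?kernel_ge0// mulrA.
Qed.

Lemma dquotL s c f g : dquot s (c *: f + g) = c *: dquot s f + dquot s g.
Proof.
apply/funext => z; rewrite /dquot.
have -> : (c *: f + g) z.1 = c * f z.1 + g z.1 by [].
have -> : (c *: f + g) z.2 = c * f z.2 + g z.2 by [].
have -> : (c *: (fun z => (f z.1 - f z.2) / Num.sqrt (gagliardo_kernel s z)) +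
    (fun z => (g z.1 - g z.2) / Num.sqrt (gagliardo_kernel s z))) z =
  c * ((f z.1 - f z.2) / Num.sqrt (gagliardo_kernel s z)) +
    (g z.1 - g z.2) / Num.sqrt (gagliardo_kernel s z) by [].
by rewrite mulrA -mulrDl; congr (_ * _); ring.
Qed.

Lemma gagliardo2E s f : gagliardo2 s f = nrm2 (leb N \x leb N)%E (dquot s f).
Proof. by apply: eq_integral => z _; rewrite dquotE. Qed.

Lemma leb2_setX (A B : set 'rV[R]_N) : measurable A -> measurable B ->
  (leb N \x leb N)%E (A `*` B) = (leb N A * leb N B)%E.
Proof. exact: product_measure1E. Qed.

(** A null set times the whole space is null, the product of 0 and an infinite measure being 0. *)
Lemma ae_leb2 (P : 'rV[R]_N -> Prop) : {ae leb N, forall x, P x} ->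
  {ae (leb N \x leb N)%E, forall z, P z.1 /\ P z.2}.
Proof.
move=> [A [mA A0 PA]].
have null (B : set ('rV[R]_N * 'rV[R]_N)) : measurable B -> (leb N \x leb N)%E B = 0%E ->
    (leb N \x leb N)%E.-negligible B by move=> mB B0; exists B; split.
have n1 : (leb N \x leb N)%E.-negligible (A `*` setT).
  by apply: null; [exact: measurableX|rewrite leb2_setX// A0 mul0e].
have n2 : (leb N \x leb N)%E.-negligible (setT `*` A).
  by apply: null; [exact: measurableX|rewrite leb2_setX// A0 mule0].
apply: negligibleS (negligibleU n1 n2) => z /= nP.
apply: contrapT => /not_orP[/= h1 h2]; apply: nP; split; apply: contrapT => nP.
  by apply: h1; split => //; exact: PA.
by apply: h2; split => //; exact: PA.
Qed.

Lemma gagliardo2_ae s f g : measurable_fun setT f -> measurable_fun setT g ->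
  {ae leb N, forall x, f x = g x} -> gagliardo2 s f = gagliardo2 s g.
Proof.
move=> mf mg fg; rewrite !gagliardo2E; apply: nrm2_ae; try exact: measurable_dquot.
by apply: filterS (ae_leb2 fg) => z [h1 h2]; rewrite /dquot h1 h2.
Qed.

Definition cube (a : 'rV[R]_N) (r : R) : set 'rV[R]_N :=
  [set x | forall i, a ord0 i <= x ord0 i < a ord0 i + r].

Lemma cubeE (a : 'rV[R]_N) (r : R) :
  cube a r = [set x | forall i, `[a ord0 i, a ord0 i + r[%classic (x ord0 i)].
Proof. by apply/seteqP; split => x /= h i; have := h i; rewrite /= in_itv. Qed.

Lemma measurable_cube a r : measurable (cube a r).
Proof.
rewrite cubeE; apply: (measurable_box (A := fun i => `[a ord0 i, a ord0 i + r[%classic)) => i.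
exact: measurable_itv.
Qed.

Lemma leb_cube (a : 'rV[R]_N) (r : R) : 0 <= r -> leb N (cube a r) = (r ^+ N)%:E.
Proof.
move=> r0; rewrite cubeE (leb_box (A := fun i => `[a ord0 i, a ord0 i + r[%classic)); last first.
  by move=> i; exact: measurable_itv.
rewrite (eq_bigr (fun=> r%:E)).
  by rewrite prodEFin prodr_const card_ord.
move=> i _; rewrite lebesgue_measure_itv/= lte_fin ltrDl.
case: ltP => r0'; first by rewrite -EFinB addrAC subrr add0r.
by congr EFin; apply/eqP; rewrite eq_le r0 r0'.
Qed.

Lemma integral_cube (a : 'rV[R]_N) (r : R) : 0 <= r ->
  (\int[leb N]_x (\1_(cube a r) x)%:E = (r ^+ N)%:E)%E.
Proof.
move=> r0; rewrite integral_indic//; last exact: measurable_cube.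
by rewrite setIT; exact: leb_cube.
Qed.

End Geometry.

(** * Dyadic scales and geometric series *)

Lemma term_le_nneseries (R : realType) (u : nat -> \bar R) k :
  (forall n, (0 <= u n)%E) -> (u k <= \sum_(n <oo) u n)%E.
Proof.
move=> u0; apply: le_trans (nneseries_lim_ge k.+1 _); last by [].
by rewrite big_mkord big_ord_recr/= leeDr// sume_ge0.
Qed.

Lemma geometric_nneseries_lty (R : realType) (a z : R) : 0 <= a -> 0 <= z < 1 ->
  (\sum_(k <oo) (a * z ^+ k)%:E < +oo)%E.
Proof.
move=> a0 /andP[z0 z1].
have cv : cvgn (series (geometric a z)) by apply: is_cvg_geometric_series; rewrite ger0_norm.
have -> : (\sum_(k <oo) (a * z ^+ k)%:E = (limn (series (geometric a z)))%:E)%E.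
  rewrite -EFin_lim//; congr (limn _); apply/funext => n.
  by rewrite /= -sumEFin.
by rewrite ltry.
Qed.

Lemma dyadic_inner (R : realType) (m : R) : 0 < m <= 1 ->
  exists k, (2^-1) ^+ k.+1 < m <= (2^-1) ^+ k.
Proof.
move=> /andP[m0 m1].
have ex : exists k, (2^-1 : R) ^+ k.+1 < m.
  have [n0 h] := inv_nat_small m0; exists n0; apply: le_lt_trans (h n0 (leqnn _)).
  rewrite exprVn lef_pV2 ?posrE ?exprn_gt0//.
  by rewrite -natrX ler_nat ltnW// ltn_expl.
have := ex_minnP ex; case: ex_minnP => k hk kmin _; exists k; rewrite hk/=.
case: k hk kmin => [|k] hk kmin; first by rewrite expr0.
by rewrite leNgt; apply/negP => /kmin; rewrite ltnn.
Qed.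

Lemma dyadic_outer (R : realType) (m : R) : 1 < m ->
  exists k, 2 ^+ k < m <= 2 ^+ k.+1.
Proof.
move=> m1.
have ex : exists k, m <= 2 ^+ k.+1.
  exists (Num.bound m); apply: le_trans (ltW (archi_boundP (ltW (lt_trans ltr01 m1)))) _.
  by rewrite -natrX ler_nat ltnW// (leq_trans (ltn_expl _ (ltnSn 1)))// leq_exp2l.
have := ex_minnP ex; case: ex_minnP => k hk kmin _; exists k; rewrite hk andbT.
case: k hk kmin => [|k] hk kmin; first by rewrite expr0.
by rewrite ltNge; apply/negP => /kmin; rewrite ltnn.
Qed.

Lemma powR_exprn (R : realType) (x a : R) k : 0 <= x -> (x ^+ k) `^ a = (x `^ a) ^+ k.
Proof.
by move=> x0; rewrite -(powR_mulrn k x0) -powRrM mulrC powRrM powR_mulrn// powR_ge0.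
Qed.

Section Lipschitz.
Context {R : realType} {N : nat}.

(* Both dyadic series over the cubes of side comparable to [2 ^ -k] and [2 ^ k] around [x]
   are geometric because [0 < s < 1]. *)
Lemma lipschitz_energy_density (s B L : R) (phi : 'rV[R]_N -> R) : 0 < s -> s < 1 ->
  0 <= B -> 0 <= L -> measurable_fun setT phi ->
  (forall x, `|phi x| <= B) -> (forall x y, `|phi x - phi y| <= L * `|x - y|) ->
  exists2 C : R, 0 <= C & forall x : 'rV[R]_N,
    (\int[leb N]_y ((phi x - phi y) ^+ 2 / gagliardo_kernel s (x, y))%:E <= C%:E)%E.
Proof.
move=> s0 s1 B0 L0 mphi phiB phiL.
pose p : R := N%:R + 2 * s; pose q : R := 2 `^ p; pose t : R := 2 `^ (2 * s).
have q0 : 0 < q by apply: powR_gt0.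
have qt : q = 2 ^+ N * t by rewrite /q /p powRD ?powR_mulrn//; apply/implyP.
have t0 : 0 < t by apply: powR_gt0.
have powR_gt1 (a r : R) : 1 < a -> 0 < r -> 1 < a `^ r.
  move=> a1 r0; rewrite -[ltLHS](congr1 (fun f => f r) (@powR1 R)).
  by apply: gt0_ltr_powR => //; rewrite nnegrE// ltW// (lt_trans ltr01).
have t1 : 1 < t by apply: powR_gt1; [rewrite ltr1n|rewrite mulr_gt0].
(* This uses [s < 1] and makes the series of small scales, of ratio [t / 4], converge. The series of
   large scales has ratio [t^-1], below 1 because [s] is positive. *)
have t4 : t < 4.
  have -> : t = 4 `^ s.
    rewrite /t powRrM; congr (_ `^ _).
    by rewrite (powR_mulrn 2)//; ring.
  have four : 4 = 4 `^ s * 4 `^ (1 - s) :> R.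
    rewrite -powRD; first by rewrite addrC subrK powRr1.
    by apply/implyP => _.
  by rewrite [ltRHS]four ltr_pMr ?powR_gt0// powR_gt1// ?ltr1n// subr_gt0.
(* [c k] bounds the integrand when [|x - y|] lies between [2^-(k+1)] and [2^-k], by the Lipschitz
   bound and a kernel at least [q^-(k+1)]. [d k] bounds it between [2^k] and [2^(k+1)], by the sup
   bound and a kernel at least [q^k]. *)
pose c k : R := L ^+ 2 * (4^-1) ^+ k * q ^+ k.+1.
pose d k : R := (4 * B ^+ 2) * (q^-1) ^+ k.
pose ones : 'rV[R]_N := const_mx 1.
(* The side is three times the radius rather than twice, so that a half-open cube contains the
   closed ball of the sup norm. *)
pose Q1 (x : 'rV[R]_N) k := cube (x - (2^-1) ^+ k *: ones) (3 * (2^-1) ^+ k).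
pose Q2 (x : 'rV[R]_N) k := cube (x - 2 ^+ k.+1 *: ones) (3 * 2 ^+ k.+1).
have c0 k : 0 <= c k by rewrite !mulr_ge0// ?exprn_ge0// ltW.
have d0 k : 0 <= d k by rewrite !mulr_ge0// ?exprn_ge0// ltW// invr_gt0.
pose G1 x (k : nat) y : \bar R := ((c k)%:E * (\1_(Q1 x k) y)%:E)%E.
pose G2 x (k : nat) y : \bar R := ((d k)%:E * (\1_(Q2 x k) y)%:E)%E.
have G10 x k y : (0 <= G1 x k y)%E by rewrite mule_ge0// lee_fin.
have G20 x k y : (0 <= G2 x k y)%E by rewrite mule_ge0// lee_fin.
have mG1 x k : measurable_fun setT (G1 x k).
  by apply: measurable_funeM; apply/measurable_EFinP; apply: measurable_indic; exact: measurable_cube.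
have mG2 x k : measurable_fun setT (G2 x k).
  by apply: measurable_funeM; apply/measurable_EFinP; apply: measurable_indic; exact: measurable_cube.
have IG1 x k : (\int[leb N]_y G1 x k y = (L ^+ 2 * q * 3 ^+ N * (t / 4) ^+ k)%:E)%E.
  rewrite ge0_integralZl//; last 2 first.
  - by apply/measurable_EFinP; apply: measurable_indic; exact: measurable_cube.
  - by rewrite lee_fin.
  rewrite /Q1 integral_cube; last by rewrite mulr_ge0// exprn_ge0.
  rewrite -EFinM; congr EFin.
  have <- : (4^-1) ^+ k * q ^+ k * ((2 ^+ N)^-1) ^+ k = (t / 4) ^+ k.
    rewrite -!exprMn; congr (_ ^+ _); rewrite qt; field.
    by rewrite expf_neq0.
  by rewrite /c (exprS q) exprMn exprAC (exprVn 2 N); ring.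
have IG2 x k : (\int[leb N]_y G2 x k y = (4 * B ^+ 2 * 6 ^+ N * (t^-1) ^+ k)%:E)%E.
  rewrite ge0_integralZl//; last 2 first.
  - by apply/measurable_EFinP; apply: measurable_indic; exact: measurable_cube.
  - by rewrite lee_fin.
  rewrite /Q2 integral_cube; last by rewrite mulr_ge0// exprn_ge0.
  rewrite -EFinM; congr EFin.
  have <- : (q^-1) ^+ k * (2 ^+ N) ^+ k = (t^-1) ^+ k.
    rewrite -!exprMn; congr (_ ^+ _); rewrite qt; field.
    by rewrite expf_neq0// gt_eqF.
  rewrite /d (exprS 2) mulrA (_ : 3 * 2 = 6 :> R); last by ring.
  by rewrite exprMn exprAC; ring.
pose S := (\sum_(k <oo) (L ^+ 2 * q * 3 ^+ N * (t / 4) ^+ k)%:E +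
  \sum_(k <oo) (4 * B ^+ 2 * 6 ^+ N * (t^-1) ^+ k)%:E)%E.
have S_lty : (S < +oo)%E.
  apply: lte_add_pinfty; apply: geometric_nneseries_lty.
  - by rewrite !mulr_ge0// ltW.
  - by rewrite divr_ge0 ?(ltW t0)//= ltr_pdivrMr// mul1r.
  - by rewrite !mulr_ge0.
  - by rewrite invr_ge0 (ltW t0)/= invf_lt1.
have S0 : (0 <= S)%E.
  apply: adde_ge0; apply: nneseries_ge0 => k _ _; rewrite lee_fin !mulr_ge0 ?exprn_ge0// ?divr_ge0// ?invr_ge0//; exact: ltW.
exists (fine S); first exact: fine_ge0.
move=> x; rewrite fineK; last by rewrite ge0_fin_numE.
pose H y := (\sum_(k <oo) G1 x k y + \sum_(k <oo) G2 x k y)%E.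
have -> : S = (\int[leb N]_y H y)%E.
  rewrite ge0_integralD//; last 4 first.
  - by move=> y _; exact: nneseries_ge0.
  - exact: ge0_emeasurable_sum.
  - by move=> y _; exact: nneseries_ge0.
  - exact: ge0_emeasurable_sum.
  rewrite !integral_nneseries//; congr (_ + _)%E; apply: eq_eseriesr => k _.
    by rewrite IG1.
  by rewrite IG2.
have mint : measurable_fun setT (fun y => (phi x - phi y) ^+ 2 / gagliardo_kernel s (x, y)).
  have -> : (fun y => (phi x - phi y) ^+ 2 / gagliardo_kernel s (x, y)) =
      (fun y => (dquot s phi (x, y)) ^+ 2).
    by apply/funext => y; rewrite dquotE.
  apply: measurable_funX; apply: (measurableT_comp (measurable_dquot s mphi)).
  by apply: measurable_fun_pair; [exact: measurable_cst|exact: measurable_id].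
apply: ge0_le_integral => //.
- by move=> y _; rewrite lee_fin divr_ge0 ?sqr_ge0 ?kernel_ge0.
- exact/measurable_EFinP.
- by apply: emeasurable_funD; exact: ge0_emeasurable_sum.
move=> y _.
have SG10 : (0 <= \sum_(k <oo) G1 x k y)%E by exact: nneseries_ge0.
have SG20 : (0 <= \sum_(k <oo) G2 x k y)%E by exact: nneseries_ge0.
have [->|xy] := eqVneq x y.
  by rewrite kernel_diag// invr0 mulr0 adde_ge0.
have m0 : 0 < `|x - y| by rewrite normr_gt0 subr_eq0.
have [i hi] : exists i, `|x - y| = `|x ord0 i - y ord0 i|.
  have [|[i1 i] h] := @mx_norm_neq0 R 1 N (x - y); first by rewrite (gt_eqF m0).
  by exists i; rewrite [LHS]h/= !mxE (ord1 i1).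
have hj j : `|x ord0 j - y ord0 j| <= `|x - y|.
  by have := coord_le_norm (x - y) j; rewrite !mxE.
have in_cube (r : R) : `|x - y| <= r -> cube (x - r *: ones) (3 * r) y.
  move=> hr j; rewrite !mxE mulr1; have := le_trans (hj j) hr.
  by have := lt_le_trans m0 hr; rewrite ler_norml => r0 /andP[h1 h2]; apply/andP; split; lra.
have sqB : (phi x - phi y) ^+ 2 <= 4 * B ^+ 2.
  have := phiB x; have := phiB y; rewrite !ler_norml => /andP[h1 h2] /andP[h3 h4].
  rewrite -[leLHS]real_normK ?num_real// (_ : 4 * B ^+ 2 = (2 * B) ^+ 2); last by ring.
  by rewrite ler_sqr ?nnegrE ?mulr_ge0// ler_norml; apply/andP; split; lra.
have ker_gt := kernel_gt0 s xy.
have ker_ge k (r : R) : 0 <= r -> r ^+ k <= `|x - y| -> (r `^ p) ^+ k <= gagliardo_kernel s (x, y).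
  by move=> r0 rk; rewrite -powR_exprn//; apply: (kernel_ge (i := i)) => //; rewrite ?exprn_ge0// -hi.
have [m1|m1] := leP `|x - y| 1.
  have [k /andP[k1 k2]] := @dyadic_inner R `|x - y| ltac:(by rewrite m0).
  apply: le_trans (leeDl _ SG20).
  apply: le_trans (term_le_nneseries k (fun n => G10 x n y)).
  rewrite /G1 indicE mem_set; last exact: in_cube.
  rewrite mule1 lee_fin ler_pdivrMr// /c.
  have qk : (q^-1) ^+ k.+1 <= gagliardo_kernel s (x, y).
    have -> : q^-1 = 2^-1 `^ p by rewrite /q -powRN -[2^-1]powR_inv1// -powRrM mulN1r.
    by apply: ker_ge => //; exact: ltW.
  apply: (@le_trans _ _ (L ^+ 2 * (4^-1) ^+ k)).
    have := phiL x y; move=> h.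
    rewrite -[leLHS]real_normK ?num_real//.
    apply: (@le_trans _ _ ((L * (2^-1) ^+ k) ^+ 2)).
      rewrite ler_sqr ?nnegrE ?mulr_ge0 ?exprn_ge0//.
      by apply: le_trans h _; exact: ler_wpM2l.
    rewrite exprMn exprAC (_ : 2^-1 ^+ 2 = 4^-1 :> R)//.
    by rewrite exprVn; congr (_^-1); ring.
  rewrite -[leLHS]mulr1 -[leRHS]mulrA ler_wpM2l//; first by rewrite mulr_ge0// exprn_ge0.
  by rewrite mulrC -ler_pdivrMr ?exprn_gt0// mul1r -exprVn.
have [k /andP[k1 k2]] := dyadic_outer m1.
apply: le_trans (leeDr _ SG10).
apply: le_trans (term_le_nneseries k (fun n => G20 x n y)).
rewrite /G2 indicE mem_set; last exact: in_cube.
rewrite mule1 lee_fin ler_pdivrMr// /d.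
have qk : q ^+ k <= gagliardo_kernel s (x, y) by apply: ker_ge => //; exact: ltW.
apply: (le_trans sqB); rewrite -[leLHS]mulr1 -[leRHS]mulrA ler_wpM2l ?mulr_ge0//.
by rewrite exprVn mulrC ler_pdivlMr ?exprn_gt0// mul1r.
Qed.
End Lipschitz.

(** * Functions supported in a box *)

Section Fatou.
Context d {T : measurableType d} {R : realType} (mu : {measure set T -> \bar R}).

(** Fatou's lemma for the sequence shifted by [k0], so that the eventual bound holds for every
    term. *)
Lemma nrm2_fatou (h_ : nat -> T -> R) (h : T -> R) (e : \bar R) (k0 : nat) :
  (forall k, measurable_fun setT (h_ k)) -> measurable_fun setT h ->
  {ae mu, forall x, h_ k x @[k --> \oo] --> h x} ->
  (forall k, (k0 <= k)%N -> (nrm2 mu (h_ k) <= e)%E) -> (nrm2 mu h <= e)%E.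
Proof.
move=> mh_ mh cv bd.
pose f k x : \bar R := (h_ (k + k0)%N x ^+ 2)%:E.
have mf k : measurable_fun setT (f k) by exact: measurable_sqr.
have f0 k x : setT x -> (0 <= f k x)%E by move=> _; rewrite lee_fin sqr_ge0.
have -> : nrm2 mu h = (\int[mu]_x limn_einf (f^~ x))%E.
  apply: ae_eq_integral => //; first exact: measurable_sqr.
    apply: measurableT_comp => //; apply: measurable_fun_limn_esup => k.
    by apply: measurableT_comp => //; exact: mf.
  apply: filterS cv => x cvx _.
  have cvf : f k x @[k --> \oo] --> (h x ^+ 2)%:E.
    apply/fine_cvgP; split; first exact: nearW.
    have h1 : h_ (k + k0)%N x @[k --> \oo] --> h x by rewrite (cvg_shiftn k0 (fun k => h_ k x)).
    by rewrite expr2; exact: (cvgM h1 h1).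
  by rewrite is_cvg_limn_einfE; [rewrite (cvg_lim _ cvf)|apply/cvg_ex; eexists; exact: cvf].
apply: le_trans (fatou mu measurableT mf f0) _.
rewrite limn_einf_lim; apply: lime_le; first exact: is_cvg_einfs.
apply: nearW => n; apply: le_trans (bd (n + k0)%N (leq_addl _ _)).
by apply: ereal_inf_lbound; exists n => /=.
Qed.
End Fatou.

Section Box.
Context {R : realType} {N : nat}.
Implicit Types (f : 'rV[R]_N -> R).

Definition in_box (M : R) f := forall x, f x != 0 -> forall i, `|x ord0 i| <= M.

(** Elements of [Dspace] vanish outside the box only almost everywhere, whereas the estimates below
    use the vanishing pointwise. *)
Lemma box_restrict (M : R) f : measurable_fun setT f ->
  {ae leb N, forall x : 'rV[R]_N, (exists i, M < `|x ord0 i|) -> f x = 0} ->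
  exists g, [/\ measurable_fun setT g, in_box M g & {ae leb N, forall x, f x = g x}].
Proof.
move=> mf fM; pose W : set 'rV[R]_N := [set x | forall i, `|x ord0 i| <= M].
have mW : measurable W.
  apply: (measurable_box (A := fun=> [set t : R | `|t| <= M])) => i.
  have -> : [set t : R | `|t| <= M] = `[- M, M]%classic.
    by apply/seteqP; split => t /=; rewrite in_itv/= ler_norml.
  exact: measurable_itv.
exists (fun x => f x * \1_W x); split.
- by apply: measurable_funM => //; exact: measurable_indic.
- move=> x; rewrite indicE; have [xW|xW] := boolP (x \in W); last by rewrite mulr0 eqxx.
  by move=> _; move: xW; rewrite inE.
- apply: filterS fM => x fx; rewrite indicE.
  have [_|xW] := boolP (x \in W); first by rewrite mulr1.
  rewrite mulr0; apply: fx; apply: contrapT => nex.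
  move/negP : xW; apply; rewrite inE /W/= => i; rewrite leNgt; apply/negP => h.
  by apply: nex; exists i.
Qed.

Hypothesis N0 : (0 < N)%N.

Lemma poincare_box (s M : R) : 0 < s -> 0 < M -> exists2 C : R, 0 < C &
  forall f, measurable_fun setT f -> in_box M f ->
    (nrm2 (leb N) f <= C%:E * gagliardo2 s f)%E.
Proof.
move=> s0 M0.
have NR : 0 < N%:R :> R by rewrite ltr0n.
(* The coordinates of the box lie in [[-M, M]] and those of the far cube [A] in [[2M, 3M[], so they
   differ by at most [4 * M] and [D] bounds the kernel between the two. *)
pose D : R := (N%:R * (4 * M)) `^ (N%:R + 2 * s).
have D0 : 0 < D by apply: powR_gt0; rewrite !mulr_gt0.
exists (D / M ^+ N); first by rewrite divr_gt0// exprn_gt0.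
move=> f mf fM; pose A := cube (const_mx (2 * M) : 'rV[R]_N) M.
have mA : measurable A by exact: measurable_cube.
have msq : measurable_fun setT (fun x => D^-1 * f x ^+ 2).
  by apply: measurable_funM => //; exact: measurable_funX.
pose G (z : 'rV[R]_N * 'rV[R]_N) : R := D^-1 * f z.1 ^+ 2 * \1_A z.2.
have mG : measurable_fun setT G.
  apply: measurable_funM.
    exact: (measurableT_comp msq measurable_fst).
  exact: (measurableT_comp (measurable_indic mA) measurable_snd).
have G0 z : 0 <= G z by rewrite /G mulr_ge0 // mulr_ge0 ?sqr_ge0 ?invr_ge0 ?(ltW D0).
have IG : (\int[leb N \x leb N]_z (G z)%:E = (M ^+ N / D)%:E * nrm2 (leb N) f)%E.
  rewrite fubini_tonelli1//; last exact/measurable_EFinP.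
  rewrite /fubini_F /nrm2 -ge0_integralZl//; last 3 first.
  - exact: measurable_sqr.
  - by move=> x _; rewrite lee_fin sqr_ge0.
  - by rewrite lee_fin divr_ge0 ?exprn_ge0 ?(ltW D0) ?(ltW M0).
  apply: eq_integral => x _.
  rewrite (eq_integral (fun y => ((D^-1 * f x ^+ 2)%:E * (\1_A y)%:E)%E)); last by move=> y _; rewrite -EFinM.
  rewrite ge0_integralZl//; last 2 first.
  - by apply/measurable_EFinP; exact: measurable_indic.
  - by rewrite lee_fin mulr_ge0 ?sqr_ge0 ?invr_ge0 ?(ltW D0).
  rewrite integral_cube ?ltW// -!EFinM; congr EFin; ring.
have le : ((M ^+ N / D)%:E * nrm2 (leb N) f <= gagliardo2 s f)%E.
  rewrite -IG gagliardo2E; apply: ge0_le_integral => //.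
  - by move=> z _; rewrite lee_fin.
  - exact/measurable_EFinP.
  - by apply: measurable_sqr; exact: measurable_dquot.
  move=> [x y] _; rewrite lee_fin dquotE /G/= indicE.
  have ge0 : 0 <= (f x - f y) ^+ 2 / gagliardo_kernel s (x, y).
    by rewrite divr_ge0 ?sqr_ge0 ?kernel_ge0.
  have [yA|_] := boolP (y \in A); last by rewrite mulr0.
  have [fx|fx] := eqVneq (f x) 0; first by rewrite fx expr0n/= mulr0 mul0r -[X in _ <= (X - _) ^+ 2 / _]fx.
  move: yA; rewrite inE => yA; pose i0 := Ordinal N0.
  have fy : f y = 0.
    apply/eqP; apply: contrapT => /negP /fM /(_ i0); have := yA i0; rewrite mxE.
    by rewrite ler_norml => /andP[h1 h2] /andP[h3 h4]; lra.
  have xy i : `|x ord0 i - y ord0 i| <= 4 * M.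
    have := fM x fx i; have := yA i; rewrite mxE !ler_norml => /andP[h1 h2] /andP[h3 h4].
    by apply/andP; split; lra.
  have xney : x != y by apply: contra fx => /eqP ->; rewrite fy.
  rewrite fy subr0 mulr1 mulrC ler_wpM2l ?sqr_ge0// lef_pV2 ?posrE ?kernel_gt0//.
  exact: kernel_le.
have c0 : (0 <= (D / M ^+ N)%:E)%E by rewrite lee_fin ltW// divr_gt0// exprn_gt0.
have := lee_wpmul2l c0 le.
rewrite muleA -EFinM (_ : D / M ^+ N * (M ^+ N / D) = 1) ?mul1e//.
by field; rewrite (gt_eqF D0) expf_neq0 ?gt_eqF.
Qed.

Lemma indic_sq_int d (T : measurableType d) (mu : {measure set T -> \bar R}) (A : set T) :
  measurable A -> (mu A < +oo)%E -> sq_int mu \1_A.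
Proof.
move=> mA fA; split; first exact: measurable_indic.
rewrite /nrm2 (eq_integral (fun x => (\1_A x)%:E)); last first.
  by move=> x _; rewrite indicE; case: (_ \in _); rewrite ?expr1n ?expr0n.
by rewrite integral_indic// setIT.
Qed.

Lemma cube_sq_int (a : 'rV[R]_N) (r : R) : 0 <= r -> sq_int (leb N) \1_(cube a r).
Proof.
move=> r0; apply: indic_sq_int; first exact: measurable_cube.
by have := leb_cube a r0 => /= ->; rewrite ltry.
Qed.

Lemma cube_ip (a : 'rV[R]_N) (r : R) : 0 <= r ->
  ip (leb N) \1_(cube a r) \1_(cube a r) = r ^+ N.
Proof.
move=> r0; rewrite ip_nrm2 /nrm2 (eq_integral (fun x => (\1_(cube a r) x)%:E)).
  by rewrite integral_cube.
by move=> x _; rewrite indicE; case: (_ \in _); rewrite ?expr1n ?expr0n.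
Qed.

(* Cauchy-Schwarz against the indicator of the cube, i.e., Jensen for the mean of [f]. *)
Lemma cube_mean_estimate (s : R) f (a : 'rV[R]_N) (r : R) x :
  0 < s -> 0 < r -> sq_int (leb N) f -> cube a r x ->
  ((f x ^+ 2)%:E <= (2 / (r ^+ N) ^+ 2 * ip (leb N) f \1_(cube a r) ^+ 2)%:E +
    (2 / r ^+ N * (N%:R * r) `^ (N%:R + 2 * s))%:E *
      \int[leb N]_y (dquot s f (x, y) ^+ 2)%:E)%E.
Proof.
move=> s0 r0 sf Qx; set Q := cube a r in Qx *; set p := N%:R + 2 * s.
have sQ : sq_int (leb N) \1_Q by apply: cube_sq_int; exact: ltW.
have fi := ip_form (@leb R N); have ss := sq_int_subspace (@leb R N).
have rN : 0 < r ^+ N by rewrite exprn_gt0.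
pose h : 'rV[R]_N -> R := fun y => - (f y * \1_Q y).
have sh : sq_int (leb N) h.
  have mh : measurable_fun setT h.
    apply: measurable_funN; apply: measurable_funM; first by case: sf.
    exact: measurable_indic (measurable_cube _ _).
  split => //; apply: le_lt_trans sf.2; apply: le_nrm2 => //; first by case: sf.
  move=> y; rewrite normrN normrM ler_piMr//.
  by rewrite indicE; case: (_ \in _); rewrite ?normr1 ?normr0.
pose g := f x *: (\1_Q : 'rV[R]_N -> R) + h.
have gE y : g y = (f x - f y) * \1_Q y.
  by have -> : g y = f x * \1_Q y - f y * \1_Q y by []; rewrite mulrBl.
have sg : sq_int (leb N) g by exact: (subspaceL ss).
have ipgQ : ip (leb N) g \1_Q = f x * r ^+ N - ip (leb N) f \1_Q.
  rewrite (formL fi)// cube_ip ?(ltW r0)//; congr (_ + _).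
  have -> : h = (-1) *: (fun y => f y * \1_Q y).
    by apply/funext => y; exact: (esym (mulN1r _)).
  rewrite /ip -[RHS]mulN1r -RintegralZl//; last exact: sq_int_integrable.
  apply: eq_Rintegral => y _.
  have -> : (-1 *: (fun y => f y * \1_Q y)) y = -1 * (f y * \1_Q y) by [].
  by rewrite -mulrA; congr (_ * _); rewrite -mulrA indicE; case: (_ \in _); rewrite ?mulr1 ?mulr0.
have CS := form_CauchySchwarz ss fi sg sQ.
move: CS; rewrite ipgQ cube_ip ?(ltW r0)//; set l := ip _ f _ => CS.
have fx2 : f x ^+ 2 <= 2 / (r ^+ N) ^+ 2 * l ^+ 2 + 2 / r ^+ N * ip (leb N) g g.
  have h1 : (f x - l / r ^+ N) ^+ 2 <= ip (leb N) g g / r ^+ N.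
    rewrite ler_pdivlMr// -(ler_pM2r rN); apply: le_trans _ CS.
    rewrite le_eqVlt; apply/orP; left; apply/eqP; field; exact: lt0r_neq0.
  have := sqr_ge0 (f x - 2 * (l / r ^+ N)).
  have -> : 2 / (r ^+ N) ^+ 2 * l ^+ 2 = 2 * (l / r ^+ N) ^+ 2 by field; exact: lt0r_neq0.
  have -> : 2 / r ^+ N * ip (leb N) g g = 2 * (ip (leb N) g g / r ^+ N) by ring.
  by nra.
apply: (@le_trans _ _ (2 / (r ^+ N) ^+ 2 * l ^+ 2 + 2 / r ^+ N * ip (leb N) g g)%:E).
  by rewrite lee_fin.
rewrite EFinD; apply: leeD2l.
rewrite (EFinM _ (ip _ g g)) -nrm2_ip// (EFinM _ (_ `^ _)) -muleA.
apply: lee_wpmul2l; first by rewrite lee_fin divr_ge0// ltW.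
have mdx : measurable_fun setT (fun y => dquot s f (x, y)).
  apply: (measurableT_comp (measurable_dquot s sf.1)).
  by apply: measurable_fun_pair; [exact: measurable_cst|exact: measurable_id].
rewrite -ge0_integralZl//; last 3 first.
- exact: measurable_sqr.
- by move=> y _; rewrite lee_fin sqr_ge0.
- by rewrite lee_fin powR_ge0.
apply: ge0_le_integral => //.
- by move=> y _; rewrite lee_fin sqr_ge0.
- by apply: measurable_sqr; case: sg.
- by apply: measurable_funeM; exact: measurable_sqr.
move=> y _; rewrite -EFinM lee_fin gE dquotE/=.
have ge0 : 0 <= (f x - f y) ^+ 2 / gagliardo_kernel s (x, y).
  by rewrite divr_ge0 ?sqr_ge0 ?kernel_ge0.
rewrite indicE; have [Qy|_] := boolP (y \in Q); last by rewrite mulr0 expr0n/= mulr_ge0// powR_ge0.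
rewrite mulr1; have [->|xy] := eqVneq x y; first by rewrite subrr expr0n/= mul0r mulr0.
rewrite mulrCA ler_peMr ?sqr_ge0// ler_pdivlMr ?kernel_gt0// mul1r.
apply: kernel_le => // i; move: Qy; rewrite inE => Qy.
have /andP[h1 h2] := Qx i; have /andP[h3 h4] := Qy i.
by rewrite ler_norml; apply/andP; split; lra.
Qed.

(** Regular grid of step [r] with lower corner [-M]: the cube of [x] is found by truncating
    [(x_i + M) / r]. *)
Lemma cubes_cover (M r : R) : 0 < M -> 0 < r -> exists (m : nat) (a : 'I_m -> 'rV[R]_N),
  forall x : 'rV[R]_N, (forall i, `|x ord0 i| <= M) -> exists j, cube (a j) r x.
Proof.
move=> M0 r0; pose n := Num.bound (2 * M / r).
have hn : 2 * M / r < n%:R by apply: archi_boundP; rewrite divr_ge0 ?mulr_ge0 ?(ltW M0) ?(ltW r0).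
pose T := {ffun 'I_N -> 'I_n.+1}.
exists #|{: T}|, (fun j : 'I_#|{: T}| => \row_i (- M + r * ((enum_val j : T) i)%:R)) => x xM.
pose k i := Num.truncn ((x ord0 i + M) / r).
have xi i : 0 <= (x ord0 i + M) / r.
  by apply: divr_ge0; [have := xM i; rewrite ler_norml => /andP[]; lra|exact: ltW].
have kn i : (k i < n.+1)%N.
  rewrite ltnS ltnW// /k truncn_lt_nat//; apply: le_lt_trans hn.
  by rewrite ler_pM2r ?invr_gt0//; have := xM i; rewrite ler_norml => /andP[]; lra.
exists (enum_rank ([ffun i => Ordinal (kn i)] : T)) => i.
rewrite mxE enum_rankK ffunE/=.
have /andP[h1 h2] := truncn_itv (xi i).
move: h1 h2; rewrite -/(k i) ler_pdivlMr// ltr_pdivrMr// -natr1 => h1 h2.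
by apply/andP; split; nra.
Qed.

Lemma compactness_box (s M eps : R) : 0 < s -> 0 < M -> 0 < eps ->
  exists (m : nat) (h : 'I_m -> 'rV[R]_N -> R) (C : R),
    [/\ forall j, sq_int (leb N) (h j), 0 <= C &
    forall f, sq_int (leb N) f -> in_box M f ->
    (nrm2 (leb N) f <= eps%:E * gagliardo2 s f + (\sum_j C * ip (leb N) f (h j) ^+ 2)%:E)%E].
Proof.
move=> s0 M0 eps0; set p := N%:R + 2 * s.
have NR : 0 < N%:R :> R by rewrite ltr0n.
have Np : 0 < N%:R `^ p :> R by apply: powR_gt0.
(* The averaging error over cubes of side [r] has constant
   [2 / r^N * (N r)^(N + 2s) = 2 N^p r^(2s)]; this [r] makes it equal to [eps]. *)
pose r := (eps / (2 * N%:R `^ p)) `^ (2 * s)^-1.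
have e0 : 0 < eps / (2 * N%:R `^ p) by rewrite divr_gt0// mulr_gt0.
have r0 : 0 < r by apply: powR_gt0.
have rN : 0 < r ^+ N by rewrite exprn_gt0.
have small : 2 / r ^+ N * (N%:R * r) `^ p = eps.
  rewrite powRM ?(ltW NR) ?(ltW r0)// /p (powRD (x := r)); last first.
    by apply/implyP => _; rewrite gt_eqF.
  rewrite powR_mulrn ?(ltW r0)// -/p.
  have -> : r `^ (2 * s) = eps / (2 * N%:R `^ p).
    by rewrite /r -powRrM mulVf ?powRr1 ?(ltW e0)// mulf_neq0// gt_eqF.
  by field; rewrite !gt_eqF.
have [m [a cov]] := cubes_cover M0 r0.
exists m, (fun j => \1_(cube (a j) r)), (2 / r ^+ N); split.
- by move=> j; apply: cube_sq_int; exact: ltW.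
- by rewrite divr_ge0// ltW.
move=> f sf fM; have mf : measurable_fun setT f by case: sf.
pose l j := ip (leb N) f \1_(cube (a j) r).
pose t j : R := 2 / (r ^+ N) ^+ 2 * l j ^+ 2.
have t0 j : 0 <= t j by rewrite mulr_ge0 ?sqr_ge0// divr_ge0// sqr_ge0.
have mdq : measurable_fun setT (EFin \o (fun z => dquot s f z ^+ 2)).
  by apply: measurable_sqr; exact: measurable_dquot.
pose I x : \bar R := (\int[leb N]_y (dquot s f (x, y) ^+ 2)%:E)%E.
have I0 x : (0 <= I x)%E by apply: integral_ge0 => y _; rewrite lee_fin sqr_ge0.
have dq0 z : (0 <= (EFin \o (fun z => (dquot s f z ^+ 2)%R)) z)%E by rewrite lee_fin sqr_ge0.
have mI : measurable_fun setT I by exact: (measurable_fun_fubini_tonelli_F (m2 := leb N) _ mdq dq0).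
have gagE : gagliardo2 s f = (\int[leb N]_x I x)%E.
  by rewrite gagliardo2E /nrm2; exact: (fubini_tonelli1 (m1 := leb N) (m2 := leb N) _ mdq dq0).
have sumE : (\sum_j (2 / r ^+ N) * l j ^+ 2)%:E =
    (\int[leb N]_x \sum_(j < m) ((t j)%:E * (\1_(cube (a j) r) x)%:E))%E.
  rewrite ge0_integral_sum//; last 2 first.
  - move=> j; apply: measurable_funeM; apply/measurable_EFinP.
    exact: measurable_indic (measurable_cube _ _).
  - by move=> j x _; rewrite mule_ge0 ?lee_fin.
  rewrite -sumEFin; apply: eq_bigr => j _.
  rewrite ge0_integralZl//; last 2 first.
  - by apply/measurable_EFinP; exact: measurable_indic (measurable_cube _ _).
  - by rewrite lee_fin.
  rewrite integral_cube ?(ltW r0)// -EFinM /t; congr EFin; field; exact: lt0r_neq0.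
rewrite sumE gagE -ge0_integralZl//; last by rewrite lee_fin ltW.
have msum : measurable_fun setT (fun x => (\sum_(j < m) ((t j)%:E * (\1_(cube (a j) r) x)%:E))%E).
  apply: emeasurable_sum => j; apply: measurable_funeM; apply/measurable_EFinP.
  exact: measurable_indic (measurable_cube _ _).
have sum0 x : (0 <= \sum_(j < m) ((t j)%:E * (\1_(cube (a j) r) x)%:E))%E.
  by apply: sume_ge0 => j _; rewrite mule_ge0 ?lee_fin.
rewrite -ge0_integralD//; last 2 first.
- by move=> x _; rewrite mule_ge0// lee_fin ltW.
- exact: measurable_funeM.
apply: ge0_le_integral => //.
- by move=> x _; rewrite lee_fin sqr_ge0.
- exact: measurable_sqr.
- by apply: emeasurable_funD => //; exact: measurable_funeM.
move=> x _; have [fx|fx] := eqVneq (f x) 0.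
  by rewrite fx expr0n/= adde_ge0// mule_ge0// lee_fin ltW.
have [j Qx] := cov x (fM x fx).
apply: le_trans (cube_mean_estimate s0 r0 sf Qx) _.
rewrite addeC small; apply: leeD2l.
rewrite (bigD1 j)//= indicE mem_set// mule1.
by rewrite leeDl// sume_ge0// => i _; rewrite mule_ge0 ?lee_fin.
Qed.

End Box.

(** * The fractional spaces *)

Section Energy.
Context {R : realType} {N : nat}.
Implicit Types (f g u v w phi : 'rV[R]_N -> R) (s : R).

Lemma gagliardo2_ge0 s f : (0 <= gagliardo2 s f)%E.
Proof. by rewrite gagliardo2E nrm2_ge0. Qed.

Lemma gagliardo2D s f g : measurable_fun setT f -> measurable_fun setT g ->
  (gagliardo2 s (f + g)%R <= 2%:E * gagliardo2 s f + 2%:E * gagliardo2 s g)%E.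
Proof.
move=> mf mg; rewrite !gagliardo2E.
have -> : dquot s (f + g) = dquot s f + dquot s g.
  by rewrite -[f in LHS]scale1r dquotL scale1r.
by apply: nrm2D; exact: measurable_dquot.
Qed.

Lemma dquot0 s : dquot s (0 : 'rV[R]_N -> R) = 0.
Proof. by apply/funext => z; rewrite /dquot subrr mul0r. Qed.

Lemma dquotZ s c f : dquot s (c *: f) = c *: dquot s f.
Proof. by rewrite -[c *: f]addr0 dquotL dquot0 addr0. Qed.

Lemma gagliardo2Z s c f : measurable_fun setT f ->
  gagliardo2 s (c *: f) = ((c ^+ 2)%:E * gagliardo2 s f)%E.
Proof. by move=> mf; rewrite !gagliardo2E dquotZ nrm2Z//; exact: measurable_dquot. Qed.

Lemma gagliardo2_0 s : gagliardo2 s (0 : 'rV[R]_N -> R) = 0%E.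
Proof. by rewrite -(scale0r (0 : 'rV[R]_N -> R)) gagliardo2Z ?expr0n ?mul0e//; exact: measurable_cst. Qed.

Lemma gagliardo2N s f : measurable_fun setT f -> gagliardo2 s (- f) = gagliardo2 s f.
Proof. by move=> mf; rewrite -scaleN1r gagliardo2Z// sqrrN expr1n mul1e. Qed.

Lemma gagliardo2BC s f g : measurable_fun setT f -> measurable_fun setT g ->
  gagliardo2 s (f - g) = gagliardo2 s (g - f).
Proof. by move=> mf mg; rewrite -[f - g]opprB gagliardo2N//; exact: measurable_funB. Qed.

Lemma gagliardo2_le_via s (h f g : 'rV[R]_N -> R) : measurable_fun setT f -> measurable_fun setT g ->
  measurable_fun setT h ->
  (gagliardo2 s (f - g)%R <= 2%:E * gagliardo2 s (f - h)%R + 2%:E * gagliardo2 s (h - g)%R)%E.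
Proof.
move=> mf mg mh; have -> : f - g = (f - h) + (h - g) by rewrite addrA subrK.
by apply: gagliardo2D; exact: measurable_funB.
Qed.

Lemma measurable_slice s f x : measurable_fun setT f ->
  measurable_fun setT (fun y => dquot s f (x, y)).
Proof.
move=> mf; apply: (measurableT_comp (measurable_dquot s mf)).
by apply: measurable_fun_pair; [exact: measurable_cst|exact: measurable_id].
Qed.

Lemma dquot_antisym s f x y : dquot s f (x, y) = - dquot s f (y, x).
Proof.
rewrite /dquot (kernel_sym s y x) /=.
by rewrite -mulNr opprB.
Qed.

Definition energy_density s f x : \bar R := (\int[leb N]_y (dquot s f (x, y) ^+ 2)%:E)%E.

Lemma energy_density_ge0 s f x : (0 <= energy_density s f x)%E.
Proof. by apply: integral_ge0 => y _; rewrite lee_fin sqr_ge0. Qed.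

Lemma weighted_energy s f (g : 'rV[R]_N -> R) : measurable_fun setT f -> measurable_fun setT g ->
  (forall x, 0 <= g x) ->
  (\int[leb N \x leb N]_z (g z.1 * dquot s f z ^+ 2)%:E =
   \int[leb N]_x ((g x)%:E * energy_density s f x))%E.
Proof.
move=> mf mg g0.
have mG : measurable_fun [set: 'rV[R]_N * 'rV[R]_N] (EFin \o (fun z => g z.1 * dquot s f z ^+ 2)).
  apply/measurable_EFinP; apply: measurable_funM.
    exact: (measurableT_comp mg measurable_fst).
  by apply: measurable_funX; exact: measurable_dquot.
have G0 z : (0%:E <= (EFin \o (fun z => (g z.1 * dquot s f z ^+ 2)%R)) z)%E.
  by rewrite lee_fin mulr_ge0// sqr_ge0.
transitivity (\int[leb N]_x fubini_F (leb N) (EFin \o (fun z => (g z.1 * dquot s f z ^+ 2)%R)) x)%E.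
  exact: (fubini_tonelli1 (m1 := leb N) (m2 := leb N) _ mG G0).
apply: eq_integral => x _; rewrite /fubini_F /energy_density -ge0_integralZl//.
- by apply: measurable_sqr; exact: measurable_slice.
- by move=> y _; rewrite lee_fin sqr_ge0.
- by rewrite lee_fin.
Qed.

Lemma weighted_energy_sym s f (g : 'rV[R]_N -> R) : measurable_fun setT f -> measurable_fun setT g ->
  (forall x, 0 <= g x) ->
  (\int[leb N \x leb N]_z (g z.2 * dquot s f z ^+ 2)%:E =
   \int[leb N]_x ((g x)%:E * energy_density s f x))%E.
Proof.
move=> mf mg g0.
have mG : measurable_fun [set: 'rV[R]_N * 'rV[R]_N] (EFin \o (fun z => g z.2 * dquot s f z ^+ 2)).
  apply/measurable_EFinP; apply: measurable_funM.
    exact: (measurableT_comp mg measurable_snd).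
  by apply: measurable_funX; exact: measurable_dquot.
have G0 z : (0%:E <= (EFin \o (fun z => (g z.2 * dquot s f z ^+ 2)%R)) z)%E.
  by rewrite lee_fin mulr_ge0// sqr_ge0.
transitivity (\int[leb N]_x fubini_F (leb N) (EFin \o (fun z => (g z.2 * dquot s f z ^+ 2)%R)) x)%E.
  exact: (fubini_tonelli1 (m1 := leb N) (m2 := leb N) _ mG G0).
rewrite (fubini_tonelli (m1 := leb N) (m2 := leb N) _ mG G0).
apply: eq_integral => y _; rewrite /fubini_G /energy_density.
transitivity (\int[leb N]_x ((g y)%:E * (dquot s f (y, x) ^+ 2)%:E))%E.
  by apply: eq_integral => x _; rewrite -EFinM/= dquot_antisym sqrrN.
apply: ge0_integralZl; first by [].
- by apply: measurable_sqr; exact: measurable_slice.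
- by move=> x _; rewrite lee_fin sqr_ge0.
- by rewrite lee_fin.
Qed.

Lemma measurable_energy_density s f : measurable_fun setT f ->
  measurable_fun setT (energy_density s f).
Proof.
move=> mf.
have mdq : measurable_fun setT (EFin \o (fun z => dquot s f z ^+ 2)).
  by apply: measurable_sqr; exact: measurable_dquot.
apply: (measurable_fun_fubini_tonelli_F (m2 := leb N) _ mdq) => z.
by rewrite lee_fin sqr_ge0.
Qed.

(** Discrete Leibniz rule: the difference quotient of [phi * w] is [phi y] times that of [w] plus
    [w x] times that of [phi]. In the second term, integrating in [y] first leaves the uniformly
    bounded density of [phi] against [w ^+ 2]. *)
Lemma gagliardo2_leibniz s (B C : R) phi w : 0 <= B -> 0 <= C ->
  measurable_fun setT phi -> measurable_fun setT w ->
  (forall x, `|phi x| <= B) -> (forall x, (energy_density s phi x <= C%:E)%E) ->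
  (gagliardo2 s (phi * w)%R <= (2 * B ^+ 2)%:E * gagliardo2 s w + (2 * C)%:E * nrm2 (leb N) w)%E.
Proof.
move=> B0 C0 mphi mw phiB phiC.
have mdw : measurable_fun setT (EFin \o (fun z => dquot s w z ^+ 2)).
  by apply: measurable_sqr; exact: measurable_dquot.
have mw2 : measurable_fun setT (fun x => 2 * w x ^+ 2).
  by apply: measurable_funM => //; exact: measurable_funX.
have w20 x : 0 <= 2 * w x ^+ 2 by rewrite mulr_ge0// sqr_ge0.
have mG : measurable_fun [set: 'rV[R]_N * 'rV[R]_N] (EFin \o (fun z => (2 * w z.1 ^+ 2) * dquot s phi z ^+ 2)).
  apply/measurable_EFinP; apply: measurable_funM.
    exact: (measurableT_comp mw2 measurable_fst).
  by apply: measurable_funX; exact: measurable_dquot.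
have le2 : (\int[leb N \x leb N]_z ((2 * w z.1 ^+ 2) * dquot s phi z ^+ 2)%:E <= (2 * C)%:E * nrm2 (leb N) w)%E.
  rewrite (weighted_energy s mphi mw2 w20) /nrm2 -ge0_integralZl//; last 3 first.
  - exact: measurable_sqr.
  - by move=> x _; rewrite lee_fin sqr_ge0.
  - by rewrite lee_fin mulr_ge0.
  apply: ge0_le_integral => //.
  - by move=> x _; rewrite mule_ge0 ?lee_fin ?energy_density_ge0.
  - by apply: emeasurable_funM; [exact/measurable_EFinP|exact: measurable_energy_density].
  - by apply: measurable_funeM; exact: measurable_sqr.
  move=> x _; apply: (@le_trans _ _ ((2 * w x ^+ 2)%:E * C%:E)%E).
    by apply: lee_wpmul2l; [rewrite lee_fin|exact: phiC].
  by rewrite -!EFinM lee_fin le_eqVlt; apply/orP; left; apply/eqP; ring.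
rewrite gagliardo2E [gagliardo2 s w]gagliardo2E {1 2}/nrm2.
apply: (@le_trans _ _ (\int[leb N \x leb N]_z (((2 * B ^+ 2)%:E * (dquot s w z ^+ 2)%:E) +
   ((2 * w z.1 ^+ 2) * dquot s phi z ^+ 2)%:E))%E).
  apply: ge0_le_integral => //.
  - by move=> z _; rewrite lee_fin sqr_ge0.
  - by apply: measurable_sqr; apply: measurable_dquot; exact: measurable_funM.
  - by apply: emeasurable_funD => //; exact: measurable_funeM.
  move=> [x y] _; rewrite -EFinM -EFinD lee_fin /=.
  have -> : dquot s (phi * w) (x, y) = phi y * dquot s w (x, y) + w x * dquot s phi (x, y).
    rewrite /dquot !mulrA -mulrDl; congr (_ * _).
    have -> : (phi * w) (x, y).1 = phi x * w x by [].
    by have -> : (phi * w) (x, y).2 = phi y * w y by []; rewrite /=; ring.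
  have := sqr_ge0 (phi y * dquot s w (x, y) - w x * dquot s phi (x, y)).
  have : (phi y * dquot s w (x, y)) ^+ 2 <= B ^+ 2 * dquot s w (x, y) ^+ 2.
    rewrite exprMn ler_wpM2r ?sqr_ge0// -[leLHS]real_normK ?num_real//.
    by rewrite ler_sqr ?nnegrE.
  by move=> h1 h2; nra.
rewrite ge0_integralD//; last 3 first.
- by move=> z _; rewrite mule_ge0 ?lee_fin ?sqr_ge0// mulr_ge0// sqr_ge0.
- exact: measurable_funeM.
- by move=> z _; rewrite lee_fin mulr_ge0 ?sqr_ge0.
apply: leeD => //.
rewrite ge0_integralZl//; last by rewrite lee_fin mulr_ge0// sqr_ge0.
by move=> z _; rewrite lee_fin sqr_ge0.
Qed.

End Energy.

Lemma ge0_cvge0P (R : realType) (u : nat -> \bar R) : (forall n, (0 <= u n)%E) ->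
  (u @ \oo --> 0%E) <->
  (forall e : R, 0 < e -> exists n0, forall n, (n0 <= n)%N -> (u n <= e%:E)%E).
Proof.
move=> u0; split.
  move=> /fine_cvgP[finu cu] e e0.
  have lt_e : \forall n \near \oo, (fine \o u) n < e by exact: cvgr_lt cu _ e0.
  have [n0 _ h] := filterI finu lt_e.
  by exists n0 => n /h[fn /ltW]; rewrite -lee_fin /= fineK.
move=> h; apply/fine_cvgP; split.
  have [n0 hn0] := h 1 ltr01; exists n0 => // n /hn0 /= h1.
  by rewrite ge0_fin_numE//; apply: le_lt_trans h1 _; rewrite ltry.
apply/cvgrPdist_le => e e0; have [n0 hn0] := h e e0; exists n0 => // n /hn0 /= h1.
rewrite sub0r normrN ger0_norm ?fine_ge0// -lee_fin fineK//.
by rewrite ge0_fin_numE//; apply: le_lt_trans h1 _; rewrite ltry.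
Qed.

(** * Energy of test functions *)

Section TestFunctions.
Context {R : realType} {N : nat}.
Implicit Types (Omega : set 'rV[R]_N) (phi : 'rV[R]_N -> R) (s : R).

Lemma test_function_measurable Omega phi : test_function Omega phi -> measurable_fun setT phi.
Proof. by case=> sphi _ _; apply: continuous_measurable_rV; exact: (sphi 0%N).1. Qed.

Lemma test_function_density Omega phi s : 0 < s -> s < 1 -> test_function Omega phi ->
  exists2 C : R, 0 <= C & forall x, (energy_density s phi x <= C%:E)%E.
Proof.
move=> s0 s1 tphi; have mphi := test_function_measurable tphi.
have [B B0 phiB] := test_function_bounded tphi.
have [L L0 phiL] := test_function_lipschitz tphi.
have L1 : 0 <= L * N%:R by rewrite mulr_ge0// ltW.
have phiL1 x y : `|phi x - phi y| <= L * N%:R * `|x - y|.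
  apply: le_trans (phiL x y) _; rewrite -mulrA ler_wpM2l ?(ltW L0)//.
  apply: (@le_trans _ _ (\sum_(i < N) `|x - y|)).
    by apply: ler_sum => i _; have := coord_le_norm (x - y) i; rewrite !mxE.
  by rewrite sumr_const card_ord mulr_natl.
have [C C0 hC] := lipschitz_energy_density s0 s1 (ltW B0) L1 mphi phiB phiL1.
exists C => // x; apply: le_trans (hC x); rewrite le_eqVlt; apply/orP; left; apply/eqP.
by apply: eq_integral => y _; congr EFin; exact: dquotE.
Qed.

(** A nonzero difference quotient has one of its two points in the cube. By symmetry the energy is
    at most twice the integral of the density over the cube. *)
Lemma finite_energy s (a : 'rV[R]_N) (r : R) phi (C : R) : 0 <= r -> 0 <= C ->
  measurable_fun setT phi -> (forall x, phi x != 0 -> cube a r x) ->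
  (forall x, (energy_density s phi x <= C%:E)%E) -> (gagliardo2 s phi < +oo)%E.
Proof.
move=> r0 C0 mphi phiQ hC; pose g : 'rV[R]_N -> R := \1_(cube a r).
have mg : measurable_fun setT g by exact: measurable_indic (measurable_cube _ _).
have g0 x : 0 <= g x by rewrite /g indicE ler0n.
have mdq : measurable_fun setT (fun z => dquot s phi z ^+ 2).
  by apply: measurable_funX; exact: measurable_dquot.
have m1 : measurable_fun [set: 'rV[R]_N * 'rV[R]_N] (EFin \o (fun z => g z.1 * dquot s phi z ^+ 2)).
  apply/measurable_EFinP; apply: measurable_funM => //.
  exact: (measurableT_comp mg measurable_fst).
have m2 : measurable_fun [set: 'rV[R]_N * 'rV[R]_N] (EFin \o (fun z => g z.2 * dquot s phi z ^+ 2)).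
  apply/measurable_EFinP; apply: measurable_funM => //.
  exact: (measurableT_comp mg measurable_snd).
have half : (\int[leb N]_x ((g x)%:E * energy_density s phi x) <= (C * r ^+ N)%:E)%E.
  rewrite EFinM -(integral_cube a r0) -ge0_integralZl//; last exact/measurable_EFinP.
  apply: ge0_le_integral => //.
  - by move=> x _; rewrite mule_ge0 ?lee_fin ?energy_density_ge0.
  - by apply: emeasurable_funM; [exact/measurable_EFinP|exact: measurable_energy_density].
  - by apply: measurable_funeM; exact/measurable_EFinP.
  by move=> x _; rewrite muleC; apply: lee_wpmul2r; rewrite ?lee_fin// g0.
rewrite gagliardo2E.
apply: (@le_lt_trans _ _ (\int[leb N \x leb N]_z ((g z.1 * dquot s phi z ^+ 2)%:E + (g z.2 * dquot s phi z ^+ 2)%:E))%E).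
  apply: ge0_le_integral => //.
  - by move=> z _; rewrite lee_fin sqr_ge0.
  - exact/measurable_EFinP.
  - exact: emeasurable_funD.
  move=> [x y] _; rewrite -EFinD lee_fin -mulrDl.
  have [Qx|Qx] := boolP (x \in cube a r).
    by rewrite ler_peMl ?sqr_ge0// {1}/g indicE Qx lerDl.
  have [Qy|Qy] := boolP (y \in cube a r).
    by rewrite ler_peMl ?sqr_ge0// {2}/g indicE Qy lerDr.
  have out (t : 'rV[R]_N) : t \notin cube a r -> phi t = 0.
    by move=> h; apply/eqP; apply: contraNT h => /phiQ; rewrite inE.
  have -> : dquot s phi (x, y) = 0 by rewrite /dquot (out x Qx) (out y Qy) subrr mul0r.
  by rewrite expr0n/= mulr0.
rewrite ge0_integralD//; last 2 first.
- by move=> z _; rewrite lee_fin mulr_ge0 ?sqr_ge0.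
- by move=> z _; rewrite lee_fin mulr_ge0 ?sqr_ge0.
rewrite (weighted_energy s mphi mg g0) (weighted_energy_sym s mphi mg g0).
by apply: lte_add_pinfty; exact: (le_lt_trans half (ltry _)).
Qed.

End TestFunctions.

(** * The spaces [Dspace] over sets contained in a box *)

Section Dspace.
Context {R : realType} {N : nat} (N0 : (0 < N)%N) (M : R) (M0 : 0 < M) (s : R) (s0 : 0 < s) (s1 : s < 1).
Implicit Types (u v w phi : 'rV[R]_N -> R).

Section OneOmega.
Context (Omega : set 'rV[R]_N) (OM : forall x, Omega x -> forall i, `|x ord0 i| <= M).

Lemma test_function_in_box phi : test_function Omega phi -> in_box M phi.
Proof. by move=> [_ _ h] x /supp_neq0 /h; exact: OM. Qed.

(** Lower corner and side of a half-open cube containing the closed box, hence the margin 1 in the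
    side. *)
Let a : 'rV[R]_N := const_mx (- M).
Let r : R := 2 * M + 1.

Let r0 : 0 <= r. Proof. by rewrite addr_ge0// mulr_ge0// ltW. Qed.

Let in_box_cube phi : in_box M phi -> forall x, phi x != 0 -> cube a r x.
Proof.
move=> h x /h xM i; have := xM i; rewrite mxE ler_norml => /andP[h1 h2].
by apply/andP; split; rewrite /r; lra.
Qed.

Lemma test_function_energy phi : test_function Omega phi -> (gagliardo2 s phi < +oo)%E.
Proof.
move=> tphi; have [C C0 hC] := test_function_density s0 s1 tphi.
apply: (finite_energy r0 C0 _ _ hC); first exact: test_function_measurable tphi.
exact/in_box_cube/test_function_in_box.
Qed.

Lemma test_function_Dspace phi : test_function Omega phi -> Dspace s Omega phi.
Proof.
move=> tphi; split; first exact: test_function_measurable tphi.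
exists (fun=> phi); split => //.
  rewrite (_ : (fun n => _) = (fun=> 0%E)); first exact: cvg_cst.
  apply/funext => n; rewrite -[RHS](@gagliardo2_0 R N s); congr gagliardo2.
  by apply/funext => x; exact: subrr.
by apply: aeW => x; exact: cvg_cst.
Qed.

Lemma Dspace_measurable u : Dspace s Omega u -> measurable_fun setT u.
Proof. by case. Qed.

Lemma Dspace_approx u : Dspace s Omega u -> forall e, 0 < e ->
  exists2 phi, test_function Omega phi & (gagliardo2 s (phi - u)%R <= e%:E)%E.
Proof.
move=> [mu [phi [tphi cphi _]]] e e0.
have [n0 h] := (ge0_cvge0P (fun n => gagliardo2_ge0 s _)).1 cphi e e0.
by exists (phi n0) => //; exact: (h n0 (leqnn _)).
Qed.

Lemma Dspace_energy u : Dspace s Omega u -> (gagliardo2 s u < +oo)%E.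
Proof.
move=> Du; have mu := Dspace_measurable Du.
have [phi tphi hphi] := Dspace_approx Du ltr01.
have mphi := test_function_measurable tphi.
have -> : u = phi + (u - phi) by rewrite addrC subrK.
apply: le_lt_trans (gagliardo2D s mphi _) _; first exact: measurable_funB.
apply: lte_add_pinfty; apply: lte_mul_pinfty => //; first exact: test_function_energy tphi.
by rewrite gagliardo2BC//; apply: le_lt_trans hphi _; rewrite ltry.
Qed.

Lemma Dspace_box u : Dspace s Omega u ->
  {ae leb N, forall x : 'rV[R]_N, (exists i, M < `|x ord0 i|) -> u x = 0}.
Proof.
move=> [_ [phi [tphi _ cphi]]]; apply: filterS cphi => x cx [i Mx].
have -> : u x = limn (fun n => phi n x) by rewrite (cvg_lim _ cx).
have -> : (fun n => phi n x) = fun=> 0.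
  apply/funext => n; apply/eqP; apply: contrapT => /negP /(test_function_in_box (tphi n)) /(_ i).
  by rewrite leNgt Mx.
by rewrite lim_cst.
Qed.

Lemma Dspace_poincare : exists2 C : R, 0 < C &
  forall u, Dspace s Omega u -> (nrm2 (leb N) u <= C%:E * gagliardo2 s u)%E.
Proof.
have [C C0 hC] := poincare_box N0 s0 M0; exists C => // u Du.
have mu := Dspace_measurable Du.
have [g [mg gM ug]] := box_restrict mu (Dspace_box Du).
by rewrite (nrm2_ae mu mg ug) (gagliardo2_ae s mu mg ug); exact: hC.
Qed.

Lemma Dspace_sq_int u : Dspace s Omega u -> sq_int (leb N) u.
Proof.
move=> Du; split; first exact: Dspace_measurable Du.
have [C C0 hC] := Dspace_poincare; apply: le_lt_trans (hC u Du) _.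
by apply: lte_mul_pinfty; rewrite ?lee_fin ?(ltW C0)//; exact: Dspace_energy.
Qed.

Lemma Dspace_dquot u : Dspace s Omega u -> sq_int (leb N \x leb N)%E (dquot s u).
Proof.
move=> Du; split; first exact: (measurable_dquot s (Dspace_measurable Du)).
by rewrite -gagliardo2E; exact: Dspace_energy.
Qed.

(** Concrete source of the stability under null vectors that the abstract comparison requires. *)
Lemma Dspace_ae u w : measurable_fun setT u -> Dspace s Omega w ->
  {ae leb N, forall x, u x = w x} -> Dspace s Omega u.
Proof.
move=> mu [mw [phi [tphi cphi aphi]]] uw; split => //.
exists phi; split => //.
  rewrite (_ : (fun n => _) = (fun n => gagliardo2 s (phi n \- w))) //.
  apply/funext => n; have mphi := test_function_measurable (tphi n).
  apply: gagliardo2_ae; [exact: measurable_funB|exact: measurable_funB|].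
  by apply: filterS uw => x /= ->.
by apply: filterS2 uw aphi => x ->.
Qed.

Lemma Dspace_subspace : subspace (Dspace s Omega).
Proof.
split; first exact/test_function_Dspace/test_function0.
move=> c u v Du Dv; have [mu [phi [tphi cphi aphi]]] := Du; have [mv [psi [tpsi cpsi apsi]]] := Dv.
split; first exact: measurable_linear.
exists (fun n => c *: phi n + psi n); split.
- by move=> n; exact: test_functionL.
- have mphi n := test_function_measurable (tphi n); have mpsi n := test_function_measurable (tpsi n).
  have up n : (gagliardo2 s ((c *: phi n + psi n) \- (c *: u + v))%R <=
      2%:E * ((c ^+ 2)%:E * gagliardo2 s (phi n \- u)%R) + 2%:E * gagliardo2 s (psi n \- v)%R)%E.
    have -> : (c *: phi n + psi n) \- (c *: u + v) = c *: (phi n - u) + (psi n - v).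
      by rewrite scalerBr addrACA -opprD.
    apply: le_trans (gagliardo2D s _ _) _.
    - by apply: measurable_funM => //; exact: measurable_funB.
    - exact: measurable_funB.
    by rewrite gagliardo2Z//; exact: measurable_funB.
  apply/ge0_cvge0P => [n|e e0]; first exact: gagliardo2_ge0.
  have d0 : 0 < e / (2 * (c ^+ 2 + 1)).
    by rewrite divr_gt0// mulr_gt0// ltr_wpDl// sqr_ge0.
  have [n1 h1] := (ge0_cvge0P (fun n => gagliardo2_ge0 s _)).1 cphi _ d0.
  have [n2 h2] := (ge0_cvge0P (fun n => gagliardo2_ge0 s _)).1 cpsi _ d0.
  exists (maxn n1 n2) => n; rewrite geq_max => /andP[/h1 {}h1 /h2 {}h2].
  apply: le_trans (up n) _.
  apply: (@le_trans _ _ (2%:E * ((c ^+ 2)%:E * (e / (2 * (c ^+ 2 + 1)))%:E) + 2%:E * (e / (2 * (c ^+ 2 + 1)))%:E)%E).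
    apply: leeD; apply: lee_wpmul2l => //.
    by apply: lee_wpmul2l => //; rewrite lee_fin sqr_ge0.
  rewrite -!EFinM -EFinD lee_fin le_eqVlt; apply/orP; left; apply/eqP; field.
  by rewrite gt_eqF// ltr_wpDl// sqr_ge0.
- apply: filterS2 aphi apsi => x cx dx.
  exact: (cvgD (cvgM (cvg_cst c) cx) dx).
Qed.

End OneOmega.
End Dspace.

Lemma lee_2D2D (R : realType) (x y : \bar R) (d e : R) : (x <= d%:E)%E -> (y <= e%:E)%E ->
  (2%:E * x + 2%:E * y <= (2 * d + 2 * e)%:E)%E.
Proof. by move=> xd ye; rewrite (EFinD (2 * d)) (EFinM 2 d) (EFinM 2 e); apply: leeD; apply: lee_wpmul2l. Qed.

Section DspaceComplete.
Context {R : realType} {N : nat} (N0 : (0 < N)%N) (M : R) (M0 : 0 < M) (s : R) (s0 : 0 < s) (s1 : s < 1).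
Context (Omega : set 'rV[R]_N) (OM : forall x, Omega x -> forall i, `|x ord0 i| <= M).
Implicit Types (u v w phi : 'rV[R]_N -> R).

(** The [u_ n] are replaced by nearby test functions. These are Cauchy in energy, hence in L^2 by
    the Poincare inequality, so a subsequence converges almost everywhere, as membership in [Dspace]
    demands. Fatou's lemma then shows that the energy converges to the same limit. *)
Lemma Dspace_complete (u_ : nat -> 'rV[R]_N -> R) : (forall n, Dspace s Omega (u_ n)) ->
  (forall e, 0 < e -> exists n0, forall i j, (n0 <= i)%N -> (n0 <= j)%N ->
    (gagliardo2 s (u_ i - u_ j)%R <= e%:E)%E) ->
  exists2 u, Dspace s Omega u &
  (forall e, 0 < e -> exists n0, forall n, (n0 <= n)%N -> (gagliardo2 s (u_ n - u)%R <= e%:E)%E).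
Proof.
move=> Du cu; have mu n := Dspace_measurable (Du n).
have approx (n : nat) : exists phi, test_function Omega phi /\
    (gagliardo2 s (phi - u_ n)%R <= (n.+1%:R^-1)%:E)%E.
  have [|phi tphi h] := Dspace_approx (Du n) (e := n.+1%:R^-1); first by rewrite invr_gt0.
  by exists phi.
have [phi hphi] := choice approx.
have tphi n : test_function Omega (phi n) := (hphi n).1.
have mphi n := test_function_measurable (tphi n).
have phi_u e : 0 < e -> exists n0, forall n, (n0 <= n)%N -> (gagliardo2 s (phi n - u_ n)%R <= e%:E)%E.
  move=> e0; have [n0 h] := inv_nat_small e0; exists n0 => n /h /ltW hn.
  by apply: le_trans (hphi n).2 _; rewrite lee_fin.
have cphi e : 0 < e -> exists n0, forall i j, (n0 <= i)%N -> (n0 <= j)%N ->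
    (gagliardo2 s (phi i - phi j)%R <= e%:E)%E.
  (* Two nested uses of the factor-2 triangle inequality cost
     [2 * d + 2 * (2 * d + 2 * d) = 10 * d]. *)
  move=> e0; have d0 : 0 < e / 10 by rewrite divr_gt0.
  have [n1 h1] := phi_u _ d0; have [n2 h2] := cu _ d0.
  exists (maxn n1 n2) => i j; rewrite !geq_max => /andP[i1 i2] /andP[j1 j2].
  apply: le_trans (gagliardo2_le_via s (mphi i) (mphi j) (mu i)) _.
  have hij : (gagliardo2 s (u_ i - phi j)%R <= (2 * (e / 10) + 2 * (e / 10))%:E)%E.
    apply: le_trans (gagliardo2_le_via s (mu i) (mphi j) (mu j)) _.
    by apply: lee_2D2D; [exact: h2|rewrite gagliardo2BC//; exact: h1].
  apply: le_trans (lee_2D2D (h1 i i1) hij) _; rewrite lee_fin; lra.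
have [C C0 poinc] := Dspace_poincare N0 M0 s0 OM.
have cL2 e : 0 < e -> exists n0, forall i j, (n0 <= i)%N -> (n0 <= j)%N ->
    (nrm2 (leb N) (phi i - phi j)%R <= e%:E)%E.
  move=> e0; have [n0 h] := cphi (e / C) (divr_gt0 e0 C0).
  exists n0 => i j ni nj; apply: le_trans (poinc _ _) _.
    apply: (subspaceB (Dspace_subspace s Omega)); exact: test_function_Dspace.
  rewrite (_ : e = C * (e / C)) ?EFinM; last by rewrite mulrCA mulfV ?mulr1// gt_eqF.
  by apply: lee_wpmul2l; [rewrite lee_fin ltW|exact: h].
have [g [f [gk mf cgf]]] := ae_cvg_subsequence mphi cL2.
have phi_f e : 0 < e -> exists n0, forall k, (n0 <= k)%N -> (gagliardo2 s (phi (g k) - f)%R <= e%:E)%E.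
  move=> e0; have [n0 h] := cphi e e0; exists n0 => k nk.
  rewrite gagliardo2E.
  apply: (@nrm2_fatou _ _ _ _ (fun j => dquot s (phi (g k) - phi (g j))) _ _ n0).
  - by move=> j; apply: measurable_dquot; exact: measurable_funB.
  - by apply: measurable_dquot; exact: measurable_funB.
  - apply: filterS (ae_leb2 cgf) => z [c1 c2].
    exact: (cvgM (cvgB (cvgB (cvg_cst _) c1) (cvgB (cvg_cst _) c2)) (cvg_cst _)).
  - move=> j nj; rewrite -gagliardo2E; apply: h; first exact: leq_trans nk (gk k).
    exact: leq_trans nj (gk j).
exists f.
  split => //; exists (phi \o g); split => //; first by move=> n; exact: tphi.
  by apply/ge0_cvge0P => [n|e e0]; [exact: gagliardo2_ge0|exact: phi_f].
move=> e e0; have d0 : 0 < e / 10 by rewrite divr_gt0.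
have [n1 h1] := phi_u _ d0; have [n2 h2] := cphi _ d0; have [n3 h3] := phi_f _ d0.
exists (maxn n1 (maxn n2 n3)) => n; rewrite !geq_max => /and3P[l1 l2 l3].
apply: le_trans (gagliardo2_le_via s (mu n) mf (mphi n)) _.
have hf : (gagliardo2 s (phi n - f)%R <= (2 * (e / 10) + 2 * (e / 10))%:E)%E.
  apply: le_trans (gagliardo2_le_via s (mphi n) mf (mphi (g n))) _.
  apply: lee_2D2D; last exact: h3.
  by apply: h2 => //; exact: leq_trans l2 (gk n).
have hu : (gagliardo2 s (u_ n - phi n)%R <= (e / 10)%:E)%E by rewrite gagliardo2BC//; exact: h1.
apply: le_trans (lee_2D2D hu hf) _; rewrite lee_fin; lra.
Qed.

(** The supports of the approximants are inherited from those of [w], so [phi] may be a test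
    function of another set: here lies the stability of the smaller space under test functions of
    [Omega]. *)
Lemma Dspace_mul (Omega' : set 'rV[R]_N) phi w : test_function Omega' phi ->
  Dspace s Omega w -> Dspace s Omega (phi * w).
Proof.
move=> tphi Dw; have mphi := test_function_measurable tphi.
have [B B0 phiB] := test_function_bounded tphi.
have [C C0 phiC] := test_function_density s0 s1 tphi.
have [P P0 poinc] := Dspace_poincare N0 M0 s0 OM.
have [mw [psi [tpsi cpsi apsi]]] := Dw.
split; first exact: measurable_funM.
exists (fun n => phi * psi n); split.
- by move=> n; apply: test_functionM => //; case: tphi.
- apply/ge0_cvge0P => [n|e e0]; first exact: gagliardo2_ge0.
  (* The two Leibniz constants, the second one multiplied by the Poincare constant [P] that trades
     the L^2 norm for energy. *)
  pose K := 2 * B ^+ 2 + 2 * C * P.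
  have K0 : 0 < K by rewrite ltr_pwDl ?mulr_gt0 ?exprn_gt0// !mulr_ge0// ltW.
  have [n0 h] := (ge0_cvge0P (fun n => gagliardo2_ge0 s _)).1 cpsi _ (divr_gt0 e0 K0).
  exists n0 => n /h hn.
  have mpsi := test_function_measurable (tpsi n).
  have Dd : Dspace s Omega (psi n - w).
    by apply: (subspaceB (Dspace_subspace s Omega)) => //; exact: test_function_Dspace.
  have -> : (phi * psi n) \- (phi * w) = phi * (psi n - w) by rewrite mulrBr.
  apply: le_trans (gagliardo2_leibniz (ltW B0) C0 mphi (Dspace_measurable Dd) phiB phiC) _.
  apply: (@le_trans _ _ ((2 * B ^+ 2)%:E * (e / K)%:E + (2 * C)%:E * (P%:E * (e / K)%:E))%E).
    apply: leeD; apply: lee_wpmul2l.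
    - by rewrite lee_fin mulr_ge0// sqr_ge0.
    - exact: hn.
    - by rewrite lee_fin mulr_ge0.
    - apply: le_trans (poinc _ Dd) _; apply: lee_wpmul2l; first by rewrite lee_fin ltW.
      exact: hn.
  rewrite -!EFinM -EFinD lee_fin le_eqVlt; apply/orP; left; apply/eqP.
  have -> : 2 * B ^+ 2 * (e / K) + 2 * C * (P * (e / K)) = K * (e / K) by rewrite /K; ring.
  by rewrite mulrCA mulfV ?mulr1// gt_eqF.
- by apply: filterS apsi => x cx; exact: (cvgM (cvg_cst _) cx).
Qed.

(** * The abstract hypotheses for the energy and L^2 forms *)

Section Forms.
Hypothesis C0 : 0 < fracC N s.
Let c := fracC N s / 2.
Let c0 : 0 < c. Proof. by rewrite divr_gt0. Qed.

Definition L2form u v : R := \int[leb N]_x (u x * v x).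

Lemma DdotE u v : Ddot s u v = c * ip (leb N \x leb N)%E (dquot s u) (dquot s v).
Proof.
rewrite /Ddot; congr (_ * _); apply: eq_Rintegral => z _.
by rewrite dquotM.
Qed.

Lemma Ddot_energy u : Dspace s Omega u -> (c%:E * gagliardo2 s u)%E = (Ddot s u u)%:E.
Proof.
by move=> Du; rewrite DdotE (EFinM c) -nrm2_ip -?gagliardo2E//; exact: (Dspace_dquot M0 s0 s1 OM).
Qed.

Lemma gagliardo2_Ddot u : Dspace s Omega u -> gagliardo2 s u = (c^-1 * Ddot s u u)%:E.
Proof.
by move=> Du; rewrite (EFinM c^-1) -Ddot_energy// muleA -(EFinM c^-1) mulVf ?mul1e// gt_eqF.
Qed.

Lemma Ddot_form : psd_form (Dspace s Omega) (Ddot s).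
Proof.
have [h1 h2 h3] := ip_form (@leb R N \x @leb R N)%E.
have dq u : Dspace s Omega u -> sq_int (leb N \x leb N)%E (dquot s u) by exact: (Dspace_dquot M0 s0 s1 OM).
split.
- by move=> u v Du Dv; rewrite !DdotE h1//; exact: dq.
- move=> k u v w Du Dv Dw; rewrite !DdotE dquotL.
  have -> := h2 k _ _ _ (dq _ Du) (dq _ Dv) (dq _ Dw).
  by rewrite mulrDr mulrCA.
- by move=> u Du; rewrite DdotE mulr_ge0 ?(ltW c0)// h3//; exact: dq.
Qed.

Lemma L2_form : psd_form (Dspace s Omega) L2form.
Proof.
apply: (sub_subspace_form _ (ip_form (@leb R N))) => u.
exact: (Dspace_sq_int N0 M0 s0 s1 OM).
Qed.

Lemma L2form_null u : Dspace s Omega u -> L2form u u = 0 <-> {ae leb N, forall x, u x = 0}.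
Proof.
move=> Du; rewrite -nrm2_eq0; last exact: Dspace_measurable Du.
rewrite nrm2_ip; last exact: (Dspace_sq_int N0 M0 s0 s1 OM Du).
by split => [h|[]//]; congr EFin; exact: h.
Qed.

Lemma L2form_Ddot_null u : Dspace s Omega u -> L2form u u = 0 -> Ddot s u u = 0.
Proof.
move=> Du /(L2form_null Du) u0.
have := gagliardo2_Ddot Du.
rewrite (gagliardo2_ae s (g := fun=> 0) (Dspace_measurable Du) _ u0)//.
have -> : gagliardo2 s (cst 0 : 'rV[R]_N -> R) = 0%E := gagliardo2_0 s.
by move=> [] /esym /eqP; rewrite mulf_eq0 invr_eq0 (gt_eqF c0) => /eqP.
Qed.

Lemma Dspace_form_complete (u_ : nat -> 'rV[R]_N -> R) : (forall n, Dspace s Omega (u_ n)) ->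
  form_cauchy (Ddot s) u_ -> exists2 u, Dspace s Omega u & form_cvg (Ddot s) u_ u.
Proof.
move=> Du cu; have ss := Dspace_subspace s Omega.
have [e e0|u Duu hu] := Dspace_complete Du.
  have [n0 h] := cu (c * e) (mulr_gt0 c0 e0); exists n0 => i j ni nj.
  rewrite gagliardo2_Ddot; last exact: (subspaceB ss).
  by rewrite lee_fin -(ler_pM2l c0) mulrA mulfV ?mul1r ?gt_eqF//; exact: h.
exists u => // e e0; have [n0 h] := hu (c^-1 * e) ltac:(by rewrite mulr_gt0 ?invr_gt0).
exists n0 => n /h; rewrite gagliardo2_Ddot; last exact: (subspaceB ss).
by rewrite lee_fin ler_pM2l ?invr_gt0.
Qed.

Lemma Dspace_form_poincare : exists C, forall u, Dspace s Omega u -> L2form u u <= C * Ddot s u u.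
Proof.
have [C C1 h] := Dspace_poincare N0 M0 s0 OM; exists (C / c) => u Du.
have := h u Du; rewrite nrm2_ip; last exact: (Dspace_sq_int N0 M0 s0 s1 OM Du).
by rewrite gagliardo2_Ddot// -EFinM lee_fin mulrA.
Qed.

Lemma Dspace_form_compact e : 0 < e ->
  exists (m : nat) (l : 'I_m -> ('rV[R]_N -> R) -> R) (C : R),
    [/\ forall j k u v, Dspace s Omega u -> Dspace s Omega v -> l j (k *: u + v) = k * l j u + l j v,
        forall j u, Dspace s Omega u -> l j u ^+ 2 <= C * Ddot s u u &
        forall u, Dspace s Omega u -> L2form u u <= e * Ddot s u u + \sum_j l j u ^+ 2].
Proof.
(* The energy is [c^-1] times [Ddot], so the tolerance [e * c] becomes [e]. *)
move=> e0; have [m [h [C [sh C1 hC]]]] := compactness_box N0 s0 M0 (mulr_gt0 e0 c0).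
have fi := ip_form (@leb R N); have ss := sq_int_subspace (@leb R N).
have sq u : Dspace s Omega u -> sq_int (leb N) u by exact: (Dspace_sq_int N0 M0 s0 s1 OM).
have [P hP] := Dspace_form_poincare.
(* The factor [Num.sqrt C] turns the weighted squares into plain squares. The constant sums over [j]
   the bounds given by Cauchy-Schwarz and Poincare, so that one value serves every functional. *)
exists m, (fun j u => Num.sqrt C * ip (leb N) u (h j)), (\sum_j C * ip (leb N) (h j) (h j) * P); split.
- by move=> j k u v Du Dv; rewrite (formL fi k (sq _ Du) (sq _ Dv) (sh j)); ring.
- move=> j u Du; rewrite exprMn sqr_sqrtr//.
  have CS := form_CauchySchwarz ss fi (sq _ Du) (sh j).
  have hj i : 0 <= ip (leb N) (h i) (h i) by exact: (form_ge0 fi).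
  have uu : 0 <= L2form u u by exact: (form_ge0 fi (sq _ Du)).
  have PD : 0 <= P * Ddot s u u := le_trans uu (hP u Du).
  rewrite mulr_suml (bigD1 j)//= -[leLHS]addr0; apply: lerD; last first.
    by apply: sumr_ge0 => i _; rewrite -mulrA mulr_ge0// mulr_ge0.
  rewrite -!mulrA ler_wpM2l//; apply: le_trans CS _.
  by rewrite mulrC ler_wpM2l//; exact: hP.
- move=> u Du; have mu := Dspace_measurable Du.
  have [g [mg gM ug]] := box_restrict mu (Dspace_box OM Du).
  have sg : sq_int (leb N) g by split => //; rewrite -(nrm2_ae mu mg ug); case: (sq _ Du).
  have ugn : ip (leb N) (u - g) (u - g) = 0.
    rewrite ip_nrm2 (_ : nrm2 _ _ = 0%E)//; apply/nrm2_eq0; first exact: measurable_funB.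
    apply: filterS ug => x /= h1; change (u x - g x = 0); by rewrite h1 addrN.
  have ugh j : ip (leb N) u (h j) = ip (leb N) g (h j).
    exact: (form_null_eq ss fi (sq _ Du) sg (sh j) ugn).
  have := hC g sg gM.
  rewrite -(nrm2_ae mu mg ug) -(gagliardo2_ae s mu mg ug) (nrm2_ip (sq _ Du)) (gagliardo2_Ddot Du).
  rewrite -EFinM -EFinD lee_fin mulrA mulfK ?gt_eqF// => /le_trans; apply.
  apply: lerD => //; apply: ler_sum => j _.
  by rewrite exprMn sqr_sqrtr// ugh.
Qed.

End Forms.
End DspaceComplete.

(** * Positivity of the normalizing constant *)

Section Gamma.
Context {R : realType}.
Local Notation leb1 := (@lebesgue_measure R).

(** Raise [expR (t / m) >= 1 + t / m >= t / m] to the power [m] and invert. *)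
Lemma expRN_le_pow (m : nat) (t : R) : 0 < t -> expR (- t) <= (m%:R / t) ^+ m.
Proof.
move=> t0; have [->|m0] := posnP m.
  by rewrite expr0 -expR0 ler_expR oppr_le0 ltW.
have mR : 0 < m%:R :> R by rewrite ltr0n.
rewrite expRN -[leLHS]div1r ler_pdivrMr ?expR_gt0//.
have -> : expR t = expR (t / m%:R) ^+ m.
  by rewrite -expRM_natl mulrCA mulfV ?mulr1// gt_eqF.
rewrite -exprMn exprn_ege1// -ler_pdivrMl ?divr_gt0// mulr1 invf_div.
by apply: ltW; apply: le_lt_trans (expR_gt1Dx _); rewrite ?gt_eqF ?divr_gt0// lerDr.
Qed.

Lemma integral_segment (r : R) : 0 <= r ->
  (\int[leb1]_t (\1_(`[0, r]%classic) t)%:E = r%:E)%E.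
Proof.
move=> r0; transitivity (leb1 `[0, r]%classic).
  by rewrite integral_indic ?setIT//; exact: measurable_itv.
transitivity (if (0%:E < r%:E)%E then (r%:E - 0%:E)%E else 0%E); first exact: lebesgue_measure_itv.
by rewrite lte_fin; case: ltP => [_|r1]; rewrite ?sube0//; congr EFin; apply/eqP; rewrite eq_le r0.
Qed.

Definition gamma_integrand (a t : R) : R := t `^ (a - 1) * expR (- t).

Lemma measurable_gamma_integrand a : measurable_fun setT (gamma_integrand a).
Proof.
apply: measurable_funM; first exact: measurable_powR.
by apply: measurableT_comp => //; exact: measurable_expR.
Qed.

Lemma powRB1 (t a : R) : 0 < t -> t `^ (a - 1) = t `^ a / t.
Proof.
by move=> t0; rewrite powRB ?powRr1 ?(ltW t0)// (gt_eqF t0) implybT.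
Qed.

(** Finiteness is part of the positivity of [GammaR]: a real-valued integral that diverges to
    infinity would be 0 by convention. *)
Lemma gamma_integral_lty (a : R) : 0 < a ->
  (\int[leb1]_(t in `]0%R, +oo[) (gamma_integrand a t)%:E < +oo)%E.
Proof.
(* With [m] at least [a + 2], the decay [(m / t)^m] of the exponential beats [t^a]: the large scales
   give the ratio [q * 2 / 2^m], below 1. *)
move=> a0; pose b := Num.bound a; pose m := b.+2.
pose q : R := 2 `^ a; have q0 : 0 < q by apply: powR_gt0.
have ab : a < b%:R by apply: archi_boundP; exact: ltW.
have qb : q <= 2 ^+ b by rewrite -powR_mulrn// ler_powR ?ler1n// ltW.
have half : 2^-1 `^ a = q^-1 by rewrite /q -powRN -[2^-1]powR_inv1// -powRrM mulN1r.
have q1 : 1 < q.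
  rewrite /q -[ltLHS](congr1 (fun f => f a) (@powR1 R)).
  by apply: gt0_ltr_powR => //; rewrite ?nnegrE ?ltr1n.
(* Bounds of the integrand on []2^-(k+1), 2^-k]], where the exponential is at most 1, and on []2^k,
   2^(k+1)]], where the factor [1 / t] is at most 1. *)
pose c k : R := (q^-1) ^+ k * 2 ^+ k.+1.
pose d k : R := q ^+ k.+1 * (m%:R / 2 ^+ k) ^+ m.
have c0 k : 0 <= c k by rewrite mulr_ge0 ?exprn_ge0 ?invr_ge0// ltW.
have d0 k : 0 <= d k by rewrite mulr_ge0 ?exprn_ge0 ?divr_ge0 ?exprn_ge0// ltW.
pose G1 (k : nat) (t : R) : \bar R := ((c k)%:E * (\1_(`[0, (2^-1) ^+ k]%classic) t)%:E)%E.
pose G2 (k : nat) (t : R) : \bar R := ((d k)%:E * (\1_(`[0, 2 ^+ k.+1]%classic) t)%:E)%E.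
have G10 k t : (0 <= G1 k t)%E by rewrite mule_ge0// lee_fin.
have G20 k t : (0 <= G2 k t)%E by rewrite mule_ge0// lee_fin.
have mi (r : R) : measurable_fun setT (EFin \o (\1_(`[0, r]%classic) : R -> R)).
  by apply/measurable_EFinP; apply: measurable_indic; exact: measurable_itv.
have mG1 k : measurable_fun setT (G1 k) by apply: measurable_funeM; exact: mi.
have mG2 k : measurable_fun setT (G2 k) by apply: measurable_funeM; exact: mi.
have IG1 k : (\int[leb1]_t G1 k t = (2 * (q^-1) ^+ k)%:E)%E.
  rewrite ge0_integralZl//; [|exact: mi|by rewrite lee_fin].
  rewrite integral_segment; last by rewrite exprn_ge0.
  rewrite -EFinM; congr EFin; rewrite /c (exprS 2 k) (exprVn 2 k) mulrA mulfK ?expf_neq0//.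
  by rewrite mulrC.
have IG2 k : (\int[leb1]_t G2 k t = (2 * q * m%:R ^+ m * (q * 2 / 2 ^+ m) ^+ k)%:E)%E.
  rewrite ge0_integralZl//; [|exact: mi|by rewrite lee_fin].
  rewrite integral_segment; last by rewrite exprn_ge0.
  rewrite -EFinM; congr EFin.
  rewrite /d (exprS q) (exprS 2 k) [in LHS]exprMn exprVn [in RHS]exprMn [in RHS]exprVn [in RHS]exprMn exprAC.
  by field; rewrite !expf_neq0.
pose H (t : R) := (\sum_(k <oo) G1 k t + \sum_(k <oo) G2 k t)%E.
have SG1 t : (0 <= \sum_(k <oo) G1 k t)%E by exact: nneseries_ge0.
have SG2 t : (0 <= \sum_(k <oo) G2 k t)%E by exact: nneseries_ge0.
have mH : measurable_fun setT H by apply: emeasurable_funD; exact: ge0_emeasurable_sum.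
have H0 t : (0 <= H t)%E by rewrite adde_ge0.
have IH : (\int[leb1]_t H t < +oo)%E.
  have mS1 : measurable_fun setT (fun t => \sum_(k <oo) G1 k t)%E by exact: ge0_emeasurable_sum.
  have mS2 : measurable_fun setT (fun t => \sum_(k <oo) G2 k t)%E by exact: ge0_emeasurable_sum.
  rewrite ge0_integralD//.
  rewrite !integral_nneseries//.
  rewrite (eq_eseriesr (fun k _ => IG1 k)) (eq_eseriesr (fun k _ => IG2 k)).
  apply: lte_add_pinfty; apply: geometric_nneseries_lty => //.
  - by rewrite invr_ge0 (ltW q0)/= (invf_lt1 q0).
  - by apply: mulr_ge0; [apply: mulr_ge0 => //; exact: ltW|exact: exprn_ge0].
  - have m0 : 0 < 2 ^+ m :> R by exact: exprn_gt0.
    apply/andP; split; first by apply: divr_ge0; [apply: mulr_ge0 => //; exact: ltW|exact: ltW].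
    rewrite (ltr_pdivrMr _ _ m0) mul1r.
    rewrite /m exprS mulrC ltr_pM2l//; apply: le_lt_trans qb _.
    by rewrite exprS ltr_pMl ?exprn_gt0// ltr1n.
apply: le_lt_trans IH.
apply: (@le_trans _ _ (\int[leb1]_(t in `]0%R, +oo[) H t)%E); last first.
  by apply: ge0_subset_integral.
apply: ge0_le_integral => //.
- by move=> t _; rewrite lee_fin mulr_ge0 ?powR_ge0 ?expR_ge0.
- by apply/measurable_EFinP; apply: measurable_funTS; exact: measurable_gamma_integrand.
- exact: measurable_funTS.
move=> t /=; rewrite in_itv/= andbT => t0.
rewrite /gamma_integrand powRB1//.
have [t1|t1] := leP t 1.
  have [k /andP[k1 k2]] := @dyadic_inner R t ltac:(by rewrite t0).
  apply: le_trans (leeDl _ (SG2 t)).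
  apply: le_trans (term_le_nneseries k (fun n => G10 n t)).
  rewrite /G1 indicE mem_set; last by rewrite /= in_itv/= (ltW t0).
  rewrite mule1 lee_fin.
  apply: (@le_trans _ _ (t `^ a / t)).
    by rewrite ler_piMr ?divr_ge0 ?powR_ge0 ?(ltW t0)// -expR0 ler_expR oppr_le0 ltW.
  rewrite /c ler_pM ?powR_ge0 ?invr_ge0 ?(ltW t0)//.
    rewrite -half -powR_exprn// ge0_ler_powR ?nnegrE ?(ltW a0) ?(ltW t0)//.
  by rewrite -[leRHS]invrK lef_pV2 ?posrE ?invr_gt0 ?exprn_gt0// -exprVn ltW.
have [k /andP[k1 k2]] := dyadic_outer t1.
apply: le_trans (leeDr _ (SG1 t)).
apply: le_trans (term_le_nneseries k (fun n => G20 n t)).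
rewrite /G2 indicE mem_set; last by rewrite /= in_itv/= (ltW t0).
rewrite mule1 lee_fin /d ler_pM ?expR_ge0 ?divr_ge0 ?powR_ge0 ?(ltW t0)//.
  apply: (@le_trans _ _ (t `^ a)).
    by rewrite ler_pdivrMr// ler_peMr ?powR_ge0// ltW.
  by rewrite /q -powR_exprn// ge0_ler_powR ?nnegrE ?(ltW a0) ?(ltW t0)// exprn_ge0.
apply: le_trans (expRN_le_pow m t0) _.
rewrite lerXn2r ?nnegrE ?divr_ge0 ?exprn_ge0 ?(ltW t0)//.
by rewrite ler_wpM2l// lef_pV2 ?posrE ?exprn_gt0// ltW.
Qed.

Lemma GammaR_gt0 (a : R) : 0 < a -> 0 < GammaR a.
Proof.
move=> a0; have h := gamma_integral_lty a0.
(* On [[1, 2]] one has [t^a >= 1], [1 / t >= 1 / 2] and [expR (- t) >= expR (- 2)]. *)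
have low : ((2^-1 * expR (- 2))%:E <= \int[leb1]_(t in `]0%R, +oo[) (gamma_integrand a t)%:E)%E.
  apply: (@le_trans _ _ (\int[leb1]_(t in `[1%R, 2%R]) (2^-1 * expR (- 2))%:E)%E).
    rewrite integral_cst//=.
    have -> : leb1 `[1%R, 2%R]%classic = 1%E.
      transitivity (if (1%:E < (2:R)%:E)%E then ((2:R)%:E - 1%:E)%E else 0%E); first exact: lebesgue_measure_itv.
      by rewrite lte_fin ltr1n -EFinB; congr EFin; ring.
    by rewrite mule1.
  apply: (@le_trans _ _ (\int[leb1]_(t in `[1%R, 2%R]) (gamma_integrand a t)%:E)%E).
    apply: ge0_le_integral => //.
    - by apply/measurable_EFinP; apply: measurable_funTS; exact: measurable_gamma_integrand.
    move=> t /=; rewrite in_itv/= => /andP[t1 t2]; have t0 : 0 < t by rewrite (lt_le_trans ltr01).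
    rewrite lee_fin /gamma_integrand powRB1// ler_pM ?expR_ge0//; last by rewrite ler_expR lerN2.
    rewrite -[leLHS]mul1r ler_pM// ?lef_pV2 ?posrE//.
    rewrite -[leLHS](congr1 (fun f => f a) (@powR1 R)).
    by rewrite ge0_ler_powR ?nnegrE ?(ltW a0) ?(ltW t0).
  apply: ge0_subset_integral => //.
  - by apply/measurable_EFinP; apply: measurable_funTS; exact: measurable_gamma_integrand.
  - by move=> t _; rewrite lee_fin mulr_ge0 ?powR_ge0 ?expR_ge0.
  - by move=> t /=; rewrite !in_itv/= andbT => /andP[t1 _]; rewrite (lt_le_trans ltr01).
have -> : GammaR a = fine (\int[leb1]_(t in `]0%R, +oo[) (gamma_integrand a t)%:E)%E by [].
have pos : 0 < 2^-1 * expR (- 2) :> R by rewrite mulr_gt0 ?expR_gt0.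
apply: (lt_le_trans pos); rewrite -lee_fin fineK// ge0_fin_numE//.
by apply: le_trans low; rewrite lee_fin ltW.
Qed.

(** Makes [Ddot u u] and the Gagliardo energy positive multiples of each other. *)
Lemma fracC_gt0 (N : nat) (s : R) : 0 < s -> s < 1 -> 0 < fracC N s.
Proof.
move=> s0 s1; rewrite /fracC !mulr_gt0 ?powR_gt0 ?pi_gt0 ?invr_gt0 ?GammaR_gt0 ?subr_gt0//.
  by rewrite divr_gt0// ltr_wpDl// mulr_gt0.
by rewrite (lt_trans s1)// ltr1n.
Qed.
End Gamma.

(** * Spectral pairs of open sets *)

Section Bumps.
Context {R : realType} {N : nat}.

Lemma open_box (W : set 'rV[R]_N) p : open W -> W p ->
  exists2 e : R, 0 < e & forall x : 'rV[R]_N, (forall i, `|x ord0 i - p ord0 i| <= e) -> W x.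
Proof.
move=> oW Wp; have /nbhs_ballP[e /= e0 be] := open_nbhs_nbhs (conj oW Wp).
exists (e / 2); first by rewrite divr_gt0.
move=> x hx; apply: be; rewrite -ball_normE /=.
apply: (@le_lt_trans _ _ (e / 2)); last by rewrite ltr_pdivrMr// ltr_pMr// ltr1n.
apply: norm_le_coord => [|i]; first by rewrite divr_ge0// ltW.
by rewrite !mxE distrC.
Qed.

(** A point where [f] is nonzero would bring a whole cube, of positive measure, into the null
    set. *)
Lemma continuous_ae_eq0 (f : 'rV[R]_N -> R) : continuous f ->
  {ae leb N, forall x, f x = 0} -> forall x, f x = 0.
Proof.
move=> cf [A [mA A0 fA]] x; apply/eqP; apply: contrapT => /negP fx.
have oW : open [set y | f y != 0].
  have := (continuousP f).1 cf _ (@open_neq R 0); exact.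
have [e e0 he] := open_box oW fx.
have : (leb N (cube x e) <= leb N A)%E.
  apply: le_measure; rewrite ?inE//; first exact: measurable_cube.
  move=> y hy; apply: fA => /= fy0.
  have /= : f y != 0; last by rewrite fy0 eqxx.
  apply: he => i; have /andP[h1 h2] := hy i.
  by rewrite ger0_norm ?subr_ge0// lerBlDl ltW.
by rewrite A0 leb_cube ?(ltW e0)// lee_fin leNgt exprn_gt0.
Qed.

(* The bumps are rescaled copies of [zeta]. *)
Lemma disjoint_test_functions (Omega W : set 'rV[R]_N) zeta q p n : (0 < N)%N ->
  test_function Omega zeta -> zeta q != 0 -> open W -> W p ->
  exists u : 'I_n -> 'rV[R]_N -> R,
    [/\ forall i, test_function W (u i), forall i, exists x, u i x != 0 &
        forall i j x, i != j -> u i x * u j x = 0].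
Proof.
move=> N0 tz zq oW Wp.
have [e e0 he] := open_box oW Wp.
have [M M0 hM] := test_function_supp_bounded tz.
pose L := M + \sum_j `|q ord0 j|.
have L0 : 0 < L by rewrite ltr_wpDr// sumr_ge0.
have zL y : zeta y != 0 -> forall j, `|y ord0 j - q ord0 j| <= L.
  move=> zy j; apply: le_trans (ler_normB _ _) _; apply: lerD; first exact: hM.
  by rewrite (bigD1 j)//= lerDl sumr_ge0.
pose k0 : 'I_N := Ordinal N0.
(* The centres [P i] are [d] apart on a line parallel to an axis, and the radius [d / 3] keeps the
   supports disjoint and within distance [e] of [p]. *)
pose d := e / n.+1%:R; have d0 : 0 < d by rewrite divr_gt0.
pose r := d / 3; have r0 : 0 < r by rewrite divr_gt0.
have nd i : (i < n)%N -> i%:R * d + r <= e.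
  move=> ni; have : (i%:R + 1) * d <= e.
    rewrite /d mulrCA ler_piMr ?(ltW e0)// ler_pdivrMr// mul1r.
    by rewrite natr1 ler_nat ltnS ltnW.
  by rewrite /r => h; lra.
pose P (i : nat) : 'rV[R]_N := p + (i%:R * d) *: delta_mx ord0 k0.
(* This dilation sends [P i] to [q] and the box of radius [r] onto the box of radius [L] around [q],
   which contains the support of [zeta]. *)
pose c := L / r; have c0 : 0 < c by rewrite divr_gt0.
pose u (i : 'I_n) := fun x => zeta (c *: x + (q - c *: P i)).
have uP i x : u i x != 0 -> forall j, `|x ord0 j - P i ord0 j| <= r.
  move=> /zL h j; have := h j; rewrite !mxE.
  have -> : c * x ord0 j + (q ord0 j - c * (p ord0 j + i%:R * d * ((ord0 == ord0 :> 'I_1) && (j == k0))%:R)) - q ord0 j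
    = c * (x ord0 j - (p ord0 j + i%:R * d * ((ord0 == ord0 :> 'I_1) && (j == k0))%:R)) by ring.
  by rewrite normrM (gtr0_norm c0) -ler_pdivlMl// /c invf_div divfK ?(gt_eqF L0).
exists u; split.
- move=> i; pose S := [set x : 'rV[R]_N | forall j, `[P i ord0 j - r, P i ord0 j + r]%classic (x ord0 j)].
  apply: (@test_function_closed _ _ _ _ S).
  + by move=> k; apply: class_C_affine; case: tz.
  + by apply: (rV_compact (A := fun j => `[P i ord0 j - r, P i ord0 j + r]%classic)) => j; exact: segment_compact.
  + move=> x Sx; apply: he => j; have := Sx j; rewrite /= in_itv/= -ler_distl.
    move=> h; rewrite -(subrKA (P i ord0 j)); apply: le_trans (ler_normD _ _) _.
    apply: (@le_trans _ _ (r + i%:R * d)); last by rewrite addrC nd.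
    apply: lerD => //; rewrite !mxE addrAC subrr add0r.
    have id0 : 0 <= i%:R * d by apply: mulr_ge0 => //; exact: ltW.
    by case: (_ && _); rewrite ?mulr1 ?mulr0 ?normr0// ger0_norm.
  + by move=> x /uP h j; rewrite /= in_itv/= -ler_distl; exact: h.
- move=> i; exists (P i); have -> : u i (P i) = zeta q by rewrite /u addrCA subrr addr0.
  exact: zq.
- move=> i j x ij; apply/eqP; apply: contrapT => /negP; rewrite mulf_eq0 negb_or => /andP[/uP/(_ k0) hi /uP/(_ k0) hj].
  have : `|P i ord0 k0 - P j ord0 k0| <= r + r.
    rewrite -(subrKA (x ord0 k0)); apply: le_trans (ler_normD _ _) _.
    by apply: lerD => //; rewrite distrC.
  rewrite !mxE !eqxx/= !mulr1 opprD addrACA subrr add0r -mulrBl normrM (gtr0_norm d0).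
  apply/negP; rewrite -ltNge; apply: (@lt_le_trans _ _ d); first by rewrite /r; lra.
  rewrite ler_peMl ?(ltW d0)//.
  move: ij; rewrite -val_eqE/=; case: (ltngtP i j) => // h _.
  - by rewrite distrC -natrB ?(ltnW h)// ger0_norm ?ler0n// ler1n subn_gt0.
  - by rewrite -natrB ?(ltnW h)// ger0_norm ?ler0n// ler1n subn_gt0.
Qed.
End Bumps.

Section SpectralPair.
Context {R : realType} {N : nat} (N0 : (0 < N)%N) (M : R) (M0 : 0 < M) (s : R) (s0 : 0 < s) (s1 : s < 1).
Context (Omega : set 'rV[R]_N) (OM : forall x, Omega x -> forall i, `|x ord0 i| <= M).

(** Multiplying the vanishing sum by [u i] isolates [c i * u i ^+ 2]. If [c i] is nonzero, [u i]
    vanishes almost everywhere, hence everywhere by continuity. *)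
Lemma L2_independent n (u : 'I_n -> 'rV[R]_N -> R) (c : 'I_n -> R) :
  (forall i, test_function Omega (u i)) -> (forall i, exists x, u i x != 0) ->
  (forall i j x, i != j -> u i x * u j x = 0) ->
  L2form (\sum_i c i *: u i) (\sum_i c i *: u i) = 0 -> forall i, c i = 0.
Proof.
move=> tu nu du; have ss := Dspace_subspace s Omega.
have Du i : Dspace s Omega (u i) by exact: (test_function_Dspace s).
have Ds : Dspace s Omega (\sum_i c i *: u i).
  by apply: (subspace_sum ss) => i _; exact: Du.
move=> /(L2form_null N0 M0 s0 s1 OM Ds) h i; apply/eqP; apply: contrapT => /negP ci.
have [x] := nu i; rewrite (continuous_ae_eq0 _ _ x) ?eqxx//.
  by case: (tu i) => su _ _; exact: class_C_continuous (su 0%N).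
apply: filterS h => y; rewrite fct_sumE (bigD1 i)//= => hy.
have : u i y * (c i *: u i y + \sum_(j < n | j != i) c j *: u j y) = 0.
  by rewrite [X in _ * X]hy mulr0.
rewrite mulrDr mulr_sumr big1 => [|j ji].
  by rewrite addr0 mulrCA => /eqP; rewrite mulf_eq0 (negbTE ci) mulf_eq0 orbb => /eqP.
by rewrite mulrCA du ?mulr0// eq_sym.
Qed.

(** [zeta] only serves as a template for bumps, so its set [Omega'] is unrelated to [Omega]: the
    same cutoff serves [Omega] and the complement of [K] in it. *)
Lemma Dspace_spectral_pair (Omega' : set 'rV[R]_N) zeta q : open Omega -> Omega !=set0 ->
  test_function Omega' zeta -> zeta q != 0 ->
  spectral_pair (Dspace s Omega) (Ddot s) L2form.
Proof.
move=> oO [p Op] tz zq; have C0 := fracC_gt0 N s0 s1.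
split.
- exact: Dspace_subspace.
- exact: (Ddot_form M0 s0 s1 OM C0).
- exact: (L2_form N0 M0 s0 s1 OM).
- exact: (Dspace_form_poincare N0 M0 s0 s1 OM C0).
- exact: (L2form_Ddot_null N0 M0 s0 s1 OM C0).
- exact: (Dspace_form_complete N0 M0 s0 s1 OM C0).
- exact: (Dspace_form_compact N0 M0 s0 s1 OM C0).
- move=> n; have [u [tu nu du]] := disjoint_test_functions n N0 tz zq oO Op.
  exists u; split; first by move=> i; exact: (test_function_Dspace s).
  by move=> c; exact: L2_independent.
Qed.
End SpectralPair.

(** * Eigenvalues and capacity *)

Section Eigenvalues.
Context {R : realType} {N : nat} (N0 : (0 < N)%N) (M : R) (M0 : 0 < M) (s : R) (s0 : 0 < s) (s1 : s < 1).
Context (Omega : set 'rV[R]_N) (OM : forall x, Omega x -> forall i, `|x ord0 i| <= M).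
Local Notation V := (Dspace s Omega).
Let sV := Dspace_subspace s Omega.
Let null u : V u -> L2form u u = 0 <-> {ae leb N, forall x, u x = 0} := @L2form_null R N N0 M M0 s s0 s1 Omega OM u.

Lemma Dspace_eigenvalueP lam : is_eigenvalue s Omega lam <->
  exists2 u, eig V (Ddot s) L2form lam u & L2form u u != 0.
Proof.
split => -[u Eu nu]; exists u => //; have Vu : V u by case: Eu.
  by apply/eqP => /(null Vu).
by move=> /(null Vu) h; rewrite h eqxx in nu.
Qed.

Lemma Dspace_has_dimP lam m : has_dim (frac_eigenspace s Omega lam) m <->
  has_null_dim L2form (eig V (Ddot s) L2form lam) m.
Proof.
have sumE (e : 'I_m -> 'rV[R]_N -> R) c x : (\sum_i c i *: e i) x = \sum_i c i * e i x.
  by rewrite fct_sumE.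
have Vsum (e : 'I_m -> 'rV[R]_N -> R) c : (forall i, V (e i)) -> V (\sum_i c i *: e i).
  by move=> Ve; apply: (subspace_sum sV) => i _; exact: Ve.
split => -[e [Ee fe ge]]; exists e; have Ve i : V (e i) by case: (Ee i).
- split=> // [c /(null (Vsum e c Ve)) h|u Eu].
    by apply: fe; apply: filterS h => x; rewrite sumE.
  have [c h] := ge u Eu; exists c; apply/null.
    by apply: (subspaceB sV); [case: Eu|exact: Vsum].
  apply: filterS h => x h1; change (u x - (\sum_i c i *: e i) x = 0).
  by rewrite sumE h1 addrN.
- split=> // [c h|u Eu].
    by apply: fe; apply/null; [exact: Vsum|apply: filterS h => x; rewrite sumE].
  have [c h] := ge u Eu; exists c; move: h => /null h.
  have Vu : V u by case: Eu.
  apply: filterS (h (subspaceB sV Vu (Vsum e c Ve))) => x /eqP.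
  by rewrite [X in X == _]/(u x - _) subr_eq0 sumE => /eqP.
Qed.

Lemma spectral_system_enumeration e l : spectral_pair V (Ddot s) L2form ->
  spectral_system V (Ddot s) L2form e l -> eigenvalue_enumeration s Omega l.
Proof.
move=> sp ss; split; first exact: ss_mono ss.
- by apply/cvgryPgt => A; have [n h] := ss_bound ss A; exists n.
- by move=> k; apply/Dspace_eigenvalueP; exact: (ss_eigenvalue ss).
- move=> lam _; have [m h c] := ss_has_null_dim sp ss lam; exists m => //.
  exact/Dspace_has_dimP.
Qed.

(** [frac_eigenvalue] comes from [xget] with default 0, so it lists eigenvalues only once some
    enumeration is known to exist. The successor compensates for numbering from 1. *)
Lemma frac_eigenvalue_enumeration : spectral_pair V (Ddot s) L2form ->
  eigenvalue_enumeration s Omega (fun k => frac_eigenvalue s Omega k.+1).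
Proof.
move=> sp; have [e [l ss]] := spectral_system_exists sp.
have := xgetPex (fun=> 0) (P := [set l | eigenvalue_enumeration s Omega l])
  (ex_intro _ l (spectral_system_enumeration sp ss)).
exact.
Qed.
End Eigenvalues.

(** * The cutoff, the capacity and the subspace of the complement of [K] *)

Section Capacity.
Context {R : realType} {N : nat} (N0 : (0 < N)%N) (M : R) (M0 : 0 < M) (s : R) (s0 : 0 < s) (s1 : s < 1).
Context (Omega : set 'rV[R]_N) (OM : forall x, Omega x -> forall i, `|x ord0 i| <= M).
Let C0 := fracC_gt0 N s0 s1.

Lemma Dspace_mono (Omega1 Omega2 : set 'rV[R]_N) : Omega1 `<=` Omega2 -> Dspace s Omega1 `<=` Dspace s Omega2.
Proof.
move=> O12 u [mu [phi [tphi cphi aphi]]]; split => //; exists phi; split => // n.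
exact: test_functionW O12 (tphi n).
Qed.

(** The sequence is Cauchy, so it has a limit in the smaller space by completeness of that space.
    The two limits differ by a vector of zero energy, null by the Poincare inequality. *)
Lemma Dspace_closed (Omega1 : set 'rV[R]_N) w_ u : Omega1 `<=` Omega ->
  (forall n, Dspace s Omega1 (w_ n)) -> Dspace s Omega u -> form_cvg (Ddot s) w_ u ->
  Dspace s Omega1 u.
Proof.
move=> O1 Dw Du cw.
have OM1 x : Omega1 x -> forall i, `|x ord0 i| <= M by move=> /O1; exact: OM.
have sV := Dspace_subspace s Omega; have fV := Ddot_form M0 s0 s1 OM C0.
have Dw' n : Dspace s Omega (w_ n) by exact: Dspace_mono O1 _ (Dw n).
have via v n e : Dspace s Omega v -> 
    Ddot s (w_ n - u) (w_ n - u) <= e -> Ddot s (w_ n - v) (w_ n - v) <= e ->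
    Ddot s (u - v) (u - v) <= 4 * e.
  move=> Dv h1 h2; have -> : u - v = (w_ n - v) - (w_ n - u) by rewrite opprB [RHS]addrC subrKA.
  have := form_leB sV fV (subspaceB sV (Dw' n) Dv) (subspaceB sV (Dw' n) Du); lra.
have [|w Dw1 cw1] := Dspace_form_complete N0 M0 s0 s1 OM1 C0 Dw.
  move=> e e0; have [n0 h] := cw (e / 4) ltac:(by rewrite divr_gt0).
  exists n0 => i j ni nj.
  have -> : w_ i - w_ j = (w_ i - u) - (w_ j - u) by rewrite opprB addrA subrK.
  have := form_leB sV fV (subspaceB sV (Dw' i) Du) (subspaceB sV (Dw' j) Du).
  by have := h i ni; have := h j nj; lra.
have Dw2 : Dspace s Omega w by exact: Dspace_mono O1 _ Dw1.
have Duw : Dspace s Omega (u - w) by exact: (subspaceB sV).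
have a0 : Ddot s (u - w) (u - w) <= 0.
  apply/ler_addgt0Pl => e e0; rewrite addr0.
  have [n1 h1] := cw (e / 4) ltac:(by rewrite divr_gt0).
  have [n2 h2] := cw1 (e / 4) ltac:(by rewrite divr_gt0).
  have := via w (maxn n1 n2) (e / 4) Dw2 (h1 _ (leq_maxl _ _)) (h2 _ (leq_maxr _ _)); lra.
have {}a0 : Ddot s (u - w) (u - w) = 0.
  by apply/eqP; rewrite eq_le a0 (form_ge0 fV).
have [C hC] := Dspace_form_poincare N0 M0 s0 s1 OM C0.
have b0 : L2form (u - w) (u - w) = 0.
  apply/eqP; rewrite eq_le (form_ge0 (L2_form N0 M0 s0 s1 OM) Duw) andbT.
  by have := hC _ Duw; rewrite a0 mulr0.
apply: (Dspace_ae (Dspace_measurable Du) Dw1).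
move/(L2form_null N0 M0 s0 s1 OM Duw): b0; apply: filterS => x /eqP.
by rewrite [X in X == _]/(u x - w x) subr_eq0 => /eqP.
Qed.

Lemma cutoff_Dspace_eq K zeta : cutoff Omega K zeta -> Dspace s (Omega `\` K) zeta ->
  Dspace s Omega = Dspace s (Omega `\` K).
Proof.
move=> [tz [U [oU KU Uz]]] Dz; have sub : Omega `\` K `<=` Omega by move=> x [].
have OM1 x : (Omega `\` K) x -> forall i, `|x ord0 i| <= M by move=> /sub; exact: OM.
have sV := Dspace_subspace s Omega; have sV1 := Dspace_subspace s (Omega `\` K).
have tst phi : test_function Omega phi -> Dspace s (Omega `\` K) phi.
  move=> tphi; have -> : phi = (cst 1 - zeta) * phi + phi * zeta.
    by rewrite mulrBl mulrC [zeta * phi]mulrC -[cst 1]/(1 : 'rV[R]_N -> R) mulr1 subrK.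
  apply: (subspaceD sV1); last exact: (Dspace_mul N0 M0 s0 s1 OM1 tphi).
  apply: test_function_Dspace; have [sphi cphi phiO] := tphi.
  (* The factor [1 - zeta] vanishes on the open set [U], so the product lives on the part of the
     support of [phi] outside [U], which is compact and misses [K]. *)
  apply: (@test_function_closed _ _ _ _ (supp phi `&` ~` U)).
  - apply: smoothM => //; apply: smoothD; first exact: smooth_cst.
    by rewrite -scaleN1r; apply: smoothZ; case: tz.
  - apply: compact_closedI => //; exact: open_closedC.
  - by move=> x [/phiO Ox Ux]; split => // /KU.
  - move=> x; rewrite [X in X != _]/((1 - zeta x) * phi x) mulf_eq0 negb_or => /andP[zx px].
    split; first exact: supp_neq0.
    by move=> /Uz z1; rewrite z1 subrr eqxx in zx.
apply/seteqP; split; last exact: Dspace_mono.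
move=> u Du.
have c0 : 0 < fracC N s / 2 by rewrite divr_gt0.
have approx (n : nat) : exists phi, test_function Omega phi /\
    (gagliardo2 s (phi - u)%R <= (n.+1%:R^-1 / (fracC N s / 2))%:E)%E.
  have n0 : 0 < n.+1%:R^-1 :> R by rewrite invr_gt0.
  by have [p tp gp] := Dspace_approx Du (divr_gt0 n0 c0); exists p.
have [phi hphi] := choice approx.
have dphi n : Dspace s Omega (phi n) by apply: test_function_Dspace; case: (hphi n).
apply: (Dspace_closed (w_ := phi) sub _ Du) => [n|e e0].
  by apply: tst; case: (hphi n).
have [n0 h] := inv_nat_small e0; exists n0 => n /h hn.
have [_] := hphi n; rewrite (gagliardo2_Ddot M0 s0 s1 OM C0); last exact: (subspaceB sV).
rewrite lee_fin mulrC ler_pM2r ?invr_gt0// => /le_trans; apply; exact: ltW.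
Qed.

Lemma capacity_eq0 K zeta : cutoff Omega K zeta ->
  capacity s Omega K zeta = 0 <-> Dspace s (Omega `\` K) zeta.
Proof.
move=> [tz _]; have sub : Omega `\` K `<=` Omega by move=> x [].
have sV := Dspace_subspace s Omega; have sV1 := Dspace_subspace s (Omega `\` K).
have fV := Ddot_form M0 s0 s1 OM C0.
have Vz : Dspace s Omega zeta by exact: test_function_Dspace.
rewrite /capacity; set S := [set _ | _ in _].
have lb : lbound S 0 by move=> _ [u [Du _] <-]; exact: (form_ge0 fV).
split=> [S0|Dz].
- have hS : has_inf S.
    (* [zeta] itself is admissible. Nonemptiness matters, since the infimum of an empty set is 0 by
       convention and would carry no information. *)
    split; last by exists 0.
    exists (Ddot s zeta zeta), zeta => //; split => //.
    have -> : zeta \- zeta = 0 by apply/funext => x; rewrite /= subrr.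
    exact: (subspace0 sV1).
  have ap (n : nat) : exists u, [/\ Dspace s Omega u, Dspace s (Omega `\` K) (u - zeta) & Ddot s u u < n.+1%:R^-1].
    have n0 : 0 < n.+1%:R^-1 :> R by rewrite invr_gt0.
    by have [_ [u [Du Duz] <-]] := inf_adherent n0 hS; rewrite S0 add0r; exists u.
  have [u hu] := choice ap.
  apply: (Dspace_closed (w_ := fun n => zeta - u n) sub _ Vz) => [n|e e0].
    by rewrite -opprB; apply: (subspaceN sV1); case: (hu n).
  have [n0 h] := inv_nat_small e0; exists n0 => n /h hn.
  have [Du _ hun] := hu n; rewrite addrAC subrr add0r -scaleN1r (form_sqrZ sV fV)//.
  by rewrite sqrrN expr1n mul1r ltW// (lt_trans hun).
- apply/eqP; rewrite eq_le; apply/andP; split; last first.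
    apply: lb_le_inf => //; exists 0, 0; last exact: (form0l sV fV (subspace0 sV)).
    split; first exact: (subspace0 sV).
    by have -> : 0 \- zeta = - zeta; [apply/funext => x; rewrite /= sub0r|exact: (subspaceN sV1)].
  apply: ge_inf; first by exists 0.
  exists 0; last exact: (form0l sV fV (subspace0 sV)).
  split; first exact: (subspace0 sV).
  by have -> : 0 \- zeta = - zeta; [apply/funext => x; rewrite /= sub0r|exact: (subspaceN sV1)].
Qed.
End Capacity.

(** A point of [K] with maximal first coordinate, pushed slightly in that direction, leaves [K] but
    not the open set. *)
Lemma open_setD_compact_neq0 (R : realType) (N : nat) (Omega K : set 'rV[R]_N) : (0 < N)%N ->
  open Omega -> compact K -> K `<=` Omega -> K !=set0 -> Omega `\` K !=set0.
Proof.
move=> N0 oO cK KO K0; pose i0 : 'I_N := Ordinal N0.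
have cc : continuous (fun x : 'rV[R]_N => x ord0 i0) by exact: coord_continuous.
have [q /set_mem Kq qmax] := EVT_max_rV K0 cK (continuous_subspaceT cc).
have [e e0 he] := open_box oO (KO q Kq).
exists (q + e *: delta_mx ord0 i0); split.
  apply: he => i; rewrite !mxE eqxx/= addrAC subrr add0r.
  by case: (i == i0); rewrite ?mulr1 ?mulr0 ?normr0 ?gtr0_norm// ltW.
move=> /mem_set /qmax; rewrite !mxE !eqxx mulr1 => h.
by move: e0; rewrite ltNge -(lerD2l (q ord0 i0)) addr0 h.
Qed.

Theorem corollary2p7 (R : realType) (N : nat) (hN : (1 <= N)%N)
  (Omega K : set 'rV[R]_N) (hOmega : open Omega) (hbnd : bounded_set Omega)
  (hK : compact K) (hKOmega : K `<=` Omega)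
  (s : R) (hs0 : 0 < s) (hs1 : s < Num.min 1 (N%:R / 2))
  (zeta : 'rV[R]_N -> R) (hzeta : cutoff Omega K zeta) :
  (forall k : nat, (1 <= k)%N ->
     frac_eigenvalue s Omega k = frac_eigenvalue s (Omega `\` K) k)
  <-> capacity s Omega K zeta = 0.
Proof.
have s1 : s < 1 by move: hs1; rewrite lt_min => /andP[].
have [M M0 OM] : exists2 M : R, 0 < M & forall x, Omega x -> forall i, `|x ord0 i| <= M.
  have [M [_ hM]] := hbnd; exists (`|M| + 1); first by rewrite ltr_wpDl.
  have MM : M < `|M| + 1 by rewrite ltr_pwDr ?ler_norm.
  by move=> x Ox i; exact: le_trans (coord_le_norm x i) (hM _ MM x Ox).
have OM1 x : (Omega `\` K) x -> forall i, `|x ord0 i| <= M by move=> [/OM].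
rewrite (capacity_eq0 hN M0 hs0 s1 OM hzeta); split => [same|Dz k _]; last first.
  (* The eigenvalues depend on the open set only through its [Dspace]. *)
  by rewrite /frac_eigenvalue /eigenvalue_enumeration /is_eigenvalue /frac_eigenspace
     (cutoff_Dspace_eq hN M0 hs0 s1 OM hzeta Dz).
have [tz [U [oU KU Uz]]] := hzeta.
(* For empty [K] the two sets coincide. Otherwise a point of [K] shows that [Omega] is nonempty and
   that [zeta] is not identically 0, as the spectral pairs require. *)
have [K0|/set0P K0] := eqVneq K set0.
  by rewrite K0 setD0; exact: test_function_Dspace.
have [q Kq] := K0.
have zq : zeta q != 0 by rewrite Uz ?oner_eq0//; exact: KU.
have oO1 : open (Omega `\` K).
  by rewrite setDE; apply: openI => //; apply: closed_openC; apply: compact_closed => //; exact: norm_hausdorff.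
have sp := Dspace_spectral_pair hN M0 hs0 s1 OM hOmega (ex_intro _ q (hKOmega q Kq)) tz zq.
have sp1 := Dspace_spectral_pair hN M0 hs0 s1 OM1 oO1
  (open_setD_compact_neq0 hN hOmega hK hKOmega K0) tz zq.
have [e [l ss]] := spectral_system_exists sp; have [e1 [l1 ss1]] := spectral_system_exists sp1.
have [_ _ _ en] := frac_eigenvalue_enumeration hN M0 hs0 s1 OM sp.
have := frac_eigenvalue_enumeration hN M0 hs0 s1 OM1 sp1.
rewrite (_ : (fun k => frac_eigenvalue s (Omega `\` K) k.+1) = (fun k => frac_eigenvalue s Omega k.+1)); last first.
  by apply/funext => k; rewrite same.
move=> [_ _ ev1 en1].
have sub : Omega `\` K `<=` Omega by move=> x [].
apply: (isospectral_inclusion sp sp1 _ _ _ ss ss1); last exact: test_function_Dspace.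
- exact: Dspace_mono.
- move=> u w Du Dw.
  have Duw : Dspace s Omega (u - w).
    by apply: (subspaceB (Dspace_subspace s Omega)) => //; exact: Dspace_mono Dw.
  move=> /(L2form_null hN M0 hs0 s1 OM Duw) h.
  apply: (Dspace_ae (Dspace_measurable Du) Dw); apply: filterS h => x /eqP.
  by rewrite [X in X == _]/(u x - w x) subr_eq0 => /eqP.
- move=> lam /(Dspace_eigenvalueP hN M0 hs0 s1 OM) elam.
  have [m dm cm] := en lam elam; exists m; split; first exact/(Dspace_has_dimP hN M0 hs0 s1 OM).
  (* Every eigenvalue of [Omega] occurs in the list: otherwise its index set is empty, its
     eigenspace has dimension 0, and the eigenvector vanishes almost everywhere. *)
  have [k kl] : exists k, frac_eigenvalue s Omega k.+1 = lam.
    apply: contrapT => nk; case: elam => u Eu; apply.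
    have m0 : m = 0%N.
      apply/esym/card_eq_II; apply: card_eq_trans cm.
      rewrite II0 (_ : [set k | _] = set0) ?card_eqxx//.
      by apply/seteqP; split => k //= hk; apply: nk; exists k.
    case: dm => e' [_ _ /(_ u Eu)[c hc]]; apply: filterS hc => x ->.
    by rewrite big1// => i _; have := ltn_ord i; rewrite [X in (_ < X)%N]m0.
  have := ev1 k; rewrite kl => /en1[m1 dm1 cm1].
  (* Both dimensions count the same set of indices, the two lists being equal. *)
  have -> : m = m1 by apply/card_eq_II; rewrite card_eq_sym in cm; exact: card_eq_trans cm cm1.
  exact/(Dspace_has_dimP hN M0 hs0 s1 OM1).
Qed.
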